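(* Let $\mathfrak h$ be a finite dimensional complex vector space, $W\subset GL(\mathfrak h)$ a finite subgroup, $c$ a conjugation-invariant complex function on the set of reflections of $W$, and $\lambda\in\mathfrak h^*$. Let $W_\lambda$ be the stabilizer of $\lambda$ in $W$ and let $c'$ be the restriction of $c$ to the set of reflections lying in $W_\lambda$. Then there is a natural equivalence of categories $$\psi_\lambda:\ \mathcal O_c(W,\mathfrak h)_\lambda\ \to\ \mathcal O_{c'}(W_\lambda,\mathfrak h/\mathfrak h^{W_\lambda})_0 .$$
   Context: A reflection in $W$ is an element $s\neq 1$ with $\mathrm{rk}(s-1)=1$; $S$ is the set of reflections. For $s\in S$, $\alpha_s\in\mathfrak h^*$ generates $\mathrm{Im}((s-1)|_{\mathfrak h^*})$, $\alpha_s^\vee\in\mathfrak h$ generates $\mathrm{Im}((s-1)|_{\mathfrak h})$, normalized by $(\alpha_s,\alpha_s^\vee)=2$. The rational Cherednik algebra $H_c(W,\mathfrak h)$ is the quotient of $\mathbb C[W]\ltimes T(\mathfrak h\oplus\mathfrak h^* )$ by the relations $[x,x']=0$, $[y,y']=0$, $[y,x]=(y,x)-\sum_{s\in S}c_s(y,\alpha_s)(x,\alpha_s^\vee)s$ for $x,x'\in\mathfrak h^*$, $y,y'\in\mathfrak h$. It contains the commutative subalgebras $\mathbb C[\mathfrak h]=S\mathfrak h^*$ and $\mathbb C[\mathfrak h^*]=S\mathfrak h$. $\mathcal O_c(W,\mathfrak h)$ is the category of $H_c(W,\mathfrak h)$-modules which are finitely generated over $\mathbb C[\mathfrak h]$ and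 locally finite under $\mathfrak h$. For $\lambda\in\mathfrak h^*$, $\mathcal O_c(W,\mathfrak h)_\lambda$ is the full subcategory of objects on which $\mathbb C[\mathfrak h^*]^W$ acts with generalized eigenvalue $\lambda$ (i.e. $f-f(\lambda)$ acts locally nilpotently for all $f\in\mathbb C[\mathfrak h^*]^W$). Thus $\mathcal O_c(W,\mathfrak h)_0$ is the category of modules finitely generated over $\mathbb C[\mathfrak h]$ on which $\mathfrak h$ acts locally nilpotently. The space $\mathfrak h/\mathfrak h^{W_\lambda}$ is a representation of $W_\lambda$, and the reflections in $W_\lambda$ acting on it are the same elements as the reflections in $W_\lambda$ acting on $\mathfrak h$. *)

(* Defs.v *)
From HB Require Import structures.
From mathcomp Require Import all_boot all_order all_fingroup all_algebra.
From mathcomp Require Import generic_quotient.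
From mathcomp Require Import boolp reals complex.
From mathcomp Require Import mpoly.

Set Implicit Arguments.
Unset Strict Implicit.
Unset Printing Implicit Defensive.

Import GRing.Theory.
Local Open Scope ring_scope.
Local Open Scope quotient_scope.

Record category := Category {
  Ob :> Type;
  Hom : Ob -> Ob -> Type;
  idm : forall X, Hom X X;
  comp : forall X Y Z, Hom Y Z -> Hom X Y -> Hom X Z;
  comp1m : forall X Y (f : Hom X Y), comp (idm Y) f = f;
  compm1 : forall X Y (f : Hom X Y), comp f (idm X) = f;
  compA : forall X Y Z T (f : Hom Z T) (g : Hom Y Z) (h : Hom X Y),
    comp f (comp g h) = comp (comp f g) h }.

Arguments idm {_} X.
Arguments comp {_ X Y Z} _ _.

Record functor (C D : category) := Functor {
  fobj :> C -> D;
  fmap : forall X Y : C, Hom X Y -> Hom (fobj X) (fobj Y);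
  fmap1 : forall X, fmap (idm X) = idm (fobj X);
  fmapD : forall X Y Z (f : Hom Y Z) (g : Hom X Y),
    fmap (comp f g) = comp (fmap f) (fmap g) }.

Arguments fmap {_ _} F {X Y} f : rename.

Definition idF (C : category) : functor C C :=
  @Functor C C id (fun _ _ f => f) (fun _ => erefl) (fun _ _ _ _ _ => erefl).

Program Definition compF (C D E : category) (G : functor D E) (F : functor C D)
    : functor C E :=
  @Functor C E (fun X => G (F X)) (fun _ _ f => fmap G (fmap F f)) _ _.
Next Obligation. by rewrite !fmap1. Qed.
Next Obligation. by rewrite !fmapD. Qed.

Definition nat_iso (C D : category) (F G : functor C D) : Prop :=
  exists (eta : forall X, Hom (F X) (G X)) (eps : forall X, Hom (G X) (F X)),
    [/\ forall X Y (f : Hom X Y),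
          comp (eta Y) (fmap F f) = comp (fmap G f) (eta X),
        forall X, comp (eps X) (eta X) = idm (F X)
      & forall X, comp (eta X) (eps X) = idm (G X)].

Definition is_equivalence (C D : category) (F : functor C D) : Prop :=
  exists G : functor D C,
    nat_iso (compF G F) (idF C) /\ nat_iso (compF F G) (idF D).

(* Algebras presented by generators and relations: formal ring expressions    *)
(* modulo the congruence generated by the axioms of unital associative        *)
(* K-algebras (in which [Cst a] is the scalar a) and the relations [rel].     *)
Section PresentedAlgebra.
Variables (K : fieldType) (X : Type).

Inductive aterm : Type :=
  | Gen of X
  | Cst of K
  | Opp of aterm
  | Add of aterm & aterm
  | Mul of aterm & aterm.

HB.instance Definition _ := gen_eqMixin aterm.
HB.instance Definition _ := gen_choiceMixin aterm.

Variable rel : aterm -> aterm -> Prop.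

Inductive acongr : aterm -> aterm -> Prop :=
  | ac_rel a b : rel a b -> acongr a b
  | ac_refl a : acongr a a
  | ac_sym a b : acongr a b -> acongr b a
  | ac_trans b a c : acongr a b -> acongr b c -> acongr a c
  | ac_opp a a' : acongr a a' -> acongr (Opp a) (Opp a')
  | ac_add a a' b b' :
      acongr a a' -> acongr b b' -> acongr (Add a b) (Add a' b')
  | ac_mul a a' b b' :
      acongr a a' -> acongr b b' -> acongr (Mul a b) (Mul a' b')
  | ac_addA a b c : acongr (Add a (Add b c)) (Add (Add a b) c)
  | ac_addC a b : acongr (Add a b) (Add b a)
  | ac_add0 a : acongr (Add (Cst 0) a) a
  | ac_addN a : acongr (Add (Opp a) a) (Cst 0)
  | ac_mulA a b c : acongr (Mul a (Mul b c)) (Mul (Mul a b) c)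
  | ac_mul1l a : acongr (Mul (Cst 1) a) a
  | ac_mul1r a : acongr (Mul a (Cst 1)) a
  | ac_mulDl a b c : acongr (Mul (Add a b) c) (Add (Mul a c) (Mul b c))
  | ac_mulDr a b c : acongr (Mul a (Add b c)) (Add (Mul a b) (Mul a c))
  | ac_cstD k l : acongr (Cst (k + l)) (Add (Cst k) (Cst l))
  | ac_cstM k l : acongr (Cst (k * l)) (Mul (Cst k) (Cst l))
  | ac_cstC k a : acongr (Mul (Cst k) a) (Mul a (Cst k)).

Definition acongrb (a b : aterm) : bool := `[< acongr a b >].

Lemma acongrb_equiv : equiv_class_of acongrb.
Proof.
split=> [a|a b|b a c].
- by apply/asboolP; apply: ac_refl.
- by apply/asboolP/asboolP => ?; apply: ac_sym.
- by move=> /asboolP ab /asboolP bc; apply/asboolP; apply: ac_trans ab bc.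
Qed.

Canonical acongr_equiv := EquivRelPack acongrb_equiv.

Definition palg : Type := {eq_quot acongr_equiv}.
HB.instance Definition _ := Choice.on palg.
HB.instance Definition _ := EqQuotient.on palg.

Lemma palgP a b : reflect (acongr a b) (\pi_palg a == \pi_palg b).
Proof. by rewrite eqmodE; apply: asboolP. Qed.

Lemma palg_eq a b : acongr a b -> \pi_palg a = \pi_palg b.
Proof. by move=> ab; apply/eqP/palgP. Qed.

Lemma repr_congr a : acongr (repr (\pi_palg a)) a.
Proof. by apply/palgP; rewrite reprK. Qed.

Definition padd (u v : palg) : palg := \pi_palg (Add (repr u) (repr v)).
Definition popp (u : palg) : palg := \pi_palg (Opp (repr u)).
Definition pmul (u v : palg) : palg := \pi_palg (Mul (repr u) (repr v)).
Definition pcst (k : K) : palg := \pi_palg (Cst k).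
Definition pgen (x : X) : palg := \pi_palg (Gen x).

Lemma pi_add a b : \pi_palg (Add a b) = padd (\pi a) (\pi b).
Proof. by apply: palg_eq; apply: ac_add; apply/ac_sym/repr_congr. Qed.
Lemma pi_opp a : \pi_palg (Opp a) = popp (\pi a).
Proof. by apply: palg_eq; apply: ac_opp; apply/ac_sym/repr_congr. Qed.
Lemma pi_mul a b : \pi_palg (Mul a b) = pmul (\pi a) (\pi b).
Proof. by apply: palg_eq; apply: ac_mul; apply/ac_sym/repr_congr. Qed.

Fact paddA : associative padd.
Proof.
elim/quotW=> a; elim/quotW=> b; elim/quotW=> c.
by rewrite -!pi_add; apply/palg_eq/ac_addA.
Qed.
Fact paddC : commutative padd.
Proof.
by elim/quotW=> a; elim/quotW=> b; rewrite -!pi_add; apply/palg_eq/ac_addC.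
Qed.
Fact padd0 : left_id (pcst 0) padd.
Proof. by elim/quotW=> a; rewrite -!pi_add; apply/palg_eq/ac_add0. Qed.
Fact paddN : left_inverse (pcst 0) popp padd.
Proof.
by elim/quotW=> a; rewrite -pi_opp -!pi_add; apply/palg_eq/ac_addN.
Qed.
Fact pmulA : associative pmul.
Proof.
elim/quotW=> a; elim/quotW=> b; elim/quotW=> c.
by rewrite -!pi_mul; apply/palg_eq/ac_mulA.
Qed.
Fact pmul1l : left_id (pcst 1) pmul.
Proof. by elim/quotW=> a; rewrite -!pi_mul; apply/palg_eq/ac_mul1l. Qed.
Fact pmul1r : right_id (pcst 1) pmul.
Proof. by elim/quotW=> a; rewrite -!pi_mul; apply/palg_eq/ac_mul1r. Qed.
Fact pmulDl : left_distributive pmul padd.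
Proof.
elim/quotW=> a; elim/quotW=> b; elim/quotW=> c.
by rewrite -!(pi_mul, pi_add); apply/palg_eq/ac_mulDl.
Qed.
Fact pmulDr : right_distributive pmul padd.
Proof.
elim/quotW=> a; elim/quotW=> b; elim/quotW=> c.
by rewrite -!(pi_mul, pi_add); apply/palg_eq/ac_mulDr.
Qed.

HB.instance Definition _ := GRing.isPzRing.Build palg
  paddA paddC padd0 paddN pmulA pmul1l pmul1r pmulDl pmulDr.

Lemma piD a b : \pi_palg (Add a b) = \pi_palg a + \pi_palg b.
Proof. exact: pi_add. Qed.
Lemma piN a : \pi_palg (Opp a) = - \pi_palg a.
Proof. exact: pi_opp. Qed.
Lemma piM a b : \pi_palg (Mul a b) = \pi_palg a * \pi_palg b.
Proof. exact: pi_mul. Qed.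

Lemma pcst0 : pcst 0 = 0. Proof. by []. Qed.
Lemma pcst1 : pcst 1 = 1. Proof. by []. Qed.
Lemma pcstD k l : pcst (k + l) = pcst k + pcst l.
Proof. by rewrite -[RHS]piD; apply/palg_eq/ac_cstD. Qed.
Lemma pcstM k l : pcst (k * l) = pcst k * pcst l.
Proof. by rewrite -[RHS]piM; apply/palg_eq/ac_cstM. Qed.
Lemma pcstC k u : pcst k * u = u * pcst k.
Proof.
by elim/quotW: u => a; rewrite -[LHS]piM -[RHS]piM; apply/palg_eq/ac_cstC.
Qed.

Lemma palg_rel a b : rel a b -> \pi_palg a = \pi_palg b.
Proof. by move=> ab; apply/palg_eq/ac_rel. Qed.

End PresentedAlgebra.

Section Representations.
Variable K : fieldType.

Record linrep (gT : finGroupType) (V : vectType K) := Repr {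
  rfun :> gT -> 'End(V);
  repr1 : rfun 1%g = \1%VF;
  reprM : forall g h, rfun (g * h)%g = (rfun g \o rfun h)%VF }.

Definition dual (V : vectType K) := 'Hom(V, K^o).

Section Theory.
Variables (gT : finGroupType) (V : vectType K) (rho : linrep gT V).

Definition dual_fun (g : gT) : 'End(dual V) :=
  linfun (fun x : dual V => (x \o rho g^-1%g)%VF).

Lemma dual_funE g x : dual_fun g x = (x \o rho g^-1%g)%VF.
Proof.
have lin : linear (fun x : dual V => (x \o rho g^-1%g)%VF).
  by move=> a u v; rewrite comp_lfunDl comp_lfunZl.
pose f := GRing.isLinear.Build _ _ _ _ _ lin.
pose F : {linear dual V -> dual V} :=
    HB.pack (fun x : dual V => (x \o rho g^-1%g)%VF) f.
exact: (lfunE F).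
Qed.

Fact dual_repr1 : dual_fun 1%g = \1%VF.
Proof.
by apply/lfunP=> x; rewrite dual_funE invg1 repr1 comp_lfun1r id_lfunE.
Qed.

Fact dual_reprM g h : dual_fun (g * h)%g = (dual_fun g \o dual_fun h)%VF.
Proof.
apply/lfunP=> x; rewrite comp_lfunE !dual_funE invMg reprM.
by rewrite comp_lfunA.
Qed.

Definition dual_repr : linrep gT (dual V) := Repr dual_repr1 dual_reprM.

Definition fixed : {vspace V} := (\bigcap_(g : gT) fixedSpace (rho g))%VS.

Lemma fixedP v : reflect (forall g, rho g v = v) (v \in fixed).
Proof.
rewrite /fixed memvE; apply: (iffP subv_bigcapP) => [fv g|fv g _].
  by apply/fixedSpaceP; rewrite memvE; apply: fv.
by rewrite -memvE; apply/fixedSpaceP.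
Qed.

Definition stab_set (v : V) : {set gT} := [set g | rho g v == v].

Fact stab_group_set v : group_set (stab_set v).
Proof.
apply/group_setP; split=> [|g h]; first by rewrite inE repr1 id_lfunE.
by rewrite !inE => /eqP gv /eqP hv; rewrite reprM comp_lfunE hv gv.
Qed.

Definition stab v : {group gT} := Group (stab_group_set v).

Definition res_fun (G : {group gT}) (g : [subg G]) : 'End(V) := rho (sgval g).

Fact res_repr1 G : res_fun (1%g : [subg G]) = \1%VF.
Proof. exact: repr1. Qed.
Fact res_reprM G (g h : [subg G]) :
  res_fun (g * h)%g = (res_fun g \o res_fun h)%VF.
Proof. exact: reprM. Qed.

Definition res_repr G : linrep [subg G] V := Repr (@res_repr1 G) (@res_reprM G).

Definition is_reflection (s : gT) : bool :=
  (s != 1%g) && (\dim (limg (rho s - \1%VF)) == 1%N).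

Definition root (s : gT) : dual V := vpick (limg (dual_repr s - \1%VF)).

Definition coroot (s : gT) : V :=
  let v := vpick (limg (rho s - \1%VF)) in (2 / root s v) *: v.

End Theory.

(* The quotient V / U, realized on the complement U^C provided by the library *)
Section Quotient.
Variables (V : vectType K) (U : {vspace V}).

Definition quotv := subvs_of (U^C)%VS.

Definition qproj : 'Hom(V, quotv) :=
  (linfun (vsproj (U^C)%VS) \o daddv_pi (U^C)%VS U)%VF.

Definition qlift : 'Hom(quotv, V) := linfun (vsval : quotv -> V).

Lemma qliftK q : qproj (qlift q) = q.
Proof.
rewrite !lfunE /= lfunE /= daddv_pi_id ?subvsP ?vsvalK //.
by rewrite capvC capv_compl.
Qed.

Lemma qproj_eq0 v : (qproj v == 0) = (v \in U).
Proof.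
have dU : (U^C :&: U)%VS = 0%VS by rewrite capvC capv_compl.
have dU' := capv_compl U.
rewrite lfunE /= lfunE /= -(inj_eq val_inj) /=.
rewrite vsprojK ?memv_pi //.
apply/eqP/idP => [v0|vU].
  have := daddv_pi_add dU (_ : v \in (U^C + U)%VS).
  rewrite addvC addv_complf memvf v0 add0r => <- //; exact: memv_pi.
apply: (addIr (daddv_pi U (U^C)%VS v)); rewrite daddv_pi_add //.
  by rewrite add0r daddv_pi_id.
by rewrite addvC addv_complf memvf.
Qed.

Lemma lker_qproj : lker qproj = U.
Proof. by apply/vspaceP=> v; rewrite memv_ker qproj_eq0. Qed.

Lemma limg_qproj : limg qproj = fullv.
Proof.
apply/vspaceP=> q; rewrite memvf -(qliftK q); exact: memv_img (memvf _).
Qed.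

Lemma qlift_proj v : qlift (qproj v) - v \in U.
Proof. by rewrite -qproj_eq0 linearB /= qliftK subrr. Qed.

End Quotient.

Section QuotientRepr.
Variables (gT : finGroupType) (V : vectType K) (rho : linrep gT V).
Let U := fixed rho.

Definition quot_fun (g : gT) : 'End(quotv U) :=
  (qproj U \o (rho g \o qlift U))%VF.

Lemma quot_funE g v : quot_fun g (qproj U v) = qproj U (rho g v).
Proof.
have Uv := qlift_proj U v; rewrite comp_lfunE [X in qproj U X]comp_lfunE.
apply/eqP; rewrite -subr_eq0 -(linearB (qproj U)) -(linearB (rho g)) /=.
by rewrite (fixedP _ _ Uv) [_ == 0]qproj_eq0.
Qed.

Fact quot_repr1 : quot_fun 1%g = \1%VF.
Proof. by apply/lfunP=> q; rewrite -(qliftK q) quot_funE repr1 !id_lfunE. Qed.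
Fact quot_reprM g h : quot_fun (g * h)%g = (quot_fun g \o quot_fun h)%VF.
Proof.
apply/lfunP=> q; rewrite -(qliftK q).
by rewrite [RHS]comp_lfunE !quot_funE reprM [X in qproj U X]comp_lfunE.
Qed.

Definition quot_repr : linrep gT (quotv U) := Repr quot_repr1 quot_reprM.

End QuotientRepr.
End Representations.

Section Cherednik.
Variables (K : fieldType) (gT : finGroupType) (V : vectType K).
Variables (W : linrep gT V) (c : gT -> K).

Inductive rca_gen : Type := GenW of gT | GenX of dual V | GenY of V.

Let w (g : gT) : aterm K rca_gen := Gen K (GenW g).
Let x (u : dual V) : aterm K rca_gen := Gen K (GenX u).
Let y (v : V) : aterm K rca_gen := Gen K (GenY v).
Let k (a : K) : aterm K rca_gen := Cst rca_gen a.

(* The relations up to [rca_wy] present the smash product of the group        *)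
(* algebra with the tensor algebra of V + V^*.                                *)
Inductive rca_rel : aterm K rca_gen -> aterm K rca_gen -> Prop :=
  | rca_w1 : rca_rel (w 1%g) (k 1)
  | rca_wM g h : rca_rel (w (g * h)%g) (Mul (w g) (w h))
  | rca_xL a u u' : rca_rel (x (a *: u + u')) (Add (Mul (k a) (x u)) (x u'))
  | rca_yL a v v' : rca_rel (y (a *: v + v')) (Add (Mul (k a) (y v)) (y v'))
  | rca_wx g u : rca_rel (Mul (w g) (x u)) (Mul (x (dual_repr W g u)) (w g))
  | rca_wy g v : rca_rel (Mul (w g) (y v)) (Mul (y (W g v)) (w g))
  | rca_xx u u' : rca_rel (Mul (x u) (x u')) (Mul (x u') (x u))
  | rca_yy v v' : rca_rel (Mul (y v) (y v')) (Mul (y v') (y v))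
  | rca_yx v u : rca_rel
      (Add (Mul (y v) (x u)) (Opp (Mul (x u) (y v))))
      (Add (k (u v)) (Opp (\big[@Add K rca_gen/k 0]_(s | is_reflection W s)
             Mul (k (c s * root W s v * u (coroot W s))) (w s)))).

Definition rca : pzRingType := palg rca_rel.

Definition hcst (a : K) : rca := pcst rca_rel a.
Definition hw (g : gT) : rca := pgen rca_rel (GenW g).
Definition hx (u : dual V) : rca := pgen rca_rel (GenX u).
Definition hy (v : V) : rca := pgen rca_rel (GenY v).

Lemma hyx v u : hy v * hx u - hx u * hy v =
  hcst (u v) - \sum_(s | is_reflection W s)
                  hcst (c s * root W s v * u (coroot W s)) * hw s.
Proof.
have := palg_rel (rca_yx v u); rewrite !(piD, piN, piM) => ->.
congr (_ - _).
rewrite (big_morph (fun t => \pi_(palg rca_rel) t) (@piD _ _ _) (erefl 0)).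
by apply: eq_bigr => s _; rewrite piM.
Qed.

Let n := \dim {:V}.

(* C[V] = Sym V^* and C[V^*] = Sym V are polynomial algebras on the dual      *)
(* basis and on the basis [vbasis fullv] of V; [pevalx] and [pevaly]          *)
(* substitute these basis elements for the indeterminates. The library's      *)
(* [mmap] does not apply, as it requires 1 != 0 in the target ring.           *)
Definition dcoord (i : 'I_n) : dual V :=
  linfun (coord (vbasis {:V}) i : V -> K^o).

Lemma dcoordE i v : dcoord i v = coord (vbasis {:V}) i v.
Proof. exact: lfunE. Qed.

Definition peval (z : 'I_n -> rca) (p : {mpoly K[n]}) : rca :=
  \sum_(m <- msupp p) hcst p@_m * \prod_(i < n) z i ^+ m i.

Definition pevalx : {mpoly K[n]} -> rca :=
  peval (fun i => hx (dcoord i)).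

Definition pevaly : {mpoly K[n]} -> rca :=
  peval (fun i => hy (vbasis {:V})`_i).

Definition dual_eval (f : {mpoly K[n]}) (mu : dual V) : K :=
  f.@[fun i => mu (vbasis {:V})`_i].

Definition dual_invariant (f : {mpoly K[n]}) : Prop :=
  forall g mu, dual_eval f (dual_repr W g mu) = dual_eval f mu.

Section Modules.
Variable M : lmodType rca.

Definition fg_over_Ch : Prop :=
  exists s : seq M, forall m : M, exists p : 'I_(size s) -> {mpoly K[n]},
    m = \sum_(i < size s) pevalx (p i) *: s`_i.

Definition cspan (s : seq M) (m : M) : Prop :=
  exists a : 'I_(size s) -> K, m = \sum_(i < size s) hcst (a i) *: s`_i.

Definition locally_finite_h : Prop :=
  forall m : M, exists s : seq M,
    cspan s m /\ forall (v : V) (m' : M), cspan s m' -> cspan s (hy v *: m').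

Definition acts_loc_nilp (a : rca) : Prop :=
  forall m : M, exists e : nat, a ^+ e *: m = 0.

Definition gen_eigenvalue (lambda : dual V) : Prop :=
  forall f, dual_invariant f ->
    acts_loc_nilp (pevaly f - hcst (dual_eval f lambda)).

End Modules.

Record catO_obj (lambda : dual V) := CatO_obj {
  Omod :> lmodType rca;
  Omod_fg : fg_over_Ch Omod;
  Omod_lf : locally_finite_h Omod;
  Omod_eigen : gen_eigenvalue Omod lambda }.

End Cherednik.

Arguments hcst {K gT V W c} a.
Arguments hw {K gT V W c} g.
Arguments hx {K gT V W c} u.
Arguments hy {K gT V W c} v.

Lemma linear_eq (A : pzRingType) (M N : lmodType A) (f g : {linear M -> N}) :
  f =1 g -> f = g.
Proof.
case: f g => [f [[fD] [fZ]]] [g [[gD] [gZ]]] /= /funext fg.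
by move: fD fZ gD gZ; rewrite fg => fD fZ gD gZ;
  rewrite (Prop_irrelevance fD gD) (Prop_irrelevance fZ gZ).
Qed.

Program Definition catO (K : fieldType) (gT : finGroupType) (V : vectType K)
    (W : linrep gT V) (c : gT -> K) (lambda : dual V) : category :=
  @Category (catO_obj W c lambda) (fun M N => {linear M -> N})
    (fun M => idfun) (fun M N P g f => g \o f) _ _ _.
Next Obligation. exact: linear_eq. Qed.
Next Obligation. exact: linear_eq. Qed.
Next Obligation. exact: linear_eq. Qed.

Section Parabolic.
Variables (K : fieldType) (gT : finGroupType) (V : vectType K).
Variables (W : linrep gT V) (c : gT -> K) (lambda : dual V).

Definition Wstab : {group gT} := stab (dual_repr W) lambda.

Definition Wstab_repr : linrep [subg Wstab] V := res_repr W Wstab.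

Definition Wstab_quot : linrep [subg Wstab] (quotv (fixed Wstab_repr)) :=
  quot_repr Wstab_repr.

Definition Wstab_param (s : [subg Wstab]) : K := c (sgval s).

(* The part of the generalized lambda-eigenspace of h in M on which the       *)
(* subspace of h fixed by the stabilizer acts by lambda itself.               *)
Definition par_subspace (M : lmodType (rca W c)) (m : M) : Prop :=
  (forall v : V, exists e : nat, (hy v - hcst (lambda v : K)) ^+ e *: m = 0) /\
  (forall v : V, v \in fixed Wstab_repr ->
     hy v *: m = hcst (lambda v : K) *: m).

(* Naturality of psi: as a representation of S(h) and of the stabilizer of    *)
(* lambda, psi M is naturally isomorphic to [par_subspace M], the action of h *)
(* being shifted by lambda.                                                   *)
Definition restricts_naturally
    (psi : functor (catO W c lambda) (catO Wstab_quot Wstab_param 0)) : Prop :=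
  exists iota : forall M : catO_obj W c lambda,
      (psi M : catO_obj Wstab_quot Wstab_param 0) -> M,
    (forall M,
      [/\ injective (iota M),
          forall m : M, par_subspace m <-> exists u, iota M u = m,
          forall (a : K) u u', iota M (hcst a *: u + u')
                                 = hcst a *: iota M u + iota M u',
          forall g u, iota M (hw g *: u) = hw (sgval g) *: iota M u
        & forall v u, iota M (hy (qproj (fixed Wstab_repr) v) *: u)
                        = (hy v - hcst (lambda v : K)) *: iota M u]) /\
    (forall (M N : catO_obj W c lambda) (f : {linear M -> N}) u,
      iota N ((fmap psi (f : Hom (M : catO W c lambda) N)
                 : {linear _ -> _}) u) = f (iota M u)).

End Parabolic.

Arguments Wstab_param {K gT V} W c lambda s.

(* Main.v *)
Require Import Defs.
From HB Require Import structures.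
From mathcomp Require Import all_boot all_order all_fingroup all_algebra ring.
From mathcomp Require Import generic_quotient.
From mathcomp Require Import boolp functions reals complex ssrcomplements mpoly.
Require Import Defs.

Set Implicit Arguments.
Unset Strict Implicit.
Unset Printing Implicit Defensive.

Import GRing.Theory.
Local Open Scope ring_scope.

(* On a module M of O_c(W, h)_lambda the space h has finitely many generalized
   weights, all in the orbit W lambda: a polynomial vanishing on the orbit is a
   root of its orbit polynomial, hence acts locally nilpotently, and Lagrange
   polynomials split M into weight spaces.

   If s is a reflection not fixing lambda and b_s spans Im (s - 1), then
   lambda(b_s) <> 0, so y_{b_s} is invertible on the weight space M_lambda and
     X_u = x_u - sum_{s notin W_lambda} k_s u(s b_s) s y_{b_s}^-1
   preserves M_lambda. Here k_s is the scalar with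
   c_s (v, alpha_s) (u, alpha_s^vee) = k_s u(s v - v). With the X_u, M_lambda is
   a module over the Cherednik algebra of W_lambda; the inverse construction
   puts on the W_lambda-equivariant functions F : W -> N the action
     (x_u F)(w) = X_{wu} F(w) + sum_{s notin W_lambda} k_s (wu)(b_s) y_{b_s}^-1 F(s w).
   That these operators commute is a telescoping sum over pairs of reflections,
   invariant under the Hurwitz move (p, q) |-> (p q p^-1, p).

   Finally lambda is fixed by W_lambda, and the directions in h^{W_lambda}
   contribute a Weyl algebra on which y - lambda(y) is locally nilpotent: by
   Taylor expansion the module is polynomial over the joint kernel of the
   y - lambda(y), y in h^{W_lambda}, which is the desired module over the
   Cherednik algebra of h / h^{W_lambda}. *)

(** * Subspaces and linear maps *)
Section Subspaces.
Variable K : fieldType.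

(** The correction terms are forced by the commutators with h. In [y_v, x_u] a reflection s outside
    W_lambda contributes a multiple of s, which moves M_lambda into another weight space. Since y_v
    s = s y_{s^-1 v} and s^-1 v - v is a multiple of b_s, the commutator of y_v with s y_{b_s}^-1 is
    again a multiple of s and can absorb that term. The obstacle is that the X_u must commute, and
    this is not computed on M_lambda. For every N, the commutator of x_u and x_u' on functions,
    evaluated at w, is the commutator of X_{wu} and X_{wu'} on F(w). Functions into M_lambda embed
    in M, where the x_u commute, and the identity is then read backwards; for induction it is read
    forwards. The scalar k_s depends only on c_s and on the eigenvalue of s on Im (s - 1), so it
    survives restriction to W_lambda and passage to h / h^{W_lambda}. Finite generation does not
    pass from x_u to X_u at once, because of the factors s y_{b_s}^-1. Generators are therefore
    enlarged to families stable under the group and h; what they generate is y-stable, hence stable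
    under y_{b_s}^-1. *)

Definition mklin (M N : lmodType K) (f : M -> N) (fL : linear f) :
    {linear M -> N} :=
  HB.pack f (GRing.isLinear.Build K M N *:%R f fL).

Lemma mklinE (M N : lmodType K) (f : M -> N) (fL : linear f) m :
  mklin fL m = f m.
Proof. by []. Qed.

Definition subspace (M : lmodType K) (P : M -> Prop) : Prop :=
  P 0 /\ forall a u v, P u -> P v -> P (a *: u + v).

Section Closure.
Variables (M : lmodType K) (P : M -> Prop).
Hypothesis hP : subspace P.

Lemma subspace0 : P 0. Proof. by case: hP. Qed.
Lemma subspaceZ a u : P u -> P (a *: u).
Proof. by move=> Pu; rewrite -[_ *: _]addr0; apply: hP.2 => //; apply: hP.1. Qed.
Lemma subspaceD u v : P u -> P v -> P (u + v).
Proof. by move=> Pu; rewrite -[u]scale1r; apply: hP.2. Qed.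
Lemma subspaceN u : P u -> P (- u).
Proof. by rewrite -scaleN1r; apply: subspaceZ. Qed.
Lemma subspaceB u v : P u -> P v -> P (u - v).
Proof. by move=> Pu Pv; apply: subspaceD => //; apply: subspaceN. Qed.
Lemma subspace_sum I (r : seq I) (Q : pred I) (F : I -> M) :
  (forall i, Q i -> P (F i)) -> P (\sum_(i <- r | Q i) F i).
Proof. by move=> PF; elim/big_ind: _ => //; [apply: subspace0|apply: subspaceD]. Qed.

Definition subspace_pred : {pred M} := fun m => `[< P m >].

Fact subspace_submod_closed : submod_closed subspace_pred.
Proof.
split=> [|a u v /asboolP Pu /asboolP Pv]; apply/asboolP; first exact: hP.1.
exact: hP.2.
Qed.
End Closure.

Section SubType.
Variables (M : lmodType K) (P : M -> Prop) (hP : subspace P).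

(** The proof of [subspace P] is a dummy argument: it lets the closure instance below be attached to
    the predicate and found from the term alone. *)
Definition subpred_of of subspace P : {pred M} := subspace_pred P.

HB.instance Definition _ := GRing.isSubmodClosed.Build K M (subpred_of hP)
  (subspace_submod_closed hP).

Record submod := Submod { subval :> M; _ : subval \in subpred_of hP }.

HB.instance Definition _ := [isSub for subval].
HB.instance Definition _ := [Choice of submod by <:].
HB.instance Definition _ := [SubChoice_isSubLmodule of submod by <:].

Lemma submodP (u : submod) : P u.
Proof. by case: u => m /= /asboolP. Qed.

Lemma Submod_subproof m : P m -> m \in subpred_of hP.
Proof. by move=> Pm; apply/asboolP. Qed.

Definition tosub m (Pm : P m) : submod := Submod (Submod_subproof Pm).

Lemma submod_inj (u v : submod) : subval u = subval v -> u = v.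
Proof. exact: val_inj. Qed.

Lemma subval_lin : linear (subval : submod -> M).
Proof. exact: (@linearP _ _ _ _ (val : {linear submod -> M})). Qed.

Lemma subvalD (u v : submod) : subval (u + v) = subval u + subval v.
Proof. exact: (raddfD (val : {linear submod -> M})). Qed.
Lemma subvalB (u v : submod) : subval (u - v) = subval u - subval v.
Proof. exact: (raddfB (val : {linear submod -> M})). Qed.
Lemma subvalZ a (u : submod) : subval (a *: u) = a *: subval u.
Proof. exact: (linearZZ (val : {linear submod -> M})). Qed.
Lemma subval0 : subval (0 : submod) = 0.
Proof. exact: (raddf0 (val : {linear submod -> M})). Qed.
Lemma subval_sum I (r : seq I) (Q : pred I) (F : I -> submod) :
  subval (\sum_(i <- r | Q i) F i) = \sum_(i <- r | Q i) subval (F i).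
Proof. exact: (raddf_sum (val : {linear submod -> M})). Qed.
End SubType.

Section SubLin.
Variables (M : lmodType K) (P : M -> Prop) (hP : subspace P).
Variables (N : lmodType K) (f : N -> M) (fL : linear f).
Hypothesis fP : forall m, P (f m).

Definition corestr_fun n : submod hP := tosub hP (fP n).
Fact corestr_linear : linear corestr_fun.
Proof.
move=> a u v; apply: submod_inj.
by rewrite subvalD subvalZ /= fL.
Qed.
Definition corestr : {linear N -> submod hP} := mklin corestr_linear.
End SubLin.

Section Restr.
Variables (M : lmodType K) (P : M -> Prop) (hP : subspace P).
Variables (N : lmodType K) (Q : N -> Prop) (hQ : subspace Q).
Variables (f : M -> N) (fL : linear f).
Hypothesis fPQ : forall m, P m -> Q (f m).

Fact restr_linear : linear (fun u : submod hP => f (subval u)).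
Proof. by move=> a u v; rewrite subvalD subvalZ fL. Qed.
Definition restr : {linear submod hP -> submod hQ} :=
  corestr hQ restr_linear (fun u => fPQ (submodP u)).
End Restr.

Lemma bij_linear (M N : lmodType K) (f : {linear M -> N}) :
  injective f -> (forall n, exists m, f m = n) ->
  exists g : {linear N -> M}, cancel f g /\ cancel g f.
Proof.
move=> finj fsur; pose g n := projT1 (cid (fsur n)).
have gK : cancel g f by move=> n; exact: projT2 (cid (fsur n)).
have gL : linear g by move=> a u v; apply: finj; rewrite linearP !gK.
by exists (mklin gL); split => // m; apply: finj; rewrite mklinE gK.
Qed.
End Subspaces.

(** * Local nilpotence *)
Lemma linBZ (K : fieldType) (M N : lmodType K) (f : {linear M -> N}) a u v :
  f (u - a *: v) = f u - a *: f v.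
Proof. by rewrite raddfB; congr (_ - _); exact: linearZZ. Qed.

Section LocalNilpotence.
Variables (K : fieldType) (M : lmodType K).
Implicit Types (f g : {linear M -> M}) (m : M).

Definition lnil (f : M -> M) m : Prop := exists e, iter e f m = 0.

Lemma iter_lin0 f e : iter e f 0 = 0.
Proof. by elim: e => //= e ->; rewrite linear0. Qed.

Lemma iter_linP f e : linear (iter e f).
Proof. by move=> a u v; elim: e => //= e ->; rewrite linearP. Qed.

Lemma iter_eq0W f e e' m : (e <= e')%N -> iter e f m = 0 -> iter e' f m = 0.
Proof. by move=> /subnK <- e0; rewrite iterD e0 iter_lin0. Qed.

Lemma iter_comm (f g : M -> M) e m :
  (forall m, f (g m) = g (f m)) -> iter e f (g m) = g (iter e f m).
Proof. by move=> fg; elim: e => //= e ->. Qed.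

Lemma lnil_subspace f : subspace (lnil f).
Proof.
split=> [|a u v [e ue] [e' ve]]; first by exists 0%N.
exists (maxn e e'); rewrite iter_linP.
rewrite (iter_eq0W (leq_maxl _ _) ue) (iter_eq0W (leq_maxr _ _) ve).
by rewrite scaler0 addr0.
Qed.

Lemma lnil_comm f g m : (forall m, f (g m) = g (f m)) -> lnil f m -> lnil f (g m).
Proof. by move=> fg [e me]; exists e; rewrite iter_comm // me linear0. Qed.

Lemma lnil_step f m : lnil f (f m) -> lnil f m.
Proof. by case=> e; rewrite -iterSr => me; exists e.+1. Qed.

Lemma lnil_stepW f m : lnil f m -> lnil f (f m).
Proof. by move=> mf; apply: lnil_comm. Qed.

(** Induction on the exponent of d at n: f (g n) is g (d n) plus T n, and f is locally nilpotent on
    the first by induction and on the second by hypothesis. It transports local nilpotence through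
    operators that commute with f up to a controlled term. *)
Lemma lnil_commutator (N : lmodType K) f (d : N -> N) (g : {linear N -> M})
    (T : N -> M) (S : N -> Prop) (n : N) :
  (forall n, S n -> f (g n) = g (d n) + T n) ->
  (forall n, S n -> S (d n)) -> (forall n, S n -> lnil f (T n)) ->
  S n -> (exists e, iter e d n = 0) -> lnil f (g n).
Proof.
move=> fg Sf ST Sn [e]; elim: e n Sn => [|e IH] n Sn /=.
  by move=> ->; rewrite linear0; exists 0%N.
rewrite -iterS iterSr => ne; apply: lnil_step; rewrite fg //.
apply: (subspaceD (lnil_subspace f)); last exact: ST.
by apply: IH => //; apply: Sf.
Qed.

Definition shift f (l : K) : {linear M -> M} :=
  locked (f \- l \*: idfun : {linear M -> M}).

Arguments shift : simpl never.

Lemma shiftE f l m : shift f l m = f m - l *: m.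
Proof. by rewrite /shift -lock. Qed.

Lemma shift_comm f g l l' m : f (g m) = g (f m) ->
  shift f l (shift g l' m) = shift g l' (shift f l m).
Proof.
move=> fg; rewrite !shiftE !linearB !linearZ /= fg !scalerA [l * l']mulrC.
by rewrite -!addrA; congr (_ + _); rewrite addrCA.
Qed.


(** From l m = f m - (f - l) m, where (f - l) m has a smaller exponent and satisfies the same
    hypotheses. With f = y_b it shows that y_b^-1 preserves every y_b-stable subspace. *)
Lemma closed_of_image f l (P : M -> Prop) m : subspace P ->
  (forall m, P m -> P (f m)) -> l != 0 ->
  lnil (shift f l) m -> P (f m) -> P m.
Proof.
move=> hP Pf l0 [e]; elim: e m => [|e IH] m /=.
  by move=> -> _; apply: subspace0.
rewrite -iterS iterSr => me Pfm.
have Pm1 : P (shift f l m).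
  apply: IH => //; rewrite shiftE linearB linearZ /= .
  by apply: subspaceB; [|exact: Pf|apply: subspaceZ].
have -> : m = l^-1 *: (f m - shift f l m).
  by rewrite shiftE opprB addrC subrK scalerA mulVf // scale1r.
by apply: subspaceZ => //; apply: subspaceB.
Qed.

Lemma shift_ker f l m : l != 0 -> lnil (shift f l) m -> f m = 0 -> m = 0.
Proof.
move=> l0 ml fm; apply: (closed_of_image (P := fun m => m = 0)) ml fm => //.
- by split=> // a u v -> ->; rewrite scaler0 addr0.
- by move=> u ->; rewrite linear0.
Qed.

(** Induction on the exponent for l' reduces to a true eigenvector of eigenvalue l', on which f - l
    is the nonzero scalar l' - l. *)
Lemma shift_ker2 f l l' m : l != l' -> lnil (shift f l) m ->
  lnil (shift f l') m -> m = 0.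
Proof.
move=> ll' ml [e]; elim: e m ml => [//|e IH] m ml.
rewrite iterSr => me.
have ml' : lnil (shift f l) (shift f l' m).
  by apply: lnil_comm => // u; apply: shift_comm.
have /eqP := IH _ ml' me; rewrite shiftE subr_eq0 => /eqP fm.
case: ml => e' me'; apply/eqP; move: me'.
have -> : iter e' (shift f l) m = (l' - l) ^+ e' *: m.
  elim: e' => [|e' /= ->]; first by rewrite scale1r.
  by rewrite shiftE linearZ /= fm !scalerA -scalerBl exprS mulrBl [_ * l']mulrC.
move/eqP; rewrite scaler_eq0 expf_eq0 subr_eq0 [l' == l]eq_sym (negPf ll').
by rewrite andbF.
Qed.

(** The finite geometric series for f^-1 in powers of f - l, built one term at a time. *)
Lemma shift_surj f l m : l != 0 -> lnil (shift f l) m -> exists m', f m' = m.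
Proof.
move=> l0 [e]; elim: e m => [|e IH] m /=.
  by move=> ->; exists 0; rewrite linear0.
rewrite -iterS iterSr => /IH[m' fm'].
exists (l^-1 *: (m - m')); rewrite linearZ linearB /= fm' shiftE.
by rewrite opprB addrC subrK scalerA mulVf // scale1r.
Qed.

End LocalNilpotence.
Arguments shift : simpl never.

Lemma shift_inv (K : fieldType) (M : lmodType K) (f : {linear M -> M}) l :
  l != 0 -> (forall m, lnil (shift f l) m) ->
  exists g : {linear M -> M}, cancel f g /\ cancel g f.
Proof.
move=> l0 fl; apply: bij_linear => [m m' /eqP|m]; last exact: shift_surj (fl m).
rewrite -subr_eq0 -linearB => /eqP E; apply/eqP.
by rewrite -subr_eq0; apply/eqP/(shift_ker l0 _ E).
Qed.

(** * Natural isomorphisms and composition of equivalences *)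

Section Cat.

Lemma nat_iso_bij (C D : category) (F G : functor C D)
  (eta : forall X, Hom (F X) (G X)) (eps : forall X, Hom (G X) (F X)) :
  (forall X Y (f : Hom X Y), comp (eta Y) (fmap F f) = comp (fmap G f) (eta X)) ->
  (forall X, comp (eps X) (eta X) = idm (F X) /\ comp (eta X) (eps X) = idm (G X)) ->
  nat_iso F G.
Proof. by move=> n i; exists eta, eps; split=> // X; case: (i X). Qed.

Lemma is_equivalence_comp (C D E : category) (G : functor D E) (F : functor C D) :
  is_equivalence F -> is_equivalence G -> is_equivalence (compF G F).
Proof.
case=> F' [[a [a' [an a'a aa']]] [b [b' [bn b'b bb']]]].
case=> G' [[p [p' [pn p'p pp']]] [q [q' [qn q'q qq']]]].
exists (compF F' G'); split.
- exists (fun X => comp (a X) (fmap F' (p (F X)))).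
  exists (fun X => comp (fmap F' (p' (F X))) (a' X)); split=> /=.
  + move=> X Y f; rewrite -compA -fmapD.
    have /= -> := pn _ _ (fmap F f).
    by rewrite fmapD !compA; have /= -> := an _ _ f.
  + move=> X; rewrite -compA [comp (a' X) _]compA a'a /= comp1m.
    by rewrite -fmapD p'p /= fmap1.
  + move=> X; rewrite -compA [comp (fmap F' (p _)) _]compA -fmapD pp' /=.
    by rewrite fmap1 comp1m aa'.
- exists (fun X => comp (q X) (fmap G (b (G' X)))).
  exists (fun X => comp (fmap G (b' (G' X))) (q' X)); split=> /=.
  + move=> X Y f; rewrite -compA -fmapD.
    have /= -> := bn _ _ (fmap G' f).
    by rewrite fmapD !compA; have /= -> := qn _ _ f.
  + move=> X; rewrite -compA [comp (q' X) _]compA q'q /= comp1m.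
    by rewrite -fmapD b'b /= fmap1.
  + move=> X; rewrite -compA [comp (fmap G (b _)) _]compA -fmapD bb' /=.
    by rewrite fmap1 comp1m qq'.
Qed.

End Cat.

(** * Modules given by operators subject to the Cherednik relations *)

Section Prech.
Variables (K : fieldType) (gT : finGroupType) (V : vectType K).
Variables (W : linrep gT V) (k : gT -> K).

(* [k s] is chosen so that [k s *: (s v - v)] is the term [c_s (v, alpha_s)   *)
(* alpha_s^vee] of the defining relation. Commutation of the [rx] is left     *)
(* out: for the shifted operators on a weight space it is a theorem.          *)
Record prech := Prech {
  pcar :> lmodType K;
  rw : gT -> {linear pcar -> pcar};
  rx : dual V -> {linear pcar -> pcar};
  ry : V -> {linear pcar -> pcar};
  rw1 : forall m, rw 1%g m = m;
  rwM : forall g h m, rw (g * h)%g m = rw g (rw h m);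
  rxL : forall a u u' m, rx (a *: u + u') m = a *: rx u m + rx u' m;
  ryL : forall a v v' m, ry (a *: v + v') m = a *: ry v m + ry v' m;
  rwx : forall g u m, rw g (rx u m) = rx (dual_repr W g u) (rw g m);
  rwy : forall g v m, rw g (ry v m) = ry (W g v) (rw g m);
  ryy : forall v v' m, ry v (ry v' m) = ry v' (ry v m);
  ryx : forall v u m, ry v (rx u m) =
    rx u (ry v m) + (u v : K) *: m
    - \sum_s (k s * (u (W s v - v) : K)) *: rw s m }.

Arguments rw {p} g.
Arguments rx {p} u.
Arguments ry {p} v.

Definition xcomm (M : prech) : Prop :=
  forall u u' (m : M), rx u (rx u' m) = rx u' (rx u m).

Record chmod := Chmod { ch_pre :> prech; ch_xx : xcomm ch_pre }.

Section Theory.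
Variable M : prech.
Implicit Types m : M.

Lemma rxD u u' m : rx (u + u') m = rx u m + rx u' m.
Proof. by rewrite -[u]scale1r rxL !scale1r. Qed.
Lemma rx0 m : rx 0 m = 0.
Proof. by apply: (addrI (rx 0 m)); rewrite -rxD !addr0. Qed.
Lemma rxZ a u m : rx (a *: u) m = a *: rx u m.
Proof. by rewrite -[a *: u]addr0 rxL rx0 addr0. Qed.
Lemma rxB u u' m : rx (u - u') m = rx u m - rx u' m.
Proof. by rewrite rxD -[- u']scaleN1r rxZ scaleN1r. Qed.
Lemma ryD v v' m : ry (v + v') m = ry v m + ry v' m.
Proof. by rewrite -[v]scale1r ryL !scale1r. Qed.
Lemma ry0 m : ry 0 m = 0.
Proof. by apply: (addrI (ry 0 m)); rewrite -ryD !addr0. Qed.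
Lemma ryZ a v m : ry (a *: v) m = a *: ry v m.
Proof. by rewrite -[a *: v]addr0 ryL ry0 addr0. Qed.
Lemma ryB v v' m : ry (v - v') m = ry v m - ry v' m.
Proof. by rewrite ryD -[- v']scaleN1r ryZ scaleN1r. Qed.
Lemma rx_sum I (r : seq I) (Q : pred I) (F : I -> dual V) m :
  rx (\sum_(i <- r | Q i) F i) m = \sum_(i <- r | Q i) rx (F i) m.
Proof.
by apply: (big_morph (fun u => rx u m)) => [u u'|]; [apply: rxD|apply: rx0].
Qed.
Lemma ry_sum I (r : seq I) (Q : pred I) (F : I -> V) m :
  ry (\sum_(i <- r | Q i) F i) m = \sum_(i <- r | Q i) ry (F i) m.
Proof.
by apply: (big_morph (fun u => ry u m)) => [u u'|]; [apply: ryD|apply: ry0].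
Qed.

Definition ysh (mu : dual V) v : {linear M -> M} := shift (ry v) (mu v : K).

Arguments ysh : simpl never.

Lemma yshE mu v m : ysh mu v m = ry v m - (mu v : K) *: m.
Proof. exact: shiftE. Qed.

Definition gwt (mu : dual V) m : Prop := forall v, lnil (ysh mu v) m.

Lemma gwt_subspace mu : subspace (gwt mu).
Proof.
split=> [v|a u u' wu wu' v]; first exact: subspace0 (lnil_subspace _).
by apply: (lnil_subspace _).2.
Qed.

Lemma ysh_comm mu v mu' v' m :
  ysh mu v (ysh mu' v' m) = ysh mu' v' (ysh mu v m).
Proof. by apply: shift_comm; apply: ryy. Qed.

Lemma ysh_ry mu v v' m : ysh mu v (ry v' m) = ry v' (ysh mu v m).
Proof. by rewrite !yshE linBZ ryy. Qed.

Lemma gwt_ry mu v m : gwt mu m -> gwt mu (ry v m).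
Proof. by move=> mw v'; apply: lnil_comm; [exact: ysh_ry|exact: mw]. Qed.

Lemma gwt_ysh mu mu' v m : gwt mu m -> gwt mu (ysh mu' v m).
Proof. by move=> mw v'; apply: lnil_comm; [exact: ysh_comm|exact: mw]. Qed.

Lemma iter_rw_ysh mu g v e m :
  iter e (ysh (dual_repr W g mu) v) (rw g m) =
  rw g (iter e (ysh mu (W g^-1%g v)) m).
Proof.
elim: e => //= e ->; rewrite !yshE linBZ rwy.
congr (_ - _ *: _); last by rewrite dual_funE comp_lfunE.
by rewrite -comp_lfunE -reprM mulgV repr1 id_lfunE.
Qed.

Lemma gwt_rw mu g m : gwt mu m -> gwt (dual_repr W g mu) (rw g m).
Proof.
move=> mw v; have [e me] := mw (W g^-1%g v); exists e.
by rewrite iter_rw_ysh me linear0.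
Qed.

(** Generation is an induction principle over subspaces stable under the [rx], which makes sense
    before these operators are known to commute; [fg_chP] compares it with polynomial
    coefficients. *)
Definition ch_fg : Prop :=
  exists s : seq M, forall P : M -> Prop, subspace P ->
    (forall u m, P m -> P (rx u m)) -> (forall m, m \in s -> P m) ->
    forall m, P m.

(** The sum runs over the group and not over the orbit, so a weight may occur several times;
    independence of distinct weights is a separate fact, [gwt_indep]. *)
Definition ch_eig (lambda : dual V) : Prop :=
  forall m, exists F : gT -> M,
    (forall g, gwt (dual_repr W g lambda) (F g)) /\ m = \sum_g F g.

End Theory.

Arguments ysh : simpl never.

Record chom (M N : prech) := Chom {
  chfun :> {linear M -> N};
  chw : forall g m, chfun (rw g m) = rw g (chfun m);
  chx : forall u m, chfun (rx u m) = rx u (chfun m);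
  chy : forall v m, chfun (ry v m) = ry v (chfun m) }.


Lemma chom_eq (M N : prech) (f g : chom M N) : f =1 g -> f = g.
Proof.
case: f g => [f fw fx fy] [g gw gx gy] /= fg.
have E : f = g by apply: linear_eq.
by case: _ / E in gw gx gy fg *; congr Chom; apply: Prop_irrelevance.
Qed.

Definition chid (M : prech) : chom M M :=
  @Chom M M idfun (fun _ _ => erefl) (fun _ _ => erefl) (fun _ _ => erefl).

Program Definition chcomp (M N P : prech) (f : chom N P) (g : chom M N) :
  chom M P := @Chom M P (f \o g) _ _ _.
Next Obligation. by rewrite !chw. Qed.
Next Obligation. by rewrite !chx. Qed.
Next Obligation. by rewrite !chy. Qed.

Lemma chom_inv (M N : prech) (f : chom M N) :
  injective f -> (forall n, exists m, f m = n) ->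
  exists g : chom N M, chcomp g f = chid M /\ chcomp f g = chid N.
Proof.
move=> finj fsur; have [g [gK fK]] := bij_linear finj fsur.
have gw h n : g (rw h n) = rw h (g n) by apply: finj; rewrite chw !fK.
have gx h n : g (rx h n) = rx h (g n) by apply: finj; rewrite chx !fK.
have gy h n : g (ry h n) = ry h (g n) by apply: finj; rewrite chy !fK.
by exists (Chom gw gx gy); split; apply: chom_eq => m /=; rewrite ?gK ?fK.
Qed.

Lemma chom_gwt (M N : prech) (f : chom M N) mu m : gwt mu m -> gwt mu (f m).
Proof.
move=> mw v; have [e me] := mw v; exists e; rewrite -(linear0 f) -me.
by elim: e {me} => //= e ->; rewrite !yshE linBZ chy.
Qed.

Record chO_obj (lambda : dual V) := ChO_obj {
  cOmod :> chmod;
  cO_fg : ch_fg cOmod;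
  cO_eig : ch_eig cOmod lambda }.

Program Definition chO (lambda : dual V) : category :=
  @Category (chO_obj lambda) (fun M N => chom M N)
    (fun M => chid M) (fun M N P g f => chcomp g f) _ _ _.
Next Obligation. exact: chom_eq. Qed.
Next Obligation. exact: chom_eq. Qed.
Next Obligation. exact: chom_eq. Qed.

Lemma chO_nat_iso (C : category) lambda (F G : functor C (chO lambda))
  (eta : forall X, Hom (F X) (G X)) :
  (forall X Y (f : Hom X Y), comp (eta Y) (fmap F f) = comp (fmap G f) (eta X)) ->
  (forall X, injective (eta X : chom (F X : chO_obj _) (G X : chO_obj _))) ->
  (forall X n, exists m, (eta X : chom (F X : chO_obj _) (G X : chO_obj _)) m = n) ->
  nat_iso F G.
Proof.
move=> n inj sur.
pose inv X := cid (chom_inv (inj X) (sur X)).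
by apply: (@nat_iso_bij _ _ F G eta (fun X => projT1 (inv X))) => // X;
  apply: (projT2 (inv X)).
Qed.

Lemma nat_iso_sym (C D : category) (F G : functor C D) :
  nat_iso F G -> nat_iso G F.
Proof.
case=> a [b [n ba ab]]; exists b, a; split=> // X Y f.
rewrite -[LHS]compm1 -ab -compA [comp (fmap G f) _]compA -n.
by rewrite -compA [LHS]compA ba comp1m.
Qed.

End Prech.

Arguments rw {K gT V W k p} g.
Arguments rx {K gT V W k p} u.
Arguments ry {K gT V W k p} v.
Arguments ysh {K gT V W k M} mu v : simpl never.

(** * The dual action and elements with Im (s - 1) a line *)

Section DualAction.
Variables (K : fieldType) (gT : finGroupType) (V : vectType K).
Variable W : linrep gT V.

Lemma dactE g (u : dual V) v : dual_repr W g u v = u (W g^-1%g v).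
Proof. by rewrite dual_funE comp_lfunE. Qed.

Lemma dualZ (u : dual V) a v : (u (a *: v) : K) = a * (u v : K).
Proof. by rewrite linearZ. Qed.

Lemma dualD (u : dual V) v w : (u (v + w) : K) = (u v : K) + (u w : K).
Proof. by rewrite linearD. Qed.

Lemma dualB (u : dual V) v w : (u (v - w) : K) = (u v : K) - (u w : K).
Proof. by rewrite linearB. Qed.

Lemma dactM g h (u : dual V) :
  dual_repr W (g * h)%g u = dual_repr W g (dual_repr W h u).
Proof. by rewrite reprM comp_lfunE. Qed.

Lemma dact1 (u : dual V) : dual_repr W 1%g u = u.
Proof. by rewrite repr1 id_lfunE. Qed.

Lemma reprMv g h v : W (g * h)%g v = W g (W h v).
Proof. by rewrite reprM comp_lfunE. Qed.

Lemma reprB g v w : W g (v - w) = W g v - W g w.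
Proof. exact: linearB. Qed.

Lemma repr1v v : W 1%g v = v.
Proof. by rewrite repr1 id_lfunE. Qed.

Lemma reprK g v : W g^-1%g (W g v) = v.
Proof. by rewrite -reprMv mulVg repr1v. Qed.

Lemma reprVK g v : W g (W g^-1%g v) = v.
Proof. by rewrite -reprMv mulgV repr1v. Qed.

Definition rvec (s : gT) : V := vpick (limg (W s - \1%VF)).

Definition rank1 (s : gT) := \dim (limg (W s - \1%VF)) == 1%N.

Lemma rank1_line s : rank1 s -> limg (W s - \1%VF) = <[rvec s]>%VS.
Proof.
move=> /eqP d1; apply/esym/eqP; rewrite eqEdim -memvE memv_pick d1 /=.
by rewrite dim_vline vpick0 -dimv_eq0 d1.
Qed.

Lemma rvec_neq0 s : rank1 s -> rvec s != 0.
Proof. by move=> /eqP d1; rewrite vpick0 -dimv_eq0 d1. Qed.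

Lemma rank1P s v : rank1 s -> exists a, W s v - v = a *: rvec s.
Proof.
move=> s1; apply/vlineP; rewrite -(rank1_line s1).
have -> : W s v - v = (W s - \1%VF) v by rewrite add_lfunE opp_lfunE id_lfunE.
exact: memv_img (memvf _).
Qed.

Lemma rank1_inv s v : rank1 s -> exists a, W s^-1%g v - v = a *: rvec s.
Proof.
move=> s1; have [a E] := rank1P (W s^-1%g v) s1; exists (- a).
by rewrite scaleNr -E reprVK opprB.
Qed.

Lemma rank1_ex s : rank1 s -> exists v, W s v - v = rvec s.
Proof.
move=> s1; have : rvec s \in limg (W s - \1%VF) by exact: memv_pick.
by case/memv_imgP=> v _ ->; exists v; rewrite add_lfunE opp_lfunE id_lfunE.
Qed.

(** Both vectors span the line Im (g s g^-1 - 1). Since [rvec] is an arbitrary choice on such a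
    line, conjugation respects it only up to a nonzero scalar. *)
Lemma rvec_conj g s : rank1 s -> rank1 (g * s * g^-1)%g ->
  exists2 a, a != 0 & rvec (g * s * g^-1)%g = a *: W g (rvec s).
Proof.
move=> s1 gs1.
have [v vE] := rank1_ex s1; have [a aE] := rank1P (W g v) gs1.
have gE : W g (rvec s) = a *: rvec (g * s * g^-1)%g.
  by rewrite -vE -aE linearB /= -!reprMv mulgKV.
have a0 : a != 0.
  apply/eqP => a0; move: gE (rvec_neq0 s1); rewrite a0 scale0r => gE.
  by rewrite -(reprK g (rvec s)) gE linear0 eqxx.
by exists a^-1; rewrite ?invr_eq0 // gE scalerA mulVf // scale1r.
Qed.

(** If lambda vanished on Im (s - 1), it would vanish on every s^-1 v - v, and s would fix it. This
    nonvanishing makes y_{b_s} invertible on vectors of weight lambda. *)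
Lemma notin_Wstab lambda s : rank1 s -> s \notin Wstab W lambda ->
  (lambda (rvec s) : K) != 0.
Proof.
move=> s1; apply: contraNneq => l0; rewrite inE; apply/eqP/lfunP=> v.
rewrite dactE; have [a E] := rank1_inv v s1.
apply/eqP; rewrite -subr_eq0 -linearB E linearZ /=.
by apply/eqP; rewrite [X in _ *: X]l0 scaler0.
Qed.

Lemma Wstab_fix lambda g v : g \in Wstab W lambda -> lambda (W g v) = lambda v.
Proof.
move=> /groupVr; rewrite inE => /eqP {2}<-.
by rewrite dactE invgK.
Qed.

End DualAction.

Section InverseY.
Variables (K : fieldType) (gT : finGroupType) (V : vectType K).
Variables (W : linrep gT V) (k : gT -> K) (lambda : dual V).
Variables (N : prech W k) (N_wt : forall m : N, gwt lambda m).

Let lam (v : V) : K := lambda v.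

(** The condition on b sits inside the existential, with the identity as default, so that [Yinv] is
    a total function of b. *)
Lemma Yinv_ex b : exists g : {linear N -> N}, lam b != 0 ->
  cancel (@ry _ _ _ _ _ N b) g /\ cancel g (@ry _ _ _ _ _ N b).
Proof.
have [b0|b0] := boolP (lam b == 0); first by exists idfun.
have [||g hg] := @shift_inv _ _ (@ry _ _ _ _ _ N b) (lam b) => [//|m|].
  exact: N_wt.
by exists g.
Qed.

Definition Yinv b : {linear N -> N} := projT1 (cid (Yinv_ex b)).

Lemma YinvK b m : lam b != 0 -> Yinv b (ry b m) = m.
Proof. by move=> b0; apply: (projT2 (cid (Yinv_ex b)) b0).1. Qed.

Lemma ry_inv b m : lam b != 0 -> ry b (Yinv b m) = m.
Proof. by move=> b0; apply: (projT2 (cid (Yinv_ex b)) b0).2. Qed.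

Lemma Yinv_eq b m n : lam b != 0 -> ry b n = m -> Yinv b m = n.
Proof. by move=> b0 <-; rewrite YinvK. Qed.

Lemma Yinv_ry b v m : lam b != 0 -> Yinv b (ry v m) = ry v (Yinv b m).
Proof. by move=> b0; apply: Yinv_eq => //; rewrite ryy ry_inv. Qed.


Lemma YinvZ a b m : a != 0 -> lam b != 0 -> Yinv (a *: b) m = a^-1 *: Yinv b m.
Proof.
move=> a0 b0; apply: Yinv_eq.
  by rewrite /lam linearZ /= mulf_neq0.
by rewrite ryZ linearZ /= ry_inv // scalerA mulfV // scale1r.
Qed.

Lemma Yinv_closed (P : N -> Prop) b m : subspace P ->
  (forall m, P m -> P (ry b m)) -> lam b != 0 -> P m -> P (Yinv b m).
Proof.
move=> hP Py b0 Pm; apply: (closed_of_image hP Py b0); first exact: N_wt.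
by rewrite ry_inv.
Qed.

End InverseY.

(** * Spans, stable families and generation by the x-operators *)

Section Span.
Variable K : fieldType.

(** The span as an intersection of subspaces: linear maps and inclusions transport it without any
    coefficients. *)
Definition span_of (M : lmodType K) (E : seq M) (m : M) : Prop :=
  forall P, subspace P -> (forall e, e \in E -> P e) -> P m.

Lemma span_subspace (M : lmodType K) (E : seq M) : subspace (span_of E).
Proof.
split=> [P hP _|a u v Eu Ev P hP PE]; first exact: subspace0.
by apply: hP.2; [apply: Eu|apply: Ev].
Qed.

Lemma span_mem (M : lmodType K) (E : seq M) e : e \in E -> span_of E e.
Proof. by move=> eE P _; apply. Qed.

Lemma span_sub (M : lmodType K) (E E' : seq M) m :
  {subset E <= E'} -> span_of E m -> span_of E' m.
Proof. by move=> EE' Em P hP PE; apply: Em => // e /EE'; apply: PE. Qed.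

Lemma subspace_comp (M N : lmodType K) (f : {linear M -> N}) (P : N -> Prop) :
  subspace P -> subspace (fun m => P (f m)).
Proof.
move=> hP; split=> [|a u v]; first by rewrite linear0; apply: hP.1.
by rewrite linearP; apply: hP.2.
Qed.

Lemma span_map (M N : lmodType K) (f : {linear M -> N}) (E : seq M)
    (P : N -> Prop) m :
  subspace P -> (forall e, e \in E -> P (f e)) -> span_of E m -> P (f m).
Proof. by move=> hP PE Em; apply: (Em (fun m => P (f m))) => //; apply: subspace_comp. Qed.

End Span.

Section Generation.
Variables (K : fieldType) (gT : finGroupType) (V : vectType K).
Variables (W : linrep gT V) (k : gT -> K) (M : prech W k).
Implicit Types (E : seq M) (m : M).

Definition yfin m : Prop := exists E,
  m \in E /\ forall e v, e \in E -> span_of E (ry v e).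

Lemma yfin_list (mu : dual V) (r : seq V) m : gwt mu m ->
  exists E, [/\ m \in E, forall e, e \in E -> gwt mu e
    & forall e v, e \in E -> v \in r -> span_of E (ry v e)].
Proof.
move=> mw; elim: r => [|v r [E [mE Ew EY]]].
  by exists [:: m]; split=> [|e|//]; rewrite inE // => /eqP->.
have [J JE] : exists J, forall e, e \in E -> iter J (ysh mu v) e = 0.
  elim: E Ew {mE EY} => [|e E IH] Ew; first by exists 0%N.
  have [|J JE] := IH; first by move=> e' e'E; apply: Ew; rewrite inE e'E orbT.
  have [J' eJ'] := Ew e (mem_head _ _) v.
  exists (maxn J J') => e'; rewrite inE => /predU1P[->|/JE].
    exact: iter_eq0W (leq_maxr _ _) eJ'.
  exact: iter_eq0W (leq_maxl _ _).
pose D j (e : M) := iter j (ysh mu v) e.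
(* The range includes J, where the iterates vanish, so that e itself (j = 0) is listed even when J =
   0. *)
exists [seq D j e | j <- iota 0 J.+1, e <- E].
have inE' j e : e \in E -> (j < J.+1)%N ->
    D j e \in [seq D j e | j <- iota 0 J.+1, e <- E].
  by move=> eE jJ; apply: allpairs_f; rewrite ?mem_iota.
split.
- by rewrite -[m]/(D 0%N m) inE'.
- move=> _ /allpairsP[[j e] /= [_ eE ->]].
  by rewrite /D; elim: j => [|j IH]; [apply: Ew|apply: gwt_ysh].
move=> x v' /allpairsP[[j e]]; rewrite mem_iota add0n => -[/andP[_ jJ] eE ->{x}].
move: jJ eE => /= jJ eE; rewrite inE => /predU1P[->|v'r].
  have -> : ry v (D j e) = (mu v : K) *: D j e + D j.+1 e.
    by rewrite [D j.+1 e]/= yshE addrC subrK.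
  apply: (span_subspace _).2; first by apply: span_mem; apply: inE'.
  have [jJ'|jJ'] := ltnP j J; first by apply: span_mem; apply: inE'.
  have -> : D j.+1 e = 0 by apply: (iter_eq0W (leqW jJ')); apply: JE.
  exact: (span_subspace _).1.
have -> : ry v' (D j e) = D j (ry v' e).
  by rewrite /D (@iter_comm _ _ _ (ry v')) // => n; apply: ysh_ry.
have := EY _ _ eE v'r.
apply: (@span_map _ _ _ (mklin (iter_linP (ysh mu v) j))) => [|e' e'E].
  exact: span_subspace.
by apply: span_mem; apply: inE'.
Qed.

Lemma gwt_yfin mu m : gwt mu m -> yfin m.
Proof.
move=> /(yfin_list (vbasis {:V}))[E [mE _ EY]]; exists E; split=> // e v eE.
rewrite (coord_vbasis (memvf v)) ry_sum; apply: (subspace_sum (span_subspace _)) => i _.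
rewrite ryZ; apply: (subspaceZ (span_subspace _)).
by apply: EY => //; rewrite mem_nth // size_tuple.
Qed.

Definition stable E : Prop :=
  (forall e g, e \in E -> span_of E (rw g e)) /\
  (forall e v, e \in E -> span_of E (ry v e)).

Lemma yfin_seq (s : seq M) : (forall m, m \in s -> yfin m) -> exists E,
  {subset s <= E} /\ forall e v, e \in E -> span_of E (ry v e).
Proof.
elim: s => [|m s IH] ys; first by exists [::].
have [E [mE EY]] := ys m (mem_head _ _).
have [|E' [sE' EY']] := IH; first by move=> m' m's; apply: ys; rewrite inE m's orbT.
exists (E ++ E'); split=> [m'|e v].
  by rewrite inE mem_cat => /predU1P[->|/sE' ->]; rewrite ?mE ?orbT.
rewrite mem_cat => /orP[/EY|/EY'] /(_ v); apply: span_sub => x;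
  by rewrite mem_cat => ->; rewrite ?orbT.
Qed.

(** All translates of a y-stable family are still y-stable, because y_v g = g y_{g^-1 v}. *)
Lemma yfin_stable (s : seq M) : (forall m, m \in s -> yfin m) -> exists E,
  {subset s <= E} /\ stable E.
Proof.
move=> /yfin_seq[E [sE EY]].
exists [seq rw g e | g <- enum gT, e <- E].
have inE' g e : e \in E -> rw g e \in [seq rw g e | g <- enum gT, e <- E].
  by move=> eE; apply: (@allpairs_f _ _ _ (fun g e => rw g e)); rewrite ?mem_enum.
split=> [m /sE mE|]; first by rewrite -[m]rw1 inE'.
split=> [_ h|_ v] /allpairsP[[g e] /= [_ eE ->]].
  by rewrite -rwM; apply: span_mem; apply: inE'.
rewrite -[v](reprVK W g) -rwy.
have := EY _ (W g^-1%g v) eE.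
apply: (@span_map _ _ _ (rw g)) => [|e' e'E]; first exact: span_subspace.
by apply: span_mem; apply: inE'.
Qed.

Definition xgen E m : Prop := forall P, subspace P ->
  (forall u m, P m -> P (rx u m)) -> (forall e, e \in E -> P e) -> P m.

Section XGen.
Variable E : seq M.

Lemma xgen_subspace : subspace (xgen E).
Proof.
split=> [P hP _ _|a u v Eu Ev P hP Px PE]; first exact: hP.1.
by apply: hP.2; [exact: Eu|exact: Ev].
Qed.

Lemma xgen_x u m : xgen E m -> xgen E (rx u m).
Proof. by move=> Em P hP Px PE; apply: (Px); exact: Em. Qed.

Lemma xgen_span m : span_of E m -> xgen E m.
Proof. by move=> Em P hP _; apply: Em. Qed.

Lemma xgen_mem e : e \in E -> xgen E e.
Proof. by move=> eE P _ _; apply. Qed.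

Hypothesis E_st : stable E.

Lemma xgen_w g m : xgen E m -> xgen E (rw g m).
Proof.
move=> Em; apply: (Em (fun m => xgen E (rw g m))) => [|u m' Em'|e eE].
- exact: subspace_comp xgen_subspace.
- by rewrite rwx; apply: xgen_x.
- by apply: xgen_span; apply: E_st.1.
Qed.

Lemma xgen_y v m : xgen E m -> xgen E (ry v m).
Proof.
(* The induction must carry m along with y m: the commutator of y with x produces m and its
   translates. *)
move=> Em; suff [] : xgen E m /\ xgen E (ry v m) by [].
apply: (Em (fun m => xgen E m /\ xgen E (ry v m))) => [|u m' [Em' Em'']|e eE].
- split=> [|a m1 m2 [E1 E1'] [E2 E2']].
    by rewrite linear0; split; apply: xgen_subspace.1.
  by rewrite linearP; split; apply: xgen_subspace.2.
- split; first exact: xgen_x.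
  have hE := xgen_subspace; rewrite ryx; apply: (subspaceB hE).
    apply: (subspaceD hE); last exact: (subspaceZ hE).
    exact: xgen_x.
  by apply: (subspace_sum hE) => s _; apply: (subspaceZ hE); apply: xgen_w.
- by split; [exact: xgen_mem|apply: xgen_span; apply: E_st.2].
Qed.

End XGen.
End Generation.

Lemma ch_fg_chom (K : fieldType) (gT : finGroupType) (V : vectType K)
    (W : linrep gT V) (k : gT -> K) (M N : prech W k) (f : chom M N) :
  (forall n, exists m, f m = n) -> ch_fg M -> ch_fg N.
Proof.
move=> fsur [s hs]; exists (map f s) => P hP Px Ps n.
have [m <-] := fsur n; apply: (hs (fun m => P (f m))) => [|u m'|m' ms].
- exact: subspace_comp.
- by rewrite chx; apply: Px.
- by apply: Ps; apply: map_f.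
Qed.

(** * Commutation of the shifted operators *)
Lemma sum_subg (gT : finGroupType) (G : {group gT}) (M : nmodType) (F : gT -> M) :
  \sum_(r : [subg G]) F (sgval r) = \sum_(r in G) F r.
Proof.
rewrite (reindex_onto (@sgval _ G) (subg G)) => [|r rG]; last exact: subgK.
by apply: eq_bigl => r; rewrite subgP sgvalK eqxx.
Qed.

Section Commutator.
Variables (K : fieldType) (gT : finGroupType) (V : vectType K).
Variables (W : linrep gT V) (k : gT -> K) (lambda : dual V).
Hypothesis k_inv : forall s g, k (g * s * g^-1)%g = k s.
Hypothesis k_rank1 : forall s, k s != 0 -> rank1 W s.

Let Wl := Wstab W lambda.
Let kl (s : [subg Wl]) : K := k (sgval s).
Let lam (v : V) : K := lambda v.
Let b s := rvec W s.

Variables (N : prech (Wstab_repr W lambda) kl).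
Hypothesis N_wt : forall m : N, gwt lambda m.

Notation Yi := (Yinv N_wt).

Let YiZ v a m : Yi v (a *: m) = a *: Yi v m. Proof. exact: linearZZ. Qed.

Lemma rw_Yinv (g : [subg Wl]) v m : lam v != 0 ->
  rw g (Yi v m) = Yi (W (sgval g) v) (rw g m).
Proof.
move=> v0; apply/esym/Yinv_eq; first by rewrite Wstab_fix ?subgP.
by rewrite -[W _]/(Wstab_repr W lambda g) -rwy ry_inv.
Qed.

Lemma lam_rvec s : k s != 0 -> s \notin Wl -> lam (b s) != 0.
Proof. by move=> ks0 sW; apply: notin_Wstab => //; apply: k_rank1. Qed.

(** Rescaling b_s changes the factor u(b_s) and the inverse operator in opposite ways, so the
    operator depends on the line Im (s - 1) only. *)
Definition dop (s : gT) (u : dual V) (m : N) : N :=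
  (k s * (u (b s) : K)) *: Yi (b s) m.

Section Omega.
Variables (u u' : dual V).

(** The alternating form u wedge u', which is what antisymmetrizing in u and u' produces. *)
Definition omega (v w : V) : K := (u v : K) * (u' w : K) - (u' v : K) * (u w : K).

(* Three vectors of a plane satisfy the Pluecker relation. Dividing by the     *)
(* invertible operators [ry x], [ry y], [ry z] it becomes [omega_phi], which   *)
(* makes the quadratic terms of the commutator telescope.                      *)
Lemma plucker (e f : V) x1 x2 y1 y2 z1 z2 :
  let x := x1 *: e + x2 *: f in let y := y1 *: e + y2 *: f in
  let z := z1 *: e + z2 *: f in
  omega x y *: z = omega x z *: y - omega y z *: x.
Proof.
have omE p1 p2 q1 q2 : omega (p1 *: e + p2 *: f) (q1 *: e + q2 *: f)
    = (p1 * q2 - p2 * q1) * omega e f.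
  have ev (t : dual V) a c : (t (a *: e + c *: f) : K) = a * (t e : K) + c * (t f : K).
    by rewrite dualD !dualZ.
  by rewrite /omega !ev; ring.
rewrite /= !omE; move: (omega e f) => o.
rewrite !scalerDr !scalerA opprD addrACA -!scalerBl.
by congr (_ *: _ + _ *: _); ring.
Qed.

(** As a fraction this is omega(v, z) / (v z), unchanged when v is multiplied by a nonzero
    scalar. *)
Definition phi (z v : V) (m : N) : N := omega v z *: Yi v (Yi z m).

Lemma omega_phi x y z m : lam x != 0 -> lam y != 0 -> lam z != 0 ->
  omega x y *: z = omega x z *: y - omega y z *: x ->
  omega x y *: Yi x (Yi y m) = phi z x m - phi z y m.
Proof.
move=> x0 y0 z0 E; set n := Yi x (Yi y (Yi z m)).
have -> : Yi x (Yi y m) = ry z n by rewrite -!(Yinv_ry N_wt) // YinvK.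
rewrite -ryZ E ryB !ryZ /phi.
have -> : ry y n = Yi x (Yi z m) by rewrite -(Yinv_ry N_wt) // ry_inv.
by congr (_ - _ *: _); rewrite /n ry_inv.
Qed.

End Omega.

(** This is [x, y^-1] = y^-1 [y, x] y^-1, with the defining relation inserted for [y, x]. *)
Lemma rx_Yinv u v m : lam v != 0 -> rx u (Yi v m) =
  Yi v (rx u m) + (u v : K) *: Yi v (Yi v m)
  - \sum_(r : [subg Wl]) (kl r * (u (W (sgval r) v - v) : K)) *: Yi v (rw r (Yi v m)).
Proof.
move=> v0; rewrite -[LHS](YinvK N_wt _ v0) ryx ry_inv //.
rewrite linearB linearD /= linearZZ linear_sum /=; congr (_ - _).
by apply: eq_bigr => r _; rewrite linearZZ.
Qed.

(** Moving x past y_{b_t}^-1 yields x-terms, a scalar term and group terms. The first two are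
    symmetric in u and u', so only the elements of the stabilizer survive antisymmetrization. *)
Lemma dop_commutator u u' t m : t \notin Wl ->
  (rx u (dop t u' m) + dop t u (rx (dual_repr W t u') m))
  - (rx u' (dop t u m) + dop t u' (rx (dual_repr W t u) m)) =
  - \sum_(r : [subg Wl]) (k t * kl r * omega u u' (W (sgval r) (b t)) (b t)) *:
      Yi (b t) (Yi (W (sgval r) (b t)) (rw r m)).
Proof.
move=> tW; have [kt0|kt0] := eqVneq (k t) 0.
  rewrite /dop kt0 !mul0r !scale0r !linear0 !addr0 subrr big1 ?oppr0 // => r _.
  by rewrite !mul0r scale0r.
have b0 := lam_rvec kt0 tW; set v := b t in b0 *.
rewrite /dop !linearZZ !rx_Yinv // -/v.
(* The form t u - u is u(b_t) times a linear form independent of u, so both sides have the same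
   coefficient u(b_t) u'(b_t). *)
have E1 : (u v : K) *: (rx (dual_repr W t u') m - rx u' m) =
          (u' v : K) *: (rx (dual_repr W t u) m - rx u m).
  rewrite -!rxB -!rxZ; congr (rx _ m); apply/lfunP => z.
  rewrite !scale_lfunE !add_lfunE !opp_lfunE !dactE -!linearB.
  have [a ->] := rank1_inv z (k_rank1 kt0).
  change ((u v : K) * (u' (a *: v) : K) = (u' v : K) * (u (a *: v) : K)).
  by rewrite !dualZ; ring.
have E2 : (u' v : K) *: Yi v (rx u m) + (u v : K) *: Yi v (rx (dual_repr W t u') m)
    = (u v : K) *: Yi v (rx u' m) + (u' v : K) *: Yi v (rx (dual_repr W t u) m).
  move/(congr1 (Yi v)): E1; rewrite !linearZZ ![Yi v (_ - _)]linearB => E1.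
  move: E1; rewrite !scalerBr => /(canRL (subrK _)) ->.
  by rewrite addrA [X in X + _]addrC subrK addrC.
have aux (x x' : K) (X Z S1 X1 X' S2 X1' : N) :
    x' *: X + x *: X1 = x *: X' + x' *: X1' ->
    (k t * x') *: (X + x *: Z - S1) + (k t * x) *: X1
    - ((k t * x) *: (X' + x' *: Z - S2) + (k t * x') *: X1')
    = k t *: (x *: S2 - x' *: S1).
  move=> E; rewrite -!scalerA -!scalerDr -scalerBr; congr (_ *: _).
  rewrite !scalerBr !scalerDr [x' *: X + _ - _ + _]addrAC.
  rewrite [x' *: X + _ + x *: X1]addrAC E.
  rewrite [x *: X' + _ - _ + _]addrAC [x *: X' + _ + x' *: X1']addrAC.
  by rewrite !scalerA [x * x']mulrC opprB [LHS]addrC addrA subrK.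
rewrite aux // !scaler_sumr -sumrB scaler_sumr -sumrN; apply: eq_bigr => r _.
rewrite rw_Yinv // !scalerA -scalerBl scalerA -scaleNr; congr (_ *: _).
by rewrite !dualB /omega; ring.
Qed.

(** s^-1 b_t is b_t plus a multiple of b_s, and the contribution of that multiple is symmetric in u
    and u'. *)
Lemma dop_dop u u' s t m : s \notin Wl -> t \notin Wl ->
  dop s u (dop t (dual_repr W s u') m) - dop s u' (dop t (dual_repr W s u) m) =
  (k s * k t * omega u u' (b s) (b t)) *: Yi (b s) (Yi (b t) m).
Proof.
move=> sW tW; have [ks0|ks0] := eqVneq (k s) 0.
  by rewrite /dop ks0 !mul0r !scale0r subrr.
rewrite /dop !YiZ !scalerA -scalerBl; congr (_ *: _).
have [a E] := rank1_inv (b t) (k_rank1 ks0).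
have {}E : W s^-1%g (b t) = b t + a *: b s by rewrite -E addrC subrK.
by rewrite !dactE E !dualD !dualZ /omega; ring.
Qed.

(* The auxiliary vector depends on the plane only, so that it is unchanged by  *)
(* the Hurwitz move (p, q) |-> (p q p^-1, p).                                  *)
Definition test_vec (Q : {vspace V}) : V :=
  if pselect (exists2 z, z \in Q & lam z != 0) is left ex then projT1 (cid2 ex)
  else 0.

Lemma test_vecP (Q : {vspace V}) z : z \in Q -> lam z != 0 ->
  test_vec Q \in Q /\ lam (test_vec Q) != 0.
Proof.
move=> zQ z0; rewrite /test_vec; case: pselect => [ex|[]]; last by exists z.
by case: (cid2 ex).
Qed.

Definition plane (p q : gT) : {vspace V} := (<[b p]> + <[b q]>)%VS.

Lemma planeP p q v : v \in plane p q -> exists x y, v = x *: b p + y *: b q.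
Proof.
by case/memv_addP=> _ /vlineP[x ->] [_ /vlineP[y ->] ->]; exists x, y.
Qed.

Section Hurwitz.
Variables (u u' : dual V) (f : gT -> N).
Hypothesis f_eqv : forall (g : [subg Wl]) w, f (sgval g * w)%g = rw g (f w).

(** Every ingredient except b_s depends only on k_p k_q, on the plane of b_p and b_q and on the
    product p q, all of which the Hurwitz move preserves. Only s outside the stabilizer is used,
    since lambda(b_s) = 0 for s inside. *)
Definition tele (p q s : gT) : N :=
  (k p * k q) *: phi u u' (test_vec (plane p q)) (b s) (f (p * q)%g).

Lemma tele_B s t : s \notin Wl -> t \notin Wl ->
  (k s * k t * omega u u' (b s) (b t)) *: Yi (b s) (Yi (b t) (f (t * s)%g)) =
  tele t s s - tele t s t.
Proof.
move=> sW tW; rewrite /tele -scalerBr.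
have [->|ks0] := eqVneq (k s) 0; first by rewrite mulr0 !mul0r !scale0r.
have [->|kt0] := eqVneq (k t) 0; first by rewrite mulr0 !mul0r !scale0r.
have bs0 := lam_rvec ks0 sW; have bt0 := lam_rvec kt0 tW.
have bsP : b s \in plane t s by apply: (subvP (addvSr _ _)); apply: memv_line.
have [zP z0] := test_vecP bsP bs0; have [x [y E]] := planeP zP.
rewrite -scalerA [k s * _]mulrC; congr (_ *: _).
apply: omega_phi => //; rewrite E.
have:= plucker u u' (b t) (b s) 0 1 1 0 x y.
by rewrite /= !scale1r !scale0r add0r addr0.
Qed.

Lemma rvec_conj_k p q : k p != 0 -> k q != 0 ->
  exists2 a, a != 0 & b (p * q * p^-1)%g = a *: W p (b q).
Proof. by move=> p0 q0; apply: rvec_conj; apply: k_rank1; rewrite ?k_inv. Qed.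

(** The vector of p q p^-1 is proportional to p b_q, which differs from b_q by a multiple of b_p. *)
Lemma plane_conj p q : k p != 0 -> k q != 0 ->
  plane (p * q * p^-1)%g p = plane p q.
Proof.
move=> p0 q0; have [a a0 E] := rvec_conj_k p0 q0.
have [c E'] := rank1P (b q) (k_rank1 p0).
have {}E' : W p (b q) = b q + c *: b p by rewrite -E' addrC subrK.
have memL v w : v \in (<[v]> + <[w]>)%VS by apply: (subvP (addvSl _ _)); apply: memv_line.
have memR v w : w \in (<[v]> + <[w]>)%VS by apply: (subvP (addvSr _ _)); apply: memv_line.
apply/eqP; rewrite eqEsubv /plane !subv_add -!memvE memL memR /= andbT.
apply/andP; split; first by rewrite E E' rpredZ // rpredD ?rpredZ ?memL ?memR.
have -> : b q = a^-1 *: b (p * q * p^-1)%g - c *: b p.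
  by rewrite E E' scalerA mulVf // scale1r addrK.
by rewrite rpredB ?rpredZ ?memL ?memR.
Qed.

Lemma phi_conj z p q m : k p != 0 -> k q != 0 -> lam (W p (b q)) != 0 ->
  phi u u' z (b (p * q * p^-1)%g) m = phi u u' z (W p (b q)) m.
Proof.
move=> p0 q0 l0; have [a a0 ->] := rvec_conj_k p0 q0.
rewrite /phi YinvZ // scalerA; congr (_ *: _).
by rewrite /omega !dualZ; field.
Qed.

(** Equivariance turns r f(t) into f(r t), and r t = (r t r^-1) r, so both terms sit over the same
    product. The vectors b_t and r b_t lie in the plane of b_r and b_t, where the Pluecker relation
    applies. *)
Lemma tele_A (r : [subg Wl]) t : t \notin Wl ->
  - (k t * kl r * omega u u' (W (sgval r) (b t)) (b t)) *:
    Yi (b t) (Yi (W (sgval r) (b t)) (rw r (f t))) =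
  tele (sgval r) t t - tele (sgval r * t * (sgval r)^-1)%g (sgval r) (sgval r * t * (sgval r)^-1)%g.
Proof.
move=> tW; rewrite /tele mulgKV k_inv /kl.
have [->|ks0] := eqVneq (k (sgval r)) 0; first by rewrite mulr0 !mul0r oppr0 !scale0r subrr.
have [->|kt0] := eqVneq (k t) 0; first by rewrite mulr0 !mul0r oppr0 !scale0r subrr.
rewrite plane_conj // -f_eqv [k t * _]mulrC -scalerBr -mulrN -scalerA.
congr (_ *: _).
have bt0 := lam_rvec kt0 tW.
have rbt0 : lam (W (sgval r) (b t)) != 0 by rewrite /lam Wstab_fix ?subgP.
rewrite phi_conj //.
have btP : b t \in plane (sgval r) t by apply: (subvP (addvSr _ _)); apply: memv_line.
have [zP z0] := test_vecP btP bt0; have [x [y E]] := planeP zP.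
have -> : - omega u u' (W (sgval r) (b t)) (b t) = omega u u' (b t) (W (sgval r) (b t)).
  by rewrite /omega; ring.
apply: omega_phi => //; rewrite E.
have [c E'] := rank1P (b t) (k_rank1 ks0).
have {}E' : W (sgval r) (b t) = c *: b (sgval r) + b t by rewrite -E' subrK.
have:= plucker u u' (b (sgval r)) (b t) 0 1 c 1 x y.
by rewrite /= !scale1r !scale0r add0r E'.
Qed.

(** The move sends (p, q) to a pair whose second entry is p and keeps the rest of [tele], so the
    terms marked by the second entry become those marked by the first. *)
Lemma tele_hurwitz :
  \sum_(q | q \notin Wl) \sum_p tele p q q = \sum_(p | p \notin Wl) \sum_q tele p q p.
Proof.
rewrite (pair_big_dep _ (fun _ _ => true) (fun q p => tele p q q)) /=.
rewrite (pair_big_dep _ (fun _ _ => true) (fun p q => tele p q p)) /=.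
pose hu (x : gT * gT) := (x.1, (x.1 * x.2 * x.1^-1)%g).
pose hv (x : gT * gT) := (x.1, (x.1^-1 * x.2 * x.1)%g).
rewrite (reindex hu); last first.
  exists hv; move=> [p q] _; rewrite /hu /hv /= !mulgA.
    by rewrite mulVg mul1g mulgKV.
  by rewrite mulgV mul1g mulgK.
apply: eq_big => [[p q] //|[p q] /= _].
rewrite /tele mulgKV k_inv [k q * _]mulrC.
have [->|p0] := eqVneq (k p) 0; first by rewrite mul0r !scale0r.
have [->|q0] := eqVneq (k q) 0; first by rewrite mulr0 !scale0r.
by rewrite plane_conj.
Qed.

(** All of x_u x_u' F at a point except the leading term X_u X_u', with f(s) the value of F at the
    s-translate of that point. *)
Definition xx_rest (u u' : dual V) : N :=
  \sum_(t | t \notin Wl) (rx u (dop t u' (f t)) + dop t u (rx (dual_repr W t u') (f t)))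
  + \sum_(s | s \notin Wl) \sum_(t | t \notin Wl)
      dop s u (dop t (dual_repr W s u') (f (t * s)%g)).

(** The mixed terms give pairs with one entry in the stabilizer, the double sum gives pairs with
    none. Together they fill the two sums of [tele_hurwitz], whose difference is zero. *)
Lemma xx_rest_sym : xx_rest u u' = xx_rest u' u.
Proof.
have splitW (F : gT -> N) :
    \sum_(r in Wl) F r + \sum_(r | r \notin Wl) F r = \sum_r F r.
  by rewrite [RHS](bigID (mem Wl)).
apply/eqP; rewrite -subr_eq0 /xx_rest opprD addrACA -!sumrB.
under eq_bigr => t tW.
  rewrite dop_commutator // -sumrN.
  under eq_bigr => r _ do rewrite -scaleNr tele_A //.
  rewrite (sum_subg Wl (fun r => tele r t t - tele (r * t * r^-1)%g r (r * t * r^-1)%g)).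
  rewrite sumrB; over.
under [X in _ + X]eq_bigr => s sW.
  rewrite -sumrB.
  under eq_bigr => t tW do rewrite dop_dop // tele_B //.
  rewrite sumrB; over.
rewrite !sumrB addrACA -opprD.
have -> : \sum_(t | t \notin Wl) \sum_(r in Wl) tele r t t
    + \sum_(s | s \notin Wl) \sum_(t | t \notin Wl) tele t s s
    = \sum_(q | q \notin Wl) \sum_p tele p q q.
  by rewrite -big_split; apply: eq_bigr => t _; apply: splitW.
have -> : \sum_(t | t \notin Wl) \sum_(r in Wl)
      tele (r * t * r^-1)%g r (r * t * r^-1)%g
    + \sum_(s | s \notin Wl) \sum_(t | t \notin Wl) tele t s t
    = \sum_(p | p \notin Wl) \sum_q tele p q p.
  rewrite exchange_big.
  (* Conjugation by r in the stabilizer permutes the complement of the stabilizer. *)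
  have conj r : r \in Wl ->
      \sum_(t | t \notin Wl) tele (r * t * r^-1)%g r (r * t * r^-1)%g
      = \sum_(t | t \notin Wl) tele t r t.
    move=> rW; rewrite [RHS](reindex (fun t => r * t * r^-1)%g); last first.
      exists (fun t => r^-1 * t * r)%g; move=> t _; rewrite !mulgA.
        by rewrite mulVg mul1g mulgKV.
      by rewrite mulgV mul1g mulgK.
    by apply: eq_bigl => t; rewrite groupMr ?groupV // groupMl.
  rewrite (eq_bigr _ conj).
  under [RHS]eq_bigr => t _ do rewrite -splitW.
  by rewrite big_split; congr (_ + _); apply: exchange_big.
by rewrite tele_hurwitz subrr.
Qed.

End Hurwitz.
End Commutator.

(** * Induction from the stabilizer *)
Section FunMod.
Variables (K : fieldType) (gT : finGroupType) (V : vectType K).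
Variables (W : linrep gT V) (k : gT -> K) (lambda : dual V).
Hypothesis k_inv : forall s g, k (g * s * g^-1)%g = k s.
Hypothesis k_rank1 : forall s, k s != 0 -> rank1 W s.

Let Wl := Wstab W lambda.
Let kl (s : [subg Wl]) : K := k (sgval s).
Let lam (v : V) : K := lambda v.
Let b s := rvec W s.

Variables (N : prech (Wstab_repr W lambda) kl).
Hypothesis N_wt : forall m : N, gwt lambda m.

Notation Yi := (Yinv N_wt).
Notation dop := (dop N_wt).

Lemma dop_lin s u : linear (dop s u).
Proof. by move=> a m m'; rewrite /dop linearP scalerDr !scalerA mulrC. Qed.

Definition dopl s u : {linear N -> N} := mklin (dop_lin s u).

Lemma dop_linl s a u u' m : dop s (a *: u + u') m = a *: dop s u m + dop s u' m.
Proof.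
rewrite /dop scalerA -scalerDl; congr (_ *: _).
have -> : ((a *: u + u') (rvec W s) : K) = a * (u (rvec W s) : K) + (u' (rvec W s) : K).
  by rewrite add_lfunE scale_lfunE.
by ring.
Qed.

Lemma rw_dop (g : [subg Wl]) s u m : s \notin Wl ->
  rw g (dop s u m) =
  dop (sgval g * s * (sgval g)^-1)%g (dual_repr W (sgval g) u) (rw g m).
Proof.
move=> sW; rewrite /dop k_inv.
have [->|ks0] := eqVneq (k s) 0; first by rewrite !mul0r !scale0r linear0.
have bs0 := lam_rvec k_rank1 ks0 sW.
have [|a a0 ->] := @rvec_conj _ _ _ W (sgval g) s (k_rank1 ks0).
  by apply: k_rank1; rewrite k_inv.
rewrite YinvZ //; last by rewrite Wstab_fix ?subgP.
rewrite scalerA dactE [W _ (_ *: _)]linearZ /= reprK dualZ linearZZ rw_Yinv //.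
by congr (_ *: _); field.
Qed.

(** s v - v is a multiple of b_s, and y_{b_s} cancels the inverse inside [dop]; the scalar left over
    is the reflection term of s in the relation for [y_v, x_u]. *)
Lemma ry_dop s u v m : s \notin Wl ->
  ry v (dop s u m) = dop s u (ry (W s v) m) - (k s * (u (W s v - v) : K)) *: m.
Proof.
move=> sW; rewrite /dop.
have [->|ks0] := eqVneq (k s) 0; first by rewrite !mul0r !scale0r linear0 subr0.
have bs0 := lam_rvec k_rank1 ks0 sW.
have [a E] := rank1P v (k_rank1 ks0).
have {1}-> : W s v = v + a *: rvec W s by rewrite -E addrC subrK.
rewrite E linearZZ ryD ryZ linearD linearZZ YinvK // scalerDr scalerA dualZ.
by rewrite (Yinv_ry N_wt) // -addrA -scalerBl -[LHS]addr0; congr (_ + _);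
  rewrite (_ : _ - _ = 0) ?scale0r //; ring.
Qed.

Definition fun_eqv (F : gT -> N) : Prop :=
  forall (g : [subg Wl]) w, F (sgval g * w)%g = rw g (F w).

Fact fun_eqv_subspace : subspace fun_eqv.
Proof.
split=> [g w|a F G hF hG g w]; first by rewrite linear0.
by rewrite !fctE hF hG linearP.
Qed.

Definition funmod : lmodType K := submod fun_eqv_subspace.

(* The structure induced on equivariant functions; [dop s] is k_s x(b_s)       *)
(* y_{b_s}^-1, where b_s spans the image of s - 1.                             *)
Definition fw (h : gT) (F : gT -> N) : gT -> N := fun w => F (w * h)%g.
Definition fy (v : V) (F : gT -> N) : gT -> N := fun w => ry (W w v) (F w).
Definition fx (u : dual V) (F : gT -> N) : gT -> N := fun w =>
  rx (dual_repr W w u) (F w)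
  + \sum_(s | s \notin Wl) dop s (dual_repr W w u) (F (s * w)%g).

Fact fw_lin h : linear (fw h). Proof. by []. Qed.
Fact fy_lin v : linear (fy v).
Proof. by move=> a F G; apply/funext => w; rewrite /fy !fctE linearP. Qed.
Fact fx_lin u : linear (fx u).
Proof.
move=> a F G; apply/funext => w; rewrite /fx !fctE linearP /= scalerDr addrACA.
congr (_ + _); rewrite scaler_sumr -big_split; apply: eq_bigr => s _.
by rewrite dop_lin.
Qed.

Fact fw_eqv h F : fun_eqv F -> fun_eqv (fw h F).
Proof. by move=> hF g w; rewrite /fw -mulgA hF. Qed.
Fact fy_eqv v F : fun_eqv F -> fun_eqv (fy v F).
Proof. by move=> hF g w; rewrite /fy hF rwy reprMv. Qed.
Fact fx_eqv u F : fun_eqv F -> fun_eqv (fx u F).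
Proof.
move=> hF g w; have inW s : (sgval g * s * (sgval g)^-1 \in Wl)%g = (s \in Wl).
  by rewrite groupMr ?groupV ?subgP // groupMl ?subgP.
rewrite /fx linearD linear_sum /= rwx hF dactM; congr (_ + _).
rewrite (reindex (fun s => sgval g * s * (sgval g)^-1)%g); last first.
  exists (fun t => (sgval g)^-1 * t * sgval g)%g; move=> t _; rewrite !mulgA.
    by rewrite mulVg mul1g mulgKV.
  by rewrite mulgV mul1g mulgK.
apply: eq_big => [s|s sW]; first by congr (~~ _); exact: inW.
rewrite rw_dop; last by rewrite -inW.
by rewrite mulgA mulgKV -[(_ * s * w)%g]mulgA hF.
Qed.

Definition fwl h : {linear funmod -> funmod} := restr _ _ (fw_lin h) (@fw_eqv h).
Definition fyl v : {linear funmod -> funmod} := restr _ _ (fy_lin v) (@fy_eqv v).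
Definition fxl u : {linear funmod -> funmod} := restr _ _ (fx_lin u) (@fx_eqv u).

Lemma funmod_eq (F G : funmod) : (forall w, subval F w = subval G w) -> F = G.
Proof. by move=> FG; apply/submod_inj/funext. Qed.

Lemma fwlE h F w : subval (fwl h F) w = subval F (w * h)%g. Proof. by []. Qed.
Lemma fylE v F w : subval (fyl v F) w = ry (W w v) (subval F w). Proof. by []. Qed.
Lemma fxlE u F w : subval (fxl u F) w = rx (dual_repr W w u) (subval F w)
  + \sum_(s | s \notin Wl) dop s (dual_repr W w u) (subval F (s * w)%g).
Proof. by []. Qed.
Lemma funmodP (F : funmod) (g : [subg Wl]) w :
  subval F (sgval g * w)%g = rw g (subval F w).
Proof. exact: (submodP F). Qed.
Lemma fmD (F G : funmod) w : subval (F + G) w = subval F w + subval G w.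
Proof. by rewrite subvalD. Qed.
Lemma fmB (F G : funmod) w : subval (F - G) w = subval F w - subval G w.
Proof. by rewrite subvalB. Qed.
Lemma fmZ a (F : funmod) w : subval (a *: F) w = a *: subval F w.
Proof. by rewrite subvalZ. Qed.
Lemma fm_sum I (r : seq I) (P : pred I) (F : I -> funmod) w :
  subval (\sum_(i <- r | P i) F i) w = \sum_(i <- r | P i) subval (F i) w.
Proof. by rewrite subval_sum fct_sumE. Qed.

Fact fm_w1 F : fwl 1%g F = F.
Proof. by apply: funmod_eq => w; rewrite fwlE mulg1. Qed.
Fact fm_wM g h F : fwl (g * h)%g F = fwl g (fwl h F).
Proof. by apply: funmod_eq => w; rewrite !fwlE mulgA. Qed.
Fact fm_xL a u u' F : fxl (a *: u + u') F = a *: fxl u F + fxl u' F.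
Proof.
apply: funmod_eq => w; rewrite fmD fmZ !fxlE linearP rxL /= scalerDr addrACA.
congr (_ + _); rewrite scaler_sumr -big_split; apply: eq_bigr => s _.
by rewrite dop_linl.
Qed.
Fact fm_yL a v v' F : fyl (a *: v + v') F = a *: fyl v F + fyl v' F.
Proof. by apply: funmod_eq => w; rewrite fmD fmZ !fylE linearP ryL. Qed.
Fact fm_wx g u F : fwl g (fxl u F) = fxl (dual_repr W g u) (fwl g F).
Proof.
apply: funmod_eq => w; rewrite fwlE !fxlE fwlE dactM; congr (_ + _).
by apply: eq_bigr => s _; rewrite fwlE mulgA.
Qed.
Fact fm_wy g v F : fwl g (fyl v F) = fyl (W g v) (fwl g F).
Proof. by apply: funmod_eq => w; rewrite fwlE !fylE fwlE reprMv. Qed.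
Fact fm_yy v v' F : fyl v (fyl v' F) = fyl v' (fyl v F).
Proof. by apply: funmod_eq => w; rewrite !fylE ryy. Qed.
(** At the point w the sum over reflections is reindexed by conjugation with w. Elements of the
    stabilizer come from the relation in N, the others from moving y past the [dop]. *)
Fact fm_yx v u F : fyl v (fxl u F) = fxl u (fyl v F) + (u v : K) *: F
  - \sum_s (k s * (u (W s v - v) : K)) *: fwl s F.
Proof.
apply: funmod_eq => w; rewrite fmB fmD fmZ fm_sum fylE !fxlE fylE.
rewrite linearD linear_sum /= ryx dactE reprK.
have -> : \sum_s subval ((k s * (u (W s v - v) : K)) *: fwl s F) w =
    \sum_s (k s * (dual_repr W w u (W s (W w v) - W w v) : K)) *: subval F (s * w)%g.
  rewrite (reindex (fun s => w^-1 * s * w)%g); last first.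
    exists (fun s => w * s * w^-1)%g; move=> t _; rewrite !mulgA.
      by rewrite mulgV mul1g mulgK.
    by rewrite mulVg mul1g mulgKV.
  apply: eq_bigr => s _; rewrite fmZ fwlE !mulgA mulgV mul1g.
  have := k_inv s w^-1%g; rewrite invgK => ->.
  by rewrite dactE reprB reprK !reprMv.
under [X in _ + X]eq_bigr => s sW do rewrite ry_dop // -reprMv.
rewrite sumrB.
set A := rx _ _; set B := _ *: subval F w.
set c := fun s => (k s * (dual_repr W w u (W s (W w v) - W w v) : K)) *: subval F (s * w)%g.
rewrite (_ : \sum_(s : [subg Wl]) _ = \sum_(s in Wl) c s); last first.
  by rewrite -(sum_subg Wl c); apply: eq_bigr => s _; rewrite /c funmodP.
rewrite (_ : \sum_s c s = \sum_(s in Wl) c s + \sum_(s | s \notin Wl) c s); last first.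
  by rewrite [LHS](bigID (mem Wl)).
rewrite opprD !addrA; congr (_ - _); last first.
  by apply: eq_bigr => s _; rewrite /c reprMv.
by rewrite addrAC [A + B + _]addrAC.
Qed.

Definition fun_prech : prech W k :=
  Prech fm_w1 fm_wM fm_xL fm_yL fm_wx fm_wy fm_yy fm_yx.

(** An identity for every N, used in both directions: [fun_xcomm] lifts commutation from N to
    functions, [wt_xcomm] brings it back. *)
Lemma fun_xx u u' (F : funmod) w :
  subval (fxl u (fxl u' F)) w - subval (fxl u' (fxl u F)) w =
  rx (dual_repr W w u) (rx (dual_repr W w u') (subval F w))
  - rx (dual_repr W w u') (rx (dual_repr W w u) (subval F w)).
Proof.
pose f s := subval F (s * w)%g.
have f_eqv (g : [subg Wl]) s : f (sgval g * s)%g = rw g (f s).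
  by rewrite /f -mulgA funmodP.
have E x x' : subval (fxl x (fxl x' F)) w =
    rx (dual_repr W w x) (rx (dual_repr W w x') (subval F w))
    + xx_rest N_wt f (dual_repr W w x) (dual_repr W w x').
  rewrite fxlE fxlE linearD linear_sum /= -addrA; congr (_ + _).
  rewrite /xx_rest big_split /= -addrA; congr (_ + _).
  rewrite -big_split; apply: eq_bigr => s sW.
  transitivity (dopl s (dual_repr W w x) (fx x' (subval F) (s * w)%g)) => //.
  rewrite /fx linearD linear_sum dactM; congr (_ + _).
  by apply: eq_bigr => t tW; rewrite /f mulgA.
rewrite !E (xx_rest_sym k_inv k_rank1 N_wt _ _ f_eqv).
by rewrite opprD addrACA subrr addr0.
Qed.


Lemma dop_closed (P : N -> Prop) s u m : subspace P ->
  (forall v m, P m -> P (ry v m)) -> s \notin Wl -> P m -> P (dop s u m).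
Proof.
move=> hP Py sW Pm; rewrite /dop.
have [->|ks0] := eqVneq (k s) 0; first by rewrite mul0r scale0r; apply: hP.1.
apply: (subspaceZ hP); apply: Yinv_closed => //; first by move=> m'; apply: Py.
exact: (lam_rvec k_rank1).
Qed.

(** The equivariant function supported on the coset of w0 under the stabilizer, with value n at
    w0. *)
Definition delta_fun (w0 : gT) (n : N) : gT -> N := fun w =>
  if (w * w0^-1)%g \in Wl then rw (subg Wl (w * w0^-1)%g) n else 0.

Fact delta_fun_eqv w0 n : fun_eqv (delta_fun w0 n).
Proof.
move=> g w; rewrite /delta_fun -mulgA (groupMl _ (subgP g)).
have [wW|_] := ifP; last by rewrite linear0.
rewrite -rwM; congr (rw _ n); apply: val_inj.
by rewrite /= !subgK // (groupMl _ (subgP g)).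
Qed.

Definition delta_mod w0 n : funmod := tosub fun_eqv_subspace (delta_fun_eqv w0 n).

Lemma delta_modE w0 n w : subval (delta_mod w0 n) w = delta_fun w0 n w.
Proof. by []. Qed.

Fact delta_lin w0 : linear (delta_mod w0).
Proof.
move=> a n n'; apply: funmod_eq => w; rewrite fmD fmZ !delta_modE /delta_fun.
by case: ifP => _; rewrite ?linearP // scaler0 addr0.
Qed.

Definition delta w0 : {linear N -> funmod} := mklin (delta_lin w0).

Lemma deltaE w0 n w : subval (delta w0 n) w = delta_fun w0 n w. Proof. by []. Qed.

Lemma delta_id w0 n : subval (delta w0 n) w0 = n.
Proof.
rewrite deltaE /delta_fun mulgV group1.
by rewrite (_ : subg Wl 1 = 1%g) ?rw1 //; apply: val_inj; rewrite /= subgK.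
Qed.

Lemma fwl_delta h w0 n : fwl h (delta w0 n) = delta (w0 * h^-1)%g n.
Proof.
by apply: funmod_eq => w; rewrite fwlE !deltaE /delta_fun invMg invgK mulgA.
Qed.

Lemma fyl_delta v w0 n : fyl v (delta w0 n) = delta w0 (ry (W w0 v) n).
Proof.
apply: funmod_eq => w; rewrite fylE !deltaE /delta_fun.
have [wW|_] := ifP; last by rewrite linear0.
by rewrite rwy; congr (ry _ _); rewrite /= /res_fun subgK // -reprMv mulgKV.
Qed.

Lemma delta_rw w0 (g : [subg Wl]) n :
  delta w0 (rw g n) = delta ((sgval g)^-1 * w0)%g n.
Proof.
apply: funmod_eq => w; rewrite !deltaE /delta_fun invMg invgK mulgA.
rewrite (groupMr _ (subgP g)); case: ifP => // wW; rewrite -rwM; congr (rw _ n).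
by apply: val_inj; rewrite /= !subgK // (groupMr _ (subgP g)).
Qed.

(** The restriction of F to a coset appears once for every w0 in that coset, whence the factor. *)
Lemma card_delta (F : funmod) :
  (#|Wl|%:R : K) *: F = \sum_w0 delta w0 (subval F w0).
Proof.
apply: funmod_eq => w; rewrite fmZ fm_sum.
rewrite (reindex_inj (can_inj (invgK) : injective (fun x : gT => x^-1)%g)).
rewrite (reindex_inj (mulgI w^-1)%g).
rewrite (eq_bigr (fun x => if x \in Wl then subval F w else 0)) => [|x _].
  by rewrite -big_mkcond sumr_const scaler_nat.
rewrite deltaE /delta_fun invgK mulKVg; case: ifP => // xW.
by rewrite -funmodP subgK // invMg invgK mulKVg.
Qed.

End FunMod.

(** * The generalized weight space *)
Lemma subval_iter (K : fieldType) (M : lmodType K) (P : M -> Prop)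
    (hP : subspace P) (f : M -> M) (g : submod hP -> submod hP) e u :
  (forall u, subval (g u) = f (subval u)) ->
  subval (iter e g u) = iter e f (subval u).
Proof. by move=> gf; elim: e => //= e IH; rewrite gf IH. Qed.

Lemma lnil_sub (K : fieldType) (M : lmodType K) (P : M -> Prop)
    (hP : subspace P) (f : M -> M) (g : submod hP -> submod hP) u :
  (forall u, subval (g u) = f (subval u)) -> lnil f (subval u) <-> lnil g u.
Proof.
move=> gf; split=> -[e ue]; exists e.
  by apply: submod_inj; rewrite (subval_iter _ _ gf) ue subval0.
by rewrite -(subval_iter _ _ gf) ue subval0.
Qed.

Section WeightSpace.
Variables (K : fieldType) (gT : finGroupType) (V : vectType K).
Variables (W : linrep gT V) (k : gT -> K) (lambda : dual V).
Hypothesis k_inv : forall s g, k (g * s * g^-1)%g = k s.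
Hypothesis k_rank1 : forall s, k s != 0 -> rank1 W s.

Let Wl := Wstab W lambda.
Let kl (s : [subg Wl]) : K := k (sgval s).
Let lam (v : V) : K := lambda v.
Let b s := rvec W s.

Variables (M : prech W k).

Let hP := gwt_subspace M lambda.

Definition wtmod : lmodType K := submod hP.

Definition wt_y v : {linear wtmod -> wtmod} :=
  restr hP hP (linearP (ry v : {linear M -> M})) (@gwt_ry _ _ _ _ _ M lambda v).

Lemma Wstab_dact g : g \in Wl -> dual_repr W g lambda = lambda.
Proof. by rewrite inE => /eqP. Qed.

Lemma wt_w_sub (g : [subg Wl]) (m : M) : gwt lambda m -> gwt lambda (rw (sgval g) m).
Proof. by move=> /(gwt_rw (sgval g)); rewrite Wstab_dact ?subgP. Qed.

Definition wt_w (g : [subg Wl]) : {linear wtmod -> wtmod} :=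
  restr hP hP (linearP (rw (sgval g) : {linear M -> M})) (@wt_w_sub g).

Lemma wt_yE v u : subval (wt_y v u) = ry v (subval u). Proof. by []. Qed.
Lemma wt_wE g u : subval (wt_w g u) = rw (sgval g) (subval u). Proof. by []. Qed.

Lemma wt_shiftE v (u : wtmod) :
  subval (shift (wt_y v) (lam v) u) = ysh lambda v (subval u).
Proof. by rewrite shiftE yshE subvalB subvalZ. Qed.

Lemma wt_lnil v (u : wtmod) : lnil (shift (wt_y v) (lam v)) u.
Proof. by apply/(lnil_sub _ (wt_shiftE v)); exact: (submodP u). Qed.

Lemma Zinv_ex v : exists g : {linear wtmod -> wtmod}, lam v != 0 ->
  cancel (wt_y v) g /\ cancel g (wt_y v).
Proof.
have [v0|v0] := boolP (lam v == 0); first by exists idfun.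
by have [g hg] := shift_inv v0 (wt_lnil v); exists g.
Qed.

Definition Zinv v : {linear wtmod -> wtmod} := projT1 (cid (Zinv_ex v)).

Lemma ZinvK v u : lam v != 0 -> Zinv v (wt_y v u) = u.
Proof. by move=> v0; apply: (projT2 (cid (Zinv_ex v)) v0).1. Qed.
Lemma wt_yK v u : lam v != 0 -> wt_y v (Zinv v u) = u.
Proof. by move=> v0; apply: (projT2 (cid (Zinv_ex v)) v0).2. Qed.
Lemma Zinv_eq v u u' : lam v != 0 -> wt_y v u' = u -> Zinv v u = u'.
Proof. by move=> v0 <-; rewrite ZinvK. Qed.

Lemma wt_yC v v' u : wt_y v (wt_y v' u) = wt_y v' (wt_y v u).
Proof. by apply: submod_inj; rewrite !wt_yE ryy. Qed.

Lemma ZinvZ a v u : a != 0 -> lam v != 0 -> Zinv (a *: v) u = a^-1 *: Zinv v u.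
Proof.
move=> a0 v0; apply: Zinv_eq; first by rewrite /lam linearZ mulf_neq0.
apply: submod_inj; rewrite wt_yE subvalZ ryZ linearZZ scalerA mulfV // scale1r.
by rewrite -wt_yE wt_yK.
Qed.

Lemma ry_Zinv v v' u : lam v != 0 ->
  ry v' (subval (Zinv v u)) = subval (Zinv v (wt_y v' u)).
Proof.
move=> v0; rewrite -wt_yE; congr subval; apply/esym/Zinv_eq => //.
by rewrite wt_yC wt_yK.
Qed.

(* Subtracting these terms for all s outside the stabilizer turns [rx u] into  *)
(* an operator preserving the generalized weight space.                        *)
Definition zterm (s : gT) (u : dual V) (m : wtmod) : M :=
  (k s * (u (W s (b s)) : K)) *: rw s (subval (Zinv (b s) m)).

Lemma zterm_lin s u : linear (zterm s u).
Proof.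
move=> a m m'; rewrite /zterm linearP subvalD subvalZ linearP scalerDr !scalerA.
by rewrite mulrC.
Qed.

Lemma zterm_linl s a u u' m : zterm s (a *: u + u') m = a *: zterm s u m + zterm s u' m.
Proof.
rewrite /zterm scalerA -scalerDl; congr (_ *: _).
rewrite add_lfunE scale_lfunE mulrDr mulrCA; congr (_ + _).
Qed.

Lemma lamb s : k s != 0 -> s \notin Wl -> lam (b s) != 0.
Proof. by move=> ks0 sW; apply: notin_Wstab => //; apply: k_rank1. Qed.

(** y_v s = s y_{s^-1 v}, and s^-1 v is v minus a multiple of b_s; y_{b_s} then meets its inverse.
    The second term is the part of [y_v, x_u] that leaves the weight space. *)
Lemma ry_zterm s u v m : s \notin Wl ->
  ry v (zterm s u m) = zterm s u (wt_y v m)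
    - (k s * (u (W s v - v) : K)) *: rw s (subval m).
Proof.
move=> sW; rewrite /zterm.
have [->|ks0] := eqVneq (k s) 0; first by rewrite !mul0r !scale0r linear0 subr0.
have bs0 := lamb ks0 sW.
rewrite linearZZ -{1}[v](reprVK W s) -rwy.
have [c E] := rank1P (W s^-1%g v) (k_rank1 ks0).
rewrite reprVK in E.
have E' : W s^-1%g v = v - c *: b s by rewrite -E subKr.
rewrite E' ryB ryZ !ry_Zinv // ZinvK // linearB linearZZ scalerBr scalerA.
congr (_ - _ *: _); rewrite -mulrA; congr (_ * _).
rewrite (_ : W s v - v = c *: W s (b s)) ?dualZ 1?mulrC //.
by rewrite -[c *: W s _]linearZ /= -E reprB reprVK.
Qed.

Lemma rw_zterm (g : [subg Wl]) s u m : s \notin Wl ->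
  rw (sgval g) (zterm s u m) =
  zterm (sgval g * s * (sgval g)^-1)%g (dual_repr W (sgval g) u) (wt_w g m).
Proof.
move=> sW; rewrite /zterm k_inv.
have [->|ks0] := eqVneq (k s) 0; first by rewrite !mul0r !scale0r linear0.
have bs0 := lamb ks0 sW.
have gb0 : lam (W (sgval g) (b s)) != 0 by rewrite /lam Wstab_fix ?subgP.
have [|a a0 Ea] := @rvec_conj _ _ _ W (sgval g) s (k_rank1 ks0).
  by apply: k_rank1; rewrite k_inv.
rewrite /b Ea ZinvZ // linearZZ subvalZ [rw _ (a^-1 *: _)]linearZZ scalerA -!rwM.
have -> : Zinv (W (sgval g) (rvec W s)) (wt_w g m) = wt_w g (Zinv (b s) m).
  apply: Zinv_eq => //; apply: submod_inj.
  by rewrite wt_yE wt_wE -rwy -wt_yE wt_yK.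
rewrite wt_wE -rwM mulgKV dactE [W _ (a *: _)]linearZ /= [W _ (a *: _)]linearZ /=.
rewrite dualZ !reprMv !reprK -mulrA [_ / a]mulrC mulrA.
congr (_ *: _); rewrite -!mulrA; congr (_ * _).
by rewrite mulrA mulVf // mul1r.
Qed.

Definition wt_xfun (u : dual V) (m : wtmod) : M :=
  rx u (subval m) - \sum_(s | s \notin Wl) zterm s u m.

Fact wt_xfun_lin u : linear (wt_xfun u).
Proof.
move=> a m m'; rewrite /wt_xfun subvalD subvalZ linearP.
under eq_bigr => s _ do rewrite zterm_lin.
by rewrite big_split /= -scaler_sumr opprD addrACA -scalerBr.
Qed.

(** The terms of the reflections outside the stabilizer cancel against those of [ry_zterm]; what
    remains is the relation for the stabilizer. *)
Lemma ry_wt_xfun v u m : ry v (wt_xfun u m) =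
  wt_xfun u (wt_y v m) + ((u v : K) *: subval m
   - \sum_(s in Wl) (k s * (u (W s v - v) : K)) *: rw s (subval m)).
Proof.
rewrite /wt_xfun linearB linear_sum /= ryx.
under [X in _ - X]eq_bigr => s sW do rewrite ry_zterm //.
rewrite sumrB opprB (bigID (mem Wl)) /=.
set A := rx u _; set B := _ *: subval m; set C := \sum_(s in _) _.
set D := \sum_(s | _) _; set E := \sum_(s | _) _.
rewrite opprD !addrA [_ - D + D]subrK.
by rewrite [LHS]addrAC [A + B - E]addrAC.
Qed.

Lemma wt_comm_gwt v u (m : wtmod) : gwt lambda ((u v : K) *: subval m
   - \sum_(s in Wl) (k s * (u (W s v - v) : K)) *: rw s (subval m)).
Proof.
have mw := submodP m; apply: (subspaceB hP); first exact: (subspaceZ hP).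
apply: (subspace_sum hP) => s sW; apply: (subspaceZ hP).
by move: (wt_w_sub (subg Wl s) mw); rewrite subgK.
Qed.

(** y_v - lambda(v) commutes with the corrected operator up to a term that already has weight
    lambda, so [lnil_commutator] applies. *)
Lemma wt_x_sub u m : gwt lambda (wt_xfun u m).
Proof.
move=> v; pose T (m : wtmod) := (u v : K) *: subval m
   - \sum_(s in Wl) (k s * (u (W s v - v) : K)) *: rw s (subval m).
apply: (@lnil_commutator _ _ _ (ysh lambda v) (shift (wt_y v) (lam v))
  (mklin (wt_xfun_lin u)) T (fun=> True)) => //.
- move=> n _; rewrite yshE !mklinE ry_wt_xfun shiftE.
  by rewrite -[wt_xfun u (_ - _)]/(mklin (wt_xfun_lin u) _) linBZ /= addrAC.
- by move=> n _; apply: wt_comm_gwt.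
- exact: wt_lnil.
Qed.

Definition wt_x u : {linear wtmod -> wtmod} :=
  corestr hP (wt_xfun_lin u) (wt_x_sub u).

Lemma wt_xE u m : subval (wt_x u m) =
  rx u (subval m) - \sum_(s | s \notin Wl) zterm s u m.
Proof. by []. Qed.

Let WR := Wstab_repr W lambda.

Fact wt_w1 m : wt_w 1%g m = m.
Proof. by apply: submod_inj; rewrite wt_wE rw1. Qed.
Fact wt_wM g h m : wt_w (g * h)%g m = wt_w g (wt_w h m).
Proof. by apply: submod_inj; rewrite !wt_wE rwM. Qed.
Fact wt_xL a u u' m : wt_x (a *: u + u') m = a *: wt_x u m + wt_x u' m.
Proof.
apply: submod_inj; rewrite subvalD subvalZ !wt_xE rxL.
under eq_bigr => s _ do rewrite zterm_linl.
by rewrite big_split /= -scaler_sumr opprD addrACA -scalerBr.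
Qed.
Fact wt_yL a v v' m : wt_y (a *: v + v') m = a *: wt_y v m + wt_y v' m.
Proof. by apply: submod_inj; rewrite subvalD subvalZ !wt_yE ryL. Qed.
Lemma dual_WR (g : [subg Wl]) u : dual_repr WR g u = dual_repr W (sgval g) u.
Proof. by apply/lfunP => v; rewrite !dactE. Qed.
Fact wt_wx g u m : wt_w g (wt_x u m) = wt_x (dual_repr WR g u) (wt_w g m).
Proof.
apply: submod_inj; rewrite dual_WR wt_xE wt_wE wt_xE linearB linear_sum /= rwx.
congr (_ - _); rewrite [RHS](reindex (fun s => sgval g * s * (sgval g)^-1)%g); last first.
  exists (fun t => (sgval g)^-1 * t * sgval g)%g; move=> t _; rewrite !mulgA.
    by rewrite mulVg mul1g mulgKV.
  by rewrite mulgV mul1g mulgK.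
apply: eq_big => [s|s sW]; last exact: rw_zterm.
by rewrite (groupMr _ (groupVr (subgP g))) (groupMl _ (subgP g)).
Qed.
Fact wt_wy g v m : wt_w g (wt_y v m) = wt_y (WR g v) (wt_w g m).
Proof. by apply: submod_inj; rewrite wt_wE !wt_yE rwy. Qed.
Fact wt_yx v u m : wt_y v (wt_x u m) = wt_x u (wt_y v m) + (u v : K) *: m
  - \sum_s (kl s * (u (WR s v - v) : K)) *: wt_w s m.
Proof.
apply: submod_inj; rewrite wt_yE ry_wt_xfun subvalB subvalD subvalZ subval_sum.
rewrite addrA; congr (_ - _); rewrite -sum_subg.
by apply: eq_bigr => s _; rewrite subvalZ.
Qed.

Definition wt_prech : prech WR kl :=
  Prech wt_w1 wt_wM wt_xL wt_yL wt_wx wt_wy wt_yC wt_yx.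

Lemma wt_prech_wt (m : wt_prech) : gwt lambda m.
Proof. by move=> v; apply: wt_lnil. Qed.

Lemma wt_dopE (N_wt : forall m : wt_prech, gwt lambda m) s u (m : wtmod) :
  s \notin Wl -> dop N_wt s u m = (k s * (u (b s) : K)) *: Zinv (b s) m.
Proof.
move=> sW; rewrite /dop; have [->|ks0] := eqVneq (k s) 0.
  by rewrite !mul0r !scale0r.
by congr (_ *: _); apply: Yinv_eq; rewrite ?lamb //; apply: wt_yK; rewrite lamb.
Qed.

End WeightSpace.

Section Weights.
Variables (K : fieldType) (gT : finGroupType) (V : vectType K).
Variables (W : linrep gT V) (k : gT -> K) (M : prech W k).

Lemma rwZ g a (m : M) : rw g (a *: m) = a *: rw g m.
Proof. exact: linearZZ. Qed.

(** With v separating mu_i from lambda, a power of y_v - mu_i(v) removes the i-th summand and keeps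
    all weights, so by induction it kills m. Then m belongs to two different eigenvalues of y_v. *)
Lemma gwt_indep lambda (I : Type) (r : seq I) (Q : pred I) (mu : I -> dual V)
    (F : I -> M) (m : M) :
  (forall i, Q i -> gwt (mu i) (F i) /\ mu i <> lambda) -> gwt lambda m ->
  m = \sum_(i <- r | Q i) F i -> m = 0.
Proof.
elim: r F m => [|i r IH] F m QF mw; first by rewrite big_nil.
rewrite big_cons; case: ifP => Qi mE; last exact: IH mE.
have [Fw /eqP muN] := QF _ Qi.
have [v vN] : exists v, mu i v != lambda v.
  apply: contra_notP (elimN eqP muN) => /forallNP muE; apply/lfunP => v.
  by apply/eqP/negPn/negP/muE.
have [e Fe] := Fw v; pose D (x : M) := iter e (ysh (mu i) v) x.
have mw' : gwt lambda (D m).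
  by rewrite /D; elim: (e) => //= e' IH'; apply: gwt_ysh.
have D0 : D m = 0.
  apply: (IH (fun j => D (F j))) mw' _ => [j Qj|].
    have [Fj ?] := QF _ Qj; split=> //.
    by rewrite /D; elim: (e) => //= e' IH'; apply: gwt_ysh.
  rewrite mE -[D]/(GRing.Linear.sort (mklin (iter_linP (ysh (mu i) v) e))).
  by rewrite linearD linear_sum /= Fe add0r.
by apply: (@shift_ker2 _ _ (ry v) (mu i v) (lambda v) m vN); [exists e|apply: mw].
Qed.

Lemma gwt_eig lambda :
  (forall g, dual_repr W g lambda = lambda) ->
  (forall m : M, gwt lambda m) <-> ch_eig M lambda.
Proof.
move=> lam_fix; split=> [Mw m|Me m].
  exists (fun g => if g == 1%g then m else 0); split=> [g|].
    by rewrite lam_fix; apply: Mw.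
  by rewrite -big_mkcond big_pred1_eq.
have [F [Fw ->]] := Me m; apply: (subspace_sum (gwt_subspace _ _)) => g _.
by rewrite -(lam_fix g).
Qed.

Lemma eig_yfin lambda (m : M) : ch_eig M lambda -> yfin m.
Proof.
move=> /(_ m)[F [Fw ->]].
have [E [FE EY]] : exists E, {subset map F (enum gT) <= E} /\
    forall e v, e \in E -> span_of E (ry v e).
  by apply: yfin_seq => _ /mapP[g _ ->]; apply: gwt_yfin (Fw g).
(* The list E was built from the weight components of m, so m is added in front; y m is the sum of y
   applied to the components. *)
exists ((\sum_g F g) :: E); split=> [|e v]; first exact: mem_head.
have sub : {subset E <= (\sum_g F g) :: E} by move=> x xE; rewrite inE xE orbT.
rewrite inE => /predU1P[->|/EY EE]; last exact: span_sub (EE v).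
rewrite linear_sum; apply: (subspace_sum (span_subspace _)) => g _.
by apply: (span_sub sub); apply: EY; apply: FE; apply: map_f; rewrite mem_enum.
Qed.

End Weights.

(** * Comparing a module with the functions into its weight space *)

Section StepOne.
Variables (K : fieldType) (gT : finGroupType) (V : vectType K).
Variables (W : linrep gT V) (k : gT -> K) (lambda : dual V).
Hypothesis k_inv : forall s g, k (g * s * g^-1)%g = k s.
Hypothesis k_rank1 : forall s, k s != 0 -> rank1 W s.

Notation Wl := (Wstab W lambda).
Notation kl := (fun s : [subg Wl] => k (sgval s)).
Notation WR := (Wstab_repr W lambda).

Hypothesis Wl_char : (#|Wl|%:R : K) != 0.

Section Phi.
Variable M : prech W k.

Notation N := (wt_prech lambda k_inv k_rank1 M).
Variable N_wt : forall n : N, gwt lambda n.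
Notation FN := (fun_prech k_inv k_rank1 N_wt).

Definition wval : {linear N -> M} := mklin (@subval_lin _ _ _ (gwt_subspace M lambda)).

Lemma wval_w g (n : N) : wval (rw g n) = rw (sgval g) (wval n). Proof. by []. Qed.
Lemma wval_y v (n : N) : wval (ry v n) = ry v (wval n). Proof. by []. Qed.
Lemma wval_x u (n : N) :
  wval (rx u n) = rx u (wval n) - \sum_(s | s \notin Wl) zterm s u n.
Proof. by []. Qed.
Lemma wvalZ a (n : wtmod lambda M) : wval (a *: n) = a *: wval n.
Proof. exact: subvalZ. Qed.
Lemma wval_wt (n : N) : gwt lambda (wval n).
Proof. exact: (submodP (n : wtmod lambda M)). Qed.

(** F(w) has weight lambda, so the summand of w has weight w^-1 lambda: F records the weight
    components of its image, each repeated once per element of a coset. *)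
Definition Phi_fun (F : FN) : M := \sum_w rw w^-1%g (wval (subval F w)).

Fact Phi_lin : linear Phi_fun.
Proof.
move=> a F G; rewrite /Phi_fun scaler_sumr -big_split; apply: eq_bigr => w _.
by rewrite fmD fmZ !linearP.
Qed.

Lemma PhiE F : mklin Phi_lin F = \sum_w rw w^-1%g (wval (subval F w)).
Proof. by []. Qed.

Fact Phi_w g F : mklin Phi_lin (rw g F) = rw g (mklin Phi_lin F).
Proof.
rewrite !PhiE linear_sum [RHS](reindex_inj (mulIg g)); apply: eq_bigr => w _.
by rewrite invMg -rwM mulKVg.
Qed.

Fact Phi_y v F : mklin Phi_lin (ry v F) = ry v (mklin Phi_lin F).
Proof.
rewrite !PhiE linear_sum; apply: eq_bigr => w _.
by rewrite [subval _ _]/(ry (W w v) (subval F w)) wval_y rwy reprK.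
Qed.

(** The correction subtracted in the weight space at s w and the off-diagonal term of the induced
    action at w are the same vector of M, so they cancel after the substitution of s w for w. *)
Fact Phi_x u F : mklin Phi_lin (rx u F) = rx u (mklin Phi_lin F).
Proof.
have E w : rw w^-1%g (wval (subval (rx u F) w)) =
    rx u (rw w^-1%g (wval (subval F w)))
    - \sum_(s | s \notin Wl) rw w^-1%g (zterm s (dual_repr W w u) (subval F w))
    + \sum_(s | s \notin Wl)
        rw w^-1%g (wval (dop N_wt s (dual_repr W w u) (subval F (s * w)%g))).
  rewrite -[subval (rx u F)]/(fx N_wt u (subval F)) /fx.
  rewrite [wval (_ + _)]linearD [rw _ (_ + _)]linearD; congr (_ + _); last first.
    by rewrite [wval (\sum_(_ | _) _)]linear_sum linear_sum.
  rewrite wval_x [LHS]linearB linear_sum; congr (_ - _).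
  by rewrite rwx -dactM mulVg dact1.
suff E2 : \sum_w \sum_(s | s \notin Wl)
      rw w^-1%g (wval (dop N_wt s (dual_repr W w u) (subval F (s * w)%g)))
    = \sum_w \sum_(s | s \notin Wl)
      rw w^-1%g (zterm s (dual_repr W w u) (subval F w)).
  rewrite !PhiE linear_sum (eq_bigr _ (fun w _ => E w)) big_split sumrB E2.
  exact: subrK.
rewrite exchange_big [RHS]exchange_big; apply: eq_bigr => s sW.
rewrite [RHS](reindex_inj (mulgI s)); apply: eq_bigr => w _.
rewrite wt_dopE // wvalZ rwZ /zterm rwZ dactM [dual_repr W s _ _]dactE reprK.
by rewrite -rwM invMg mulgKV.
Qed.

Definition Phi : chom FN M := Chom Phi_w Phi_x Phi_y.

Lemma Phi_delta w0 (n : N) :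
  Phi (delta N w0 n) = #|Wl|%:R *: rw w0^-1%g (wval n).
Proof.
rewrite /= /Phi_fun (reindex_inj (mulIg w0)).
rewrite (eq_bigr (fun x => if x \in Wl then rw w0^-1%g (wval n) else 0)) => [|x _].
  by rewrite -big_mkcond sumr_const scaler_nat.
rewrite deltaE /delta_fun mulgK; case: ifP => xW; last by rewrite !linear0.
by rewrite wval_w subgK // -rwM invMg mulgKV.
Qed.

(** In a vanishing sum the terms of weight lambda, those with w in the stabilizer, add up to
    |W_lambda| F(1), and the rest has other weights, so F(1) = 0. Other values of F are values at 1
    of translates of F. *)
Lemma Phi_inj : injective Phi.
Proof.
suff ker F : Phi F = 0 -> F = 0.
  move=> F G /eqP; rewrite -subr_eq0 -linearB => /eqP/ker/eqP.
  by rewrite subr_eq0 => /eqP.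
have ker1 G : Phi G = 0 -> subval G 1%g = 0 :> N.
  rewrite [Phi G]PhiE (bigID (mem Wl)) => /eqP.
  rewrite (eq_bigr (fun=> wval (subval G 1%g))) => [|w wW]; last first.
    have {}wW : w \in Wl by [].
    have -> : w = (sgval (subg Wl w) * 1)%g by rewrite mulg1 subgK.
    by rewrite funmodP wval_w -rwM mulg1 mulVg rw1.
  rewrite sumr_const addr_eq0 -sumrN => /eqP E.
  have {E} : wval (subval G 1%g) *+ #|Wl| = 0.
    apply: (@gwt_indep _ _ _ _ _ M lambda _ _ _
        (fun w => dual_repr W w^-1%g lambda) _ _ _ _ E) => [w wW|]; last first.
      by rewrite -scaler_nat; apply: (subspaceZ (gwt_subspace M _));
        apply: wval_wt.
    split.
      apply: (subspaceN (gwt_subspace M _)); apply: gwt_rw.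
      exact: wval_wt.
    move=> fixw; have {}wW : w \notin Wl by [].
    move/negP: wW; apply; rewrite -groupV inE; exact/eqP.
  rewrite -scaler_nat => /eqP; rewrite scaler_eq0 (negPf Wl_char) => /eqP E.
  by apply: submod_inj; rewrite subval0.
move=> F0; apply: funmod_eq => w; rewrite subval0.
have -> : subval F w = subval (rw w F : FN) 1%g by rewrite /= /fw mul1g.
by rewrite ker1 // chw F0 linear0.
Qed.

Lemma Phi_surj : ch_eig M lambda -> forall m, exists F, Phi F = m.
Proof.
move=> Me m; have [G [Gw ->]] := Me m.
have nw w : gwt lambda (rw w^-1%g (G w)).
  by have := gwt_rw w^-1%g (Gw w); rewrite -dactM mulVg dact1.
pose n w : N := tosub (gwt_subspace M lambda) (nw w).
(* The component of weight w lambda is brought back to weight lambda by w^-1; the factor undoes the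
   repetition over a coset. *)
exists (\sum_w #|Wl|%:R^-1 *: delta N w^-1%g (n w)).
rewrite linear_sum; apply: eq_bigr => w _; rewrite linearZZ Phi_delta scalerA.
by rewrite mulVf // scale1r invgK [wval (n w)]/(rw w^-1%g (G w)) -rwM mulgV rw1.
Qed.

End Phi.

(** A vector of the weight space is the value at 1 of a delta function. The x-operators commute on
    that function because [Phi] embeds it in M, and [fun_xx] carries this to its value at 1. *)
Lemma wt_xcomm (M : prech W k) : xcomm M -> xcomm (wt_prech lambda k_inv k_rank1 M).
Proof.
pose N_wt := @wt_prech_wt _ _ _ _ _ lambda k_inv k_rank1 M.
pose FN := fun_prech k_inv k_rank1 N_wt.
move=> Mxx u u' n; pose F : FN := delta _ 1%g n.
have FE : rx u (rx u' F) = rx u' (rx u F) :> FN.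
  by apply: (Phi_inj (N_wt := N_wt)); rewrite !chx Mxx.
have := fun_xx k_inv k_rank1 N_wt u u' F 1%g.
rewrite !dact1 delta_id => /esym/eqP.
have : subval (rx u (rx u' F) : FN) 1%g = subval (rx u' (rx u F) : FN) 1%g.
  by rewrite FE.
by move=> -> /=; rewrite subrr subr_eq0 => /eqP.
Qed.



End StepOne.

(** * Restriction to the weight space and induction are mutually inverse *)

Section StepOneInverse.
Variables (K : fieldType) (gT : finGroupType) (V : vectType K).
Variables (W : linrep gT V) (k : gT -> K) (lambda : dual V).
Hypothesis k_inv : forall s g, k (g * s * g^-1)%g = k s.
Hypothesis k_rank1 : forall s, k s != 0 -> rank1 W s.

Notation Wl := (Wstab W lambda).
Notation kl := (fun s : [subg Wl] => k (sgval s)).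
Notation WR := (Wstab_repr W lambda).

Hypothesis Wl_char : (#|Wl|%:R : K) != 0.

Section Fun.
Variables (L : prech WR kl) (L_wt : forall n : L, gwt lambda n).

Notation FL := (fun_prech k_inv k_rank1 L_wt).

Lemma fun_xcomm : xcomm L -> xcomm FL.
Proof.
move=> Lxx u u' F; apply: funmod_eq => w; apply/eqP; rewrite -subr_eq0.
by apply/eqP; rewrite [LHS]fun_xx Lxx subrr.
Qed.

Lemma delta_decomp (F : FL) :
  F = \sum_w0 #|Wl|%:R^-1 *: delta L w0 (subval F w0).
Proof. by rewrite -scaler_sumr -card_delta scalerA mulVf // scale1r. Qed.

Lemma ysh_delta v w0 n :
  ysh (dual_repr W w0^-1%g lambda) v (delta L w0 n : FL) =
  delta L w0 (ysh lambda (W w0 v) n).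
Proof.
by rewrite !yshE linBZ -fyl_delta dactE invgK.
Qed.

Lemma delta_gwt w0 n : gwt (dual_repr W w0^-1%g lambda) (delta L w0 n : FL).
Proof.
move=> v; have [e ne] := L_wt n (W w0 v); exists e.
have -> : iter e (ysh (dual_repr W w0^-1%g lambda) v) (delta L w0 n : FL) =
    delta L w0 (iter e (ysh lambda (W w0 v)) n).
  by elim: (e) => // e' IH; rewrite [LHS]iterS IH ysh_delta -iterS.
by rewrite ne linear0.
Qed.

Lemma fun_eig : ch_eig FL lambda.
Proof.
move=> F; exists (fun g => #|Wl|%:R^-1 *: delta L g^-1%g (subval F g^-1%g)).
split=> [g|].
  apply: (subspaceZ (gwt_subspace _ _)).
  by rewrite -{1}[g]invgK; apply: delta_gwt.
rewrite {1}(delta_decomp F) (reindex_inj (can_inj (invgK) : injective (fun x : gT => x^-1)%g)).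
by [].
Qed.

(** Generators of L are the values of the generating functions, enlarged to a stable family: a value
    of x_u F involves X and [dop], and [dop] preserves y-stable subspaces. *)
Lemma fun_fg_inv : ch_fg FL -> ch_fg L.
Proof.
case=> s hs.
have [E [sE Est]] := @yfin_stable _ _ _ _ _ L
  [seq subval (F : funmod L) w | F <- s, w <- enum gT]
  (fun n _ => gwt_yfin (L_wt n)).
exists E => P hP Px PE n.
suff : xgen E n by apply.
have hE := xgen_subspace E.
suff : forall w, xgen E (subval (delta L 1%g n) w).
  by move=> /(_ 1%g); rewrite delta_id.
apply: (hs (fun F : FL => forall w, xgen E (subval (F : funmod L) w))).
- split=> [w|a F G hF hG w]; first by rewrite subval0; apply: hE.1.
  by rewrite fmD fmZ; apply: hE.2.
- move=> u F hF w; rewrite [subval _ _]/(fx L_wt u (subval (F : funmod L)) w) /fx.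
  apply: (subspaceD hE); first exact: xgen_x.
  apply: (subspace_sum hE) => s0 sW; apply: (dop_closed k_rank1 L_wt _ hE) => //.
  by move=> v m; apply: xgen_y.
- move=> F Fs w; apply: xgen_mem; apply: sE.
  by apply: (@allpairs_f _ _ _ (fun (F : funmod L) w => subval F w)); rewrite ?mem_enum.
Qed.

(** The vectors whose delta functions are all generated form a subspace stable under y and the
    stabilizer, hence under [dop]; the difficulty is stability under x. *)
Lemma fun_fg : ch_fg L -> ch_fg FL.
Proof.
case=> s hs.
have [E [sE Est]] := @yfin_stable _ _ _ _ _ L s (fun n _ => gwt_yfin (L_wt n)).
pose E' : seq FL := [seq delta L w e | w <- enum gT, e <- E].
have inE' w e : e \in E -> (delta L w e : FL) \in E'.
  by move=> eE; apply: (@allpairs_f _ _ _ (fun w e => delta L w e)); rewrite ?mem_enum.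
have E'w w e h : e \in E -> span_of E' (rw h (delta L w e : FL)).
  move=> eE; have -> : rw h (delta L w e : FL) = delta L (w * h^-1)%g e by apply: fwl_delta.
  by apply: span_mem; apply: inE'.
have E'y w e v : e \in E -> span_of E' (ry v (delta L w e : FL)).
  move=> eE; have -> : ry v (delta L w e : FL) = delta L w (ry (W w v) e) by apply: fyl_delta.
  have := Est.2 _ (W w v) eE.
  apply: (@span_map _ _ _ (delta L w : {linear L -> FL})) => [|e' e'E].
    exact: span_subspace.
  by apply: span_mem; apply: inE'.
have E'st : stable E'.
  by split=> x z /allpairsP[[w e] [_ eE ->]]; [apply: E'w|apply: E'y].
exists E' => P hP Px PE F.
suff : xgen E' F by apply.
have hE := xgen_subspace E'.
pose T (n : L) : Prop := forall w, xgen E' (delta L w n : FL).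
have hT : subspace T.
  split=> [w|a n n' Tn Tn' w]; first by rewrite linear0; apply: hE.1.
  by rewrite linearP; apply: hE.2; [apply: Tn|apply: Tn'].
have Ty v n : T n -> T (ry v n).
  move=> Tn w; rewrite -[v](reprVK W w) -fyl_delta.
  exact: (xgen_y E'st (W w^-1%g v) (Tn w)).
have Tw g n : T n -> T (rw g n) by move=> Tn w; rewrite delta_rw; apply: Tn.
suff TL n : T n.
  rewrite (delta_decomp F); apply: (subspace_sum hE) => w _.
  by apply: (subspaceZ hE); apply: TL.
apply: (hs T) => // [u {}n Tn w|e /sE eE w]; last first.
  by apply: xgen_mem; apply: inE'.
pose u' := dual_repr W w^-1%g u.
have u'E : dual_repr W w u' = u by rewrite /u' -dactM mulgV dact1.
(* x_{u'} applied to a delta function is the delta function of X_u n up to R. The values of R are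
   [dop] terms of translates of n, so R is generated. *)
pose R : FL := rx u' (delta L w n : FL) - delta L w (rx u n).
suff RE : xgen E' R.
  have -> : (delta L w (rx u n) : FL) = rx u' (delta L w n : FL) - R.
    by rewrite /R opprB addrC subrK.
  apply: (subspaceB hE) => //; apply: xgen_x; exact: Tn.
rewrite (delta_decomp R); apply: (subspace_sum hE) => w' _.
apply: (subspaceZ hE).
suff : T (subval R w') by apply.
have -> : subval R w' = \sum_(s0 | s0 \notin Wl)
    dop L_wt s0 (dual_repr W w' u') (subval (delta L w n) (s0 * w')%g).
  have -> : subval R w' = fx L_wt u' (subval (delta L w n)) w'
      - subval (delta L w (rx u n)) w' by rewrite /R fmB.
  rewrite /fx.
  rewrite addrAC [X in X + _](_ : _ = 0) ?add0r //; apply/eqP.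
  rewrite subr_eq0 !deltaE /delta_fun; case: ifP => [wW|_]; last by rewrite linear0.
  by rewrite rwx dual_WR subgK // /u' -dactM.
apply: (subspace_sum hT) => s0 sW; apply: (dop_closed k_rank1 L_wt _ hT) => //.
rewrite deltaE /delta_fun; case: ifP => _; last exact: hT.1.
exact: Tw.
Qed.


Notation G := (wt_prech lambda k_inv k_rank1 FL).

Definition ev (F : FL) w : L := subval (F : funmod L) w.

Lemma evD F F' w : ev (F + F') w = ev F w + ev F' w. Proof. exact: fmD. Qed.
Lemma evB F F' w : ev (F - F') w = ev F w - ev F' w. Proof. exact: fmB. Qed.
Lemma evZ a F w : ev (a *: F) w = a *: ev F w. Proof. exact: fmZ. Qed.
Lemma ev_sum I (r : seq I) (P : pred I) (F : I -> FL) w :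
  ev (\sum_(i <- r | P i) F i) w = \sum_(i <- r | P i) ev (F i) w.
Proof. exact: fm_sum. Qed.
Lemma ev0 w : ev 0 w = 0. Proof. by rewrite /ev subval0. Qed.
Lemma ev_w h F w : ev (rw h F) w = ev F (w * h)%g. Proof. by []. Qed.
Lemma ev_y v F w : ev (ry v F) w = ry (W w v) (ev F w). Proof. by []. Qed.
Lemma ev_x u F w : ev (rx u F) w = rx (dual_repr W w u) (ev F w)
  + \sum_(s | s \notin Wl) dop L_wt s (dual_repr W w u) (ev F (s * w)%g).
Proof. by []. Qed.
Lemma ev_eqv F (g : [subg Wl]) w : ev F (sgval g * w)%g = rw g (ev F w).
Proof. exact: funmodP. Qed.
Lemma ev_eq F F' : (forall w, ev F w = ev F' w) -> F = F'.
Proof. exact: funmod_eq. Qed.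

Definition eps_fun (x : wtmod lambda FL) : L := ev (subval x) 1%g.

Fact eps_lin : linear eps_fun.
Proof. by move=> a x y; rewrite /eps_fun subvalD subvalZ evD evZ. Qed.

Definition eps_linear : {linear G -> L} := mklin eps_lin.

Lemma eps_linearE (x : wtmod lambda FL) : eps_linear x = ev (subval x) 1%g.
Proof. by []. Qed.

(** F(w) is a generalized eigenvector of y_{wv} for lambda(w v), as a vector of L, and for
    lambda(v), since (y_v F)(w) = y_{wv} F(w). These differ for some v when w does not fix
    lambda. *)
Lemma gwt_supp (F : FL) w : gwt lambda F -> w \notin Wl -> ev F w = 0.
Proof.
move=> Fw wW.
have [v vN] : exists v, lambda (W w v) != lambda v.
  apply: contra_notP (elimN idP wW) => /forallNP E.
  rewrite -groupV inE; apply/eqP/lfunP => v; rewrite dactE invgK.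
  by apply/eqP/negPn/negP/E.
apply: (@shift_ker2 _ _ (ry (W w v)) (lambda (W w v)) (lambda v) _ vN).
  exact: L_wt.
have [e Fe] := Fw v; exists e.
have -> : iter e (shift (ry (W w v)) (lambda v)) (ev F w) =
    ev (iter e (ysh lambda v) F) w.
  by elim: (e) => // e' IH; rewrite [LHS]iterS IH iterS yshE evB evZ shiftE.
by rewrite Fe /ev subval0.
Qed.

Lemma wt_supp (x : wtmod lambda FL) w : w \notin Wl -> ev (subval x) w = 0.
Proof. by apply: gwt_supp; apply: (submodP x). Qed.

Fact eps_w g x : eps_linear (rw g x) = rw g (eps_linear x).
Proof. by rewrite !eps_linearE wt_wE ev_w mul1g -ev_eqv mulg1. Qed.

Fact eps_y v x : eps_linear (ry v x) = ry v (eps_linear x).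
Proof. by rewrite !eps_linearE wt_yE ev_y repr1v. Qed.

(** Functions of weight lambda are supported on the stabilizer, so the correction terms of both
    actions vanish at 1. *)
Fact eps_x u x : eps_linear (rx u x) = rx u (eps_linear x).
Proof.
rewrite !eps_linearE wt_xE evB ev_sum [X in _ - X]big1 => [|s sW]; last first.
  by rewrite /zterm evZ ev_w mul1g wt_supp // scaler0.
rewrite subr0 ev_x dact1 big1 ?addr0 // => s sW.
by rewrite mulg1 wt_supp // /dop linear0 scaler0.
Qed.

Definition eps : chom G L := Chom eps_w eps_x eps_y.

Lemma eps_inj : injective eps.
Proof.
suff ker x : eps x = 0 -> x = 0.
  move=> x y /eqP; rewrite -subr_eq0 -linearB => /eqP/ker/eqP.
  by rewrite subr_eq0 => /eqP.
rewrite [eps x]eps_linearE => x0; apply: submod_inj; apply: ev_eq => w.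
have -> : ev (subval (0 : wtmod lambda FL)) w = 0 by rewrite subval0 ev0.
have [wW|] := boolP (w \in Wl); last exact: wt_supp.
by have := ev_eqv (subval (x : wtmod lambda FL)) (subg Wl w) 1%g;
  rewrite x0 linear0 mulg1 subgK.
Qed.

Lemma eps_surj n : exists x, eps x = n.
Proof.
have dw : gwt lambda (delta L 1%g n : FL).
  by have := @delta_gwt 1%g n; rewrite invg1 dact1.
exists (tosub (gwt_subspace FL lambda) dw); exact: delta_id.
Qed.

End Fun.

Section Morphisms.

Lemma chom_Yinv (L L' : prech WR kl) (L_wt : forall n : L, gwt lambda n)
    (L'_wt : forall n : L', gwt lambda n) (f : chom L L') v n :
  (lambda v : K) != 0 -> f (Yinv L_wt v n) = Yinv L'_wt v (f n).
Proof. by move=> v0; apply/esym/Yinv_eq => //; rewrite -chy ry_inv. Qed.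

Lemma chom_dop (L L' : prech WR kl) (L_wt : forall n : L, gwt lambda n)
    (L'_wt : forall n : L', gwt lambda n) (f : chom L L') s u n :
  s \notin Wl -> f (dop L_wt s u n) = dop L'_wt s u (f n).
Proof.
move=> sW; rewrite /dop linearZZ; have [->|ks0] := eqVneq (k s) 0.
  by rewrite !mul0r !scale0r.
by rewrite (chom_Yinv _ L'_wt) // (lam_rvec k_rank1).
Qed.

Lemma chom_Zinv (M M' : prech W k) (f : chom M M')
    (g : {linear wtmod lambda M -> wtmod lambda M'}) v n :
  (forall n, subval (g n) = f (subval n)) ->
  (lambda v : K) != 0 -> g (Zinv lambda M v n) = Zinv lambda M' v (g n).
Proof.
move=> gf v0; apply/esym/Zinv_eq => //; apply: submod_inj.
by rewrite wt_yE !gf -chy -wt_yE wt_yK.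
Qed.

Lemma chom_zterm (M M' : prech W k) (f : chom M M')
    (g : {linear wtmod lambda M -> wtmod lambda M'}) s u n :
  (forall n, subval (g n) = f (subval n)) ->
  s \notin Wl -> f (zterm s u n) = zterm s u (g n).
Proof.
move=> gf sW; rewrite /zterm linearZZ; have [->|ks0] := eqVneq (k s) 0.
  by rewrite !mul0r !scale0r.
by rewrite chw -gf (chom_Zinv _ gf) // (lamb k_rank1).
Qed.

Section Res.
Variables (M M' : prech W k) (f : chom M M').
Notation N := (wt_prech lambda k_inv k_rank1).

Definition res_lin : {linear N M -> N M'} :=
  restr (gwt_subspace M lambda) (gwt_subspace M' lambda) (linearP (chfun f))
    (@chom_gwt _ _ _ _ _ M M' f lambda).

Lemma res_linE (n : wtmod lambda M) : subval (res_lin n) = f (subval n).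
Proof. by []. Qed.

Fact res_w g n : res_lin (rw g n) = rw g (res_lin n).
Proof. by apply: submod_inj; rewrite res_linE wt_wE chw. Qed.
Fact res_y v n : res_lin (ry v n) = ry v (res_lin n).
Proof. by apply: submod_inj; rewrite res_linE wt_yE chy. Qed.
Fact res_x u n : res_lin (rx u n) = rx u (res_lin n).
Proof.
apply: submod_inj; rewrite res_linE !wt_xE linearB linear_sum chx; congr (_ - _).
by apply: eq_bigr => s sW; rewrite (@chom_zterm _ _ _ res_lin).
Qed.

Definition res_chom : chom (N M) (N M') := Chom res_w res_x res_y.
End Res.

Section Ind.
Variables (L L' : prech WR kl) (L_wt : forall n : L, gwt lambda n).
Variables (L'_wt : forall n : L', gwt lambda n) (f : chom L L').
Notation FL := (fun_prech k_inv k_rank1 L_wt).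
Notation FL' := (fun_prech k_inv k_rank1 L'_wt).

Definition ind_fun (F : gT -> L) : gT -> L' := fun w => f (F w).
Fact ind_fun_lin : linear ind_fun.
Proof. by move=> a F G; apply/funext => w; rewrite /ind_fun !fctE linearP. Qed.
Fact ind_fun_eqv (F : gT -> L) : fun_eqv F -> fun_eqv (ind_fun F).
Proof. by move=> hF g w; rewrite /ind_fun hF chw. Qed.

Definition ind_lin : {linear FL -> FL'} :=
  restr (fun_eqv_subspace L) (fun_eqv_subspace L') ind_fun_lin ind_fun_eqv.

Lemma ind_linE (F : FL) w : subval (ind_lin F) w = f (subval F w).
Proof. by []. Qed.

Fact ind_w g F : ind_lin (rw g F) = rw g (ind_lin F).
Proof. by apply: funmod_eq. Qed.
Fact ind_y v F : ind_lin (ry v F) = ry v (ind_lin F).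
Proof. by apply: funmod_eq => w; rewrite ind_linE fylE [LHS]chy. Qed.
Fact ind_x u F : ind_lin (rx u F) = rx u (ind_lin F).
Proof.
apply: funmod_eq => w; rewrite ind_linE !fxlE linearD linear_sum chx; congr (_ + _).
by apply: eq_bigr => s sW; rewrite (chom_dop _ L'_wt).
Qed.

Definition ind_chom : chom FL FL' := Chom ind_w ind_x ind_y.
End Ind.
End Morphisms.

Section Functors.

Lemma WR_fix g : dual_repr WR g lambda = lambda.
Proof. by rewrite dual_WR Wstab_dact ?subgP. Qed.

(** M is isomorphic through [Phi] to the module induced from its weight space, so finite generation
    passes to the latter by [fun_fg_inv]. *)
Lemma res_fg (M : chO_obj W k lambda) : ch_fg (wt_prech lambda k_inv k_rank1 M).
Proof.
apply: (@fun_fg_inv _ (@wt_prech_wt _ _ _ _ _ lambda k_inv k_rank1 M)).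
set N_wt := @wt_prech_wt _ _ _ _ _ lambda k_inv k_rank1 M.
have [g [gf _]] := chom_inv (Phi_inj Wl_char (N_wt := N_wt))
  (Phi_surj Wl_char N_wt (@cO_eig _ _ _ _ _ _ M)).
apply: (ch_fg_chom (f := g)) (@cO_fg _ _ _ _ _ _ M) => F.
exists (Phi N_wt F).
exact: (congr1 (fun h : chom _ _ => h F) gf).
Qed.

Lemma res_xcomm (M : chO_obj W k lambda) :
  xcomm (wt_prech lambda k_inv k_rank1 M).
Proof. by apply: wt_xcomm => //; apply: ch_xx. Qed.

Lemma res_eig (M : chO_obj W k lambda) :
  ch_eig (wt_prech lambda k_inv k_rank1 M) lambda.
Proof. exact: (iffLR (gwt_eig _ WR_fix) (@wt_prech_wt _ _ _ _ _ _ _ _ M)). Qed.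

Definition res_obj (M : chO_obj W k lambda) : chO_obj WR kl lambda :=
  @ChO_obj _ _ _ _ _ _ (Chmod (@res_xcomm M)) (res_fg M) (@res_eig M).

Program Definition res_functor : functor (chO W k lambda) (chO WR kl lambda) :=
  @Functor (chO W k lambda) (chO WR kl lambda) res_obj
    (fun M M' f => res_chom (f : chom (M : chO_obj _ _ _) (M' : chO_obj _ _ _))) _ _.
Next Obligation. by apply: chom_eq => n; apply: submod_inj. Qed.
Next Obligation. by apply: chom_eq => n; apply: submod_inj. Qed.

Lemma obj_wt (L : chO_obj WR kl lambda) (n : L) : gwt lambda n.
Proof. exact: (iffRL (gwt_eig _ WR_fix) (@cO_eig _ _ _ _ _ _ L)). Qed.

Section IndObj.
Variable L : chO_obj WR kl lambda.
Notation FL := (fun_prech k_inv k_rank1 (@obj_wt L)).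

Lemma ind_xcomm : xcomm FL. Proof. by apply: fun_xcomm; apply: ch_xx. Qed.
Lemma ind_fg : ch_fg FL. Proof. by apply: fun_fg => //; apply: cO_fg. Qed.
Lemma ind_eig : ch_eig FL lambda. Proof. exact: fun_eig. Qed.

Definition ind_obj : chO_obj W k lambda :=
  @ChO_obj _ _ _ _ _ _ (Chmod ind_xcomm) ind_fg ind_eig.
End IndObj.

Program Definition ind_functor : functor (chO WR kl lambda) (chO W k lambda) :=
  @Functor (chO WR kl lambda) (chO W k lambda) ind_obj
    (fun L L' f => ind_chom (@obj_wt L) (@obj_wt L')
       (f : chom (L : chO_obj _ _ _) (L' : chO_obj _ _ _))) _ _.
Next Obligation. by apply: chom_eq => n; apply: ev_eq. Qed.
Next Obligation. by apply: chom_eq => n; apply: ev_eq. Qed.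

Lemma res_equivalence : is_equivalence res_functor.
Proof.
exists ind_functor; split.
- apply: (@chO_nat_iso _ _ _ _ _ (chO W k lambda) lambda
    (compF ind_functor res_functor) (idF _) (fun M : chO_obj W k lambda =>
       Phi (@obj_wt (res_obj M)) : chom (ind_obj (res_obj M)) M)).
  + move=> M M' f; apply: chom_eq => F.
    rewrite /= /Phi_fun linear_sum; apply: eq_bigr => w _.
    by rewrite chw.
  + by move=> M; apply: Phi_inj.
  + by move=> M; apply: Phi_surj => //; apply: cO_eig.
- apply: (@chO_nat_iso _ _ _ _ _ (chO WR kl lambda) lambda
    (compF res_functor ind_functor) (idF _) (fun L : chO_obj WR kl lambda => eps (@obj_wt L))).
  + by move=> L L' f; apply: chom_eq.
  + by move=> L; apply: eps_inj.
  + by move=> L; apply: eps_surj.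
Qed.

End Functors.
End StepOneInverse.

(** * Splitting off the fixed space *)
Section FixedSpace.
Variables (K : fieldType) (gT : finGroupType) (V : vectType K).
Variable rho : linrep gT V.
Hypothesis gT_char : (#|gT|%:R : K) != 0.

Definition fixU : {vspace V} := fixed rho.
Notation U := fixU.

Lemma fixU_repr g v : v \in U -> rho g v = v.
Proof. by move/fixedP. Qed.

Definition pU (v : V) : V := #|gT|%:R^-1 *: \sum_g rho g v.

Lemma pU_lin : linear pU.
Proof.
move=> a v w; rewrite /pU; under eq_bigr => g _ do rewrite linearP.
by rewrite big_split /= -scaler_sumr scalerDr !scalerA mulrC.
Qed.

Lemma pU_mem v : pU v \in U.
Proof.
apply/fixedP => g; rewrite /pU linearZ linear_sum /=; congr (_ *: _).
rewrite [RHS](reindex_inj (mulgI g)); apply: eq_bigr => h _.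
by rewrite reprMv.
Qed.

Lemma pU_id v : v \in U -> pU v = v.
Proof.
move=> vU; rewrite /pU (eq_bigr (fun=> v)) => [|g _]; last exact: fixU_repr.
by rewrite sumr_const -scaler_nat scalerA mulVf // scale1r.
Qed.

Lemma pU_repr g v : pU (rho g v) = pU v.
Proof.
rewrite /pU [in RHS](reindex_inj (mulIg g)); congr (_ *: _).
by apply: eq_bigr => h _; rewrite reprMv.
Qed.

Notation d := (\dim U).

Definition ub (i : 'I_d) : V := (vbasis U)`_i.

Lemma ub_mem i : ub i \in U.
Proof. by apply: vbasis_mem; rewrite mem_nth // size_tuple. Qed.

Definition xc_fun (i : 'I_d) (v : V) : K^o := coord (vbasis U) i (pU v).

Lemma xc_lin i : linear (xc_fun i).
Proof. by move=> a v w; rewrite /xc_fun pU_lin linearP. Qed.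

(** Coordinates of the averaging projection onto the fixed space: invariant linear forms dual to the
    basis [ub]. *)
Definition xc (i : 'I_d) : dual V :=
  linfun (HB.pack (xc_fun i) (GRing.isLinear.Build K V K^o *:%R (xc_fun i) (xc_lin i))
    : {linear V -> K^o}).

Lemma xcE i v : xc i v = coord (vbasis U) i (pU v).
Proof. by rewrite lfunE. Qed.

Lemma xc_repr i g v : xc i (rho g v) = xc i v.
Proof. by rewrite !xcE pU_repr. Qed.

Lemma xc_ub i j : (xc i (ub j) : K) = (i == j)%:R.
Proof.
rewrite xcE pU_id ?ub_mem // eq_sym coord_free //.
exact: (basis_free (vbasisP U)).
Qed.

Lemma pU_sum v : pU v = \sum_i (xc i v : K) *: ub i.
Proof.
rewrite {1}(coord_vbasis (pU_mem v)); apply: eq_bigr => i _.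
by rewrite xcE.
Qed.

Lemma xc_pU i v : xc i (v - pU v) = 0.
Proof. by rewrite linearB /= !xcE (pU_id (pU_mem v)) subrr. Qed.

(** The component of u in the annihilator of the fixed space, along the span of the [xc]; the
    annihilator is the dual of the quotient, through [qxC] and [qpull]. *)
Definition xC (u : dual V) : dual V := u - \sum_i (u (ub i) : K) *: xc i.

Lemma xCE u v : xC u v = u (v - pU v).
Proof.
rewrite /xC add_lfunE opp_lfunE linearB; congr (_ - _).
rewrite pU_sum linear_sum sum_lfunE; apply: eq_bigr => i _.
by rewrite scale_lfunE linearZ; apply: mulrC.
Qed.

Lemma xC_U u v : v \in U -> xC u v = 0.
Proof. by move=> vU; rewrite xCE pU_id // subrr linear0. Qed.

Lemma dual_decomp (u : dual V) : u = \sum_i (u (ub i) : K) *: xc i + xC u.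
Proof. by rewrite /xC addrC subrK. Qed.

Lemma dual_ub g (u : dual V) i : dual_repr rho g u (ub i) = u (ub i).
Proof. by rewrite dactE fixU_repr ?ub_mem. Qed.

Lemma dual_xc g i : dual_repr rho g (xc i) = xc i.
Proof. by apply/lfunP => v; rewrite dactE xc_repr. Qed.

Definition qxC (u : dual V) : dual (quotv U) := (xC u \o qlift U)%VF.

Lemma qxC_proj u v : qxC u (qproj U v) = xC u v.
Proof.
rewrite comp_lfunE; apply/eqP; rewrite -subr_eq0 -linearB; apply/eqP.
by apply: xC_U; apply: qlift_proj.
Qed.

Definition qpull (q : dual (quotv U)) : dual V := (q \o qproj U)%VF.

Lemma qpullE q v : qpull q v = q (qproj U v).
Proof. exact: comp_lfunE. Qed.

Lemma qproj_U v : v \in U -> qproj U v = 0.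
Proof. by rewrite -qproj_eq0 => /eqP. Qed.

Lemma qpull_U q v : v \in U -> qpull q v = 0.
Proof. by move=> vU; rewrite qpullE qproj_U // linear0. Qed.

Lemma qpull_xC u : qpull (qxC u) = xC u.
Proof. by apply/lfunP => v; rewrite qpullE qxC_proj. Qed.

Lemma qxC_pull q : qxC (qpull q) = q.
Proof.
apply/lfunP => z; rewrite comp_lfunE xCE linearB /= !qpullE qliftK.
by rewrite (qproj_U (pU_mem _)) linear0 subr0.
Qed.

Lemma qxC_xc i : qxC (xc i) = 0.
Proof. by apply/lfunP => z; rewrite comp_lfunE xCE xc_pU lfunE. Qed.

Lemma quot_proj g v : quot_repr rho g (qproj U v) = qproj U (rho g v).
Proof. exact: quot_funE. Qed.

Lemma qxC_repr g u : qxC (dual_repr rho g u) = dual_repr (quot_repr rho) g (qxC u).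
Proof.
apply/lfunP => z; rewrite -(qliftK z) [RHS]dactE quot_proj !qxC_proj !xCE.
rewrite dactE; congr (u _); rewrite reprB pU_repr; congr (_ - _).
by rewrite fixU_repr ?pU_mem.
Qed.

Lemma qpull_repr g q :
  qpull (dual_repr (quot_repr rho) g q) = dual_repr rho g (qpull q).
Proof.
by apply/lfunP => v; rewrite qpullE !dactE quot_proj qpullE.
Qed.

Lemma qxC_lin a u u' : qxC (a *: u + u') = a *: qxC u + qxC u'.
Proof.
apply/lfunP => z; rewrite add_lfunE scale_lfunE !comp_lfunE !xCE.
by rewrite add_lfunE scale_lfunE.
Qed.

Lemma qpull_lin a q q' : qpull (a *: q + q') = a *: qpull q + qpull q'.
Proof.
apply/lfunP => z; rewrite add_lfunE scale_lfunE !qpullE.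
by rewrite add_lfunE scale_lfunE.
Qed.

Lemma xC_diff (u : dual V) s v : xC u (rho s v - v) = u (rho s v - v).
Proof.
rewrite xCE (_ : pU _ = 0) ?subr0 //.
have -> : rho s v - v = -1 *: v + rho s v by rewrite scaleN1r addrC.
by rewrite pU_lin scaleN1r pU_repr addNr.
Qed.

End FixedSpace.

(** * Weyl algebra modules with locally nilpotent derivations *)

Section SliceOne.
Variables (K : fieldType) (N : lmodType K) (X Y : {linear N -> N}).
Hypothesis K_char : forall n, (n.+1%:R : K) != 0.
Hypothesis YX : forall n, Y (X n) = X (Y n) + n.
Hypothesis Y_nil : forall n, lnil Y n.

Lemma iterYX e n : iter e Y (X n) = X (iter e Y n) + e%:R *: iter e.-1 Y n.
Proof.
elim: e => [|e IH]; first by rewrite scale0r addr0.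
rewrite iterS IH linearD YX linearZZ -addrA; congr (_ + _).
case: e {IH} => [|e]; first by rewrite scale0r addr0 scale1r.
by rewrite /= -[X in X + _ = _]scale1r -scalerDl nat1r.
Qed.

(** The operator X Y has no negative integer eigenvalue: if n has eigenvalue -(c + 1), then Y n has
    eigenvalue -(c + 2) and a smaller exponent, so Y n = 0 by induction and then n = 0. *)
Lemma slice_zero e (c : nat) n : iter e Y n = 0 -> X (Y n) = - (c.+1%:R *: n) -> n = 0.
Proof.
elim: e c n => [|e IH] c n //; rewrite iterSr => ne nE.
have Yn0 : Y n = 0.
  apply: (IH c.+1) ne _; apply: (addIr (Y n)); rewrite -YX nE linearN linearZZ.
  by rewrite -[c.+2%:R]natr1 scalerDl scale1r opprD addrNK.
move: nE; rewrite Yn0 linear0 => /esym/eqP; rewrite oppr_eq0 scaler_eq0.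
by rewrite (negPf (K_char c)) => /eqP.
Qed.

Lemma slice_direct a n : Y a = 0 -> a = X n -> a = 0.
Proof.
move=> Ya aE; have [e ne] := Y_nil n; rewrite aE.
rewrite (@slice_zero e 0%N n) ?linear0 //.
by apply/eqP; rewrite scale1r -addr_eq0 -YX -aE Ya.
Qed.

(** If Y^(e+2) n = 0, then Y^(e+1) X Y n = (e + 1) Y^(e+1) n, so subtracting X Y n / (e + 1) from n
    lowers the exponent by one. *)
Lemma slice_sum n : exists a, Y a = 0 /\ exists b, n = a + X b.
Proof.
have [e] := Y_nil n; elim: e n => [|e IH] n.
  by move=> /= ->; exists 0; rewrite linear0; split=> //; exists 0; rewrite linear0 addr0.
case: e IH => [|e] IH ne.
  by exists n; split=> //; exists 0; rewrite linear0 addr0.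
have [|a [Ya [b nE]]] := IH (n - e.+1%:R^-1 *: X (Y n)).
  rewrite -[iter _ _ _]/(mklin (iter_linP Y e.+1) _) linBZ !mklinE iterYX.
  rewrite -!iterSr ne linear0 add0r scalerA mulVf ?K_char // scale1r subrr //.
exists a; split=> //; exists (b + e.+1%:R^-1 *: Y n).
by rewrite linearD linearZZ addrA -nE subrK.
Qed.

Definition slice_fun (n : N) : N := projT1 (cid (slice_sum n)).

Lemma slice_funP n : Y (slice_fun n) = 0 /\ exists b, n = slice_fun n + X b.
Proof. exact: projT2 (cid (slice_sum n)). Qed.

Lemma slice_fun_uniq n a b : Y a = 0 -> n = a + X b -> slice_fun n = a.
Proof.
move=> Ya nE; have [Ys [b' nE']] := slice_funP n.
apply/eqP; rewrite -subr_eq0; apply/eqP/(@slice_direct _ (b - b')).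
  by rewrite linearB Ys Ya subrr.
by rewrite linearB; apply/eqP; rewrite subr_eq addrAC eq_sym subr_eq [_ + a]addrC -nE -nE'.
Qed.

Lemma slice_lin : linear slice_fun.
Proof.
move=> a n n'; have [Yn [b nE]] := slice_funP n; have [Yn' [b' nE']] := slice_funP n'.
apply: (@slice_fun_uniq _ _ (a *: b + b')).
  by rewrite linearP Yn Yn' scaler0 addr0.
by rewrite {1}nE {1}nE' linearP scalerDr addrACA.
Qed.

Definition slice : {linear N -> N} := mklin slice_lin.

Lemma slice_Y n : Y (slice n) = 0. Proof. exact: (slice_funP n).1. Qed.
Lemma slice_X n : slice (X n) = 0.
Proof. by apply: (@slice_fun_uniq _ _ n); rewrite ?linear0 // add0r. Qed.
Lemma slice_id n : Y n = 0 -> slice n = n.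
Proof. by move=> Yn; apply: (@slice_fun_uniq _ _ 0); rewrite // linear0 addr0. Qed.
Lemma slice_comm (T : {linear N -> N}) n :
  (forall n, T (X n) = X (T n)) -> (forall n, T (Y n) = Y (T n)) ->
  slice (T n) = T (slice n).
Proof.
move=> TX TY; have [Yn [b nE]] := slice_funP n.
apply: (@slice_fun_uniq _ _ (T b)); first by rewrite -TY Yn linear0.
by rewrite {1}nE linearD TX.
Qed.

End SliceOne.

Section Slice.
Variables (K : fieldType) (N : lmodType K) (I : eqType) (X Y : I -> {linear N -> N}).
Hypothesis K_char : forall n, (n.+1%:R : K) != 0.
Hypothesis YX : forall i j n, Y i (X j n) = X j (Y i n) + (i == j)%:R *: n.
Hypothesis XX : forall i j n, X i (X j n) = X j (X i n).
Hypothesis YY : forall i j n, Y i (Y j n) = Y j (Y i n).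
Hypothesis Y_nil : forall i n, lnil (Y i) n.

(** The one-variable projections are composed. The last clause drives the induction: the projection
    for the earlier indices commutes with X_i, so its composite with the new one still kills the
    image of X_i. *)
Lemma slice_ex (r : seq I) : uniq r -> exists p : {linear N -> N},
  [/\ forall i n, i \in r -> Y i (p n) = 0, forall i n, i \in r -> p (X i n) = 0,
      forall n, (forall i, i \in r -> Y i n = 0) -> p n = n
    & forall T : {linear N -> N},
        (forall i n, i \in r -> T (X i n) = X i (T n)) ->
        (forall i n, i \in r -> T (Y i n) = Y i (T n)) ->
        forall n, p (T n) = T (p n)].
Proof.
elim: r => [_|i r IH /= /andP[ir /IH[p [pY pX p_id p_comm]]]].
  by exists idfun; split.
have YXi n : Y i (X i n) = X i (Y i n) + n by rewrite YX eqxx scale1r.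
pose q := slice K_char YXi (Y_nil i).
have neq j : j \in r -> (i == j) = false.
  by move=> jr; apply: contraNF ir => /eqP ->.
have YXj j n : j \in r -> Y i (X j n) = X j (Y i n).
  by move=> jr; rewrite YX neq // scale0r addr0.
have YjX j n : j \in r -> Y j (X i n) = X i (Y j n).
  by move=> jr; rewrite YX eq_sym neq // scale0r addr0.
exists (q \o p); split=> [j n|j n|n Yn|T TX TY n] /=.
- rewrite inE => /predU1P[->|jr]; first exact: slice_Y.
  have <- : q (Y j (p n)) = Y j (q (p n)).
    by apply: slice_comm => n'; rewrite ?YjX //; apply: YY.
  by rewrite pY //; exact: (linear0 q).
- rewrite inE => /predU1P[->|jr]; last by rewrite pX //; exact: (linear0 q).
  rewrite (p_comm (X i)) => [|l n' lr|l n' lr]; first exact: slice_X.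
    exact: XX.
  by rewrite YjX.
- rewrite p_id => [|j jr]; last by apply: Yn; rewrite inE jr orbT.
  by apply: slice_id; apply: Yn; rewrite mem_head.
- rewrite p_comm => [|j n' jr|j n' jr]; rewrite ?TX ?TY ?inE ?jr ?orbT //.
  by apply: slice_comm => n'; rewrite ?TX ?TY // mem_head.
Qed.

(** If i occurs in the word, it can be moved to the front, replacing n by Y_i n, which has a smaller
    exponent, at the cost of one letter; otherwise the word uses only the remaining indices. *)
Lemma word_bound (r : seq I) n : exists B, forall w : seq I, {subset w <= r} ->
  (B <= size w)%N -> foldl (fun n i => Y i n) n w = 0.
Proof.
pose Yw (n : N) (w : seq I) := foldl (fun n i => Y i n) n w.
have Yw0 w : Yw 0 w = 0 by elim: w => //= i w IH; rewrite linear0.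
have Yw_rem i w (m : N) : i \in w -> Yw m w = Yw (Y i m) (rem i w).
  elim: w m => //= j w IH m; rewrite inE eq_sym.
  case: (eqVneq j i) => [-> //|ji /= iw].
  by rewrite (IH _ iw) YY.
elim: r n => [|i r IH] n.
  exists 1%N => w wr; case: w wr => //= i w wr.
  by have := wr i (mem_head _ _); rewrite in_nil.
have [e] := Y_nil i n; elim: e n => [|e IHe] n.
  by move=> /= ->; exists 0%N => w _ _; apply: Yw0.
rewrite iterSr => /IHe[B1 hB1]; have [B2 hB2] := IH n.
exists (maxn B1.+1 B2) => w wr; rewrite geq_max => /andP[s1 s2].
have [iw|iw] := boolP (i \in w); last first.
  apply: hB2 => // j jw; have := wr j jw; rewrite inE => /predU1P[ji|//].
  by rewrite -ji jw in iw.
rewrite -/(Yw n w) (Yw_rem i) //; apply: hB1.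
  by move=> j /mem_rem; apply: wr.
by rewrite size_rem // -ltnS prednK // (leq_trans _ s1).
Qed.

End Slice.

(* Polynomials with coefficients in [L] in the variables [I], as symmetric    *)
(* functions on words: [F w] is the value at 0 of the iterated partial        *)
(* derivative of [F] along [w].                                               *)
Section Words.
Variables (K : fieldType) (I : finType) (L : lmodType K).
Implicit Types (F : seq I -> L) (w : seq I).

Definition Sfun (i : I) F : seq I -> L := fun w => F (i :: w).

(** The Leibniz rule for x_i F at the origin: x_i itself vanishes there, so the derivative along w
    is the sum, over the occurrences of i in w, of the values of F on w with that occurrence
    deleted. *)
Fixpoint Mrec (i : I) w F : L :=
  if w is j :: w' then (if i == j then F w' else 0) + Mrec i w' (Sfun j F)
  else 0.

Definition Mfun (i : I) F : seq I -> L := fun w => Mrec i w F.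

Definition Pfun (L' : Type) (f : L -> L') F : seq I -> L' := fun w => f (F w).

Definition wsym F : Prop :=
  forall p a b w, F (p ++ a :: b :: w) = F (p ++ b :: a :: w).

Definition wbnd F : Prop := exists B, forall w, (B <= size w)%N -> F w = 0.

Definition wpoly F : Prop := wsym F /\ wbnd F.

Lemma Sfun_lin i : linear (Sfun i). Proof. by []. Qed.

Lemma Mfun_lin i : linear (Mfun i).
Proof.
move=> a F G; apply/funext => w; rewrite /Mfun !fctE.
elim: w F G => [|j w IH] F G /=; first by rewrite scaler0 addr0.
rewrite -[Sfun j _]/(a *: Sfun j F + Sfun j G) IH scalerDr !addrA; congr (_ + _).
by case: ifP => _; [exact: addrAC|rewrite scaler0 add0r addr0].
Qed.

Lemma Pfun_lin (f : {linear L -> L}) : linear (Pfun f).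
Proof. by move=> a F G; apply/funext => w; rewrite /Pfun !fctE linearP. Qed.

Lemma SM i j F : Sfun j (Mfun i F) = (i == j)%:R *: F + Mfun i (Sfun j F).
Proof.
apply/funext => w; rewrite /Mfun {1}/Sfun /= !fctE; congr (_ + _).
by case: (i == j); rewrite ?scale1r ?scale0r.
Qed.

Lemma MM i j F : Mfun i (Mfun j F) = Mfun j (Mfun i F).
Proof.
apply/funext => w; elim: w F => [//|l w IH] F.
rewrite -[LHS]/(Sfun l (Mfun i (Mfun j F)) w) -[RHS]/(Sfun l (Mfun j (Mfun i F)) w).
rewrite !SM !Mfun_lin !fctE IH !addrA; congr (_ + _).
exact: addrC.
Qed.

Lemma SP i f F : Sfun i (Pfun f F) = Pfun f (Sfun i F). Proof. by []. Qed.

Lemma MP i (f : {linear L -> L}) F : Mfun i (Pfun f F) = Pfun f (Mfun i F).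
Proof.
apply/funext => w; elim: w F => [|l w IH] F; first by rewrite /Pfun /= linear0.
rewrite -[LHS]/(Sfun l (Mfun i (Pfun f F)) w) -[RHS]/(f (Sfun l (Mfun i F) w)).
by rewrite !SM !fctE linearD linearZZ SP IH.
Qed.

Lemma SS i j F : wsym F -> Sfun i (Sfun j F) = Sfun j (Sfun i F).
Proof. by move=> hF; apply/funext => w; apply: (hF [::]). Qed.

Lemma wsym_S i F : wsym F -> wsym (Sfun i F).
Proof. by move=> hF p a b w; apply: (hF (i :: p)). Qed.

Lemma wsym_M i F : wsym F -> wsym (Mfun i F).
Proof.
move=> hF p; elim: p F hF => [|j p IH] F hF a b w.
  rewrite -[LHS]/(Sfun b (Sfun a (Mfun i F)) w) -[RHS]/(Sfun a (Sfun b (Mfun i F)) w).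
  rewrite !SM ![Sfun _ (_ + _)](Sfun_lin _ _ _ _) !SM (SS a b hF) !fctE !addrA.
  by congr (_ + _); exact: addrC.
rewrite -[LHS]/(Sfun j (Mfun i F) _) -[RHS]/(Sfun j (Mfun i F) _) SM !fctE.
by rewrite hF IH //; apply: wsym_S.
Qed.

Lemma wbnd_S i F : wbnd F -> wbnd (Sfun i F).
Proof. by case=> B hB; exists B => w Bw; apply: hB; apply: leqW. Qed.

Lemma wbnd_M i F : wbnd F -> wbnd (Mfun i F).
Proof.
case=> B hB; exists B.+1 => w; elim: w B F hB => [//|j w IH] B F hB sw.
rewrite -[LHS]/(Sfun j (Mfun i F) w) SM !fctE hB // scaler0 add0r.
case: B hB sw => [|B] hB sw.
  rewrite (_ : Sfun j F = 0); last by apply/funext => z; apply: hB.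
  by rewrite -[Mfun i]/(mklin (Mfun_lin i) : _ -> _) linear0.
by apply: (IH B) => // z Bz; apply: hB.
Qed.

Lemma wpoly_subspace : subspace wpoly.
Proof.
split=> [|a F G [Fs [B hB]] [Gs [C hC]]]; first by split; [|exists 0%N].
split=> [p i j w|]; first by rewrite !fctE Fs Gs.
exists (maxn B C) => w; rewrite geq_max => /andP[Bw Cw].
by rewrite !fctE hB // hC // scaler0 addr0.
Qed.

Lemma wpoly_S i F : wpoly F -> wpoly (Sfun i F).
Proof. by case=> Fs Fb; split; [apply: wsym_S|apply: wbnd_S]. Qed.
Lemma wpoly_M i F : wpoly F -> wpoly (Mfun i F).
Proof. by case=> Fs Fb; split; [apply: wsym_M|apply: wbnd_M]. Qed.
Lemma wpoly_P (f : {linear L -> L}) F : wpoly F -> wpoly (Pfun f F).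
Proof.
case=> Fs [B hB]; split=> [p a b w|]; first by rewrite /Pfun Fs.
by exists B => w Bw; rewrite /Pfun hB // linear0.
Qed.

Definition polymod : lmodType K := submod wpoly_subspace.

Definition Sop i : {linear polymod -> polymod} :=
  restr _ _ (Sfun_lin i) (@wpoly_S i).
Definition Mop i : {linear polymod -> polymod} :=
  restr _ _ (Mfun_lin i) (@wpoly_M i).
Definition Pop (f : {linear L -> L}) : {linear polymod -> polymod} :=
  restr _ _ (Pfun_lin f) (@wpoly_P f).

Lemma SopE i (F : polymod) w : subval (Sop i F) w = subval F (i :: w).
Proof. by []. Qed.
Lemma PopE f (F : polymod) w : subval (Pop f F) w = f (subval F w).
Proof. by []. Qed.
Lemma Mop_nil i (F : polymod) : subval (Mop i F) [::] = 0. Proof. by []. Qed.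

Lemma polymod_eq (F G : polymod) : (forall w, subval F w = subval G w) -> F = G.
Proof. by move=> FG; apply/submod_inj/funext. Qed.

Lemma Sop_Mop i j (F : polymod) : Sop j (Mop i F) = (i == j)%:R *: F + Mop i (Sop j F).
Proof. by apply: submod_inj; rewrite subvalD subvalZ; apply: SM. Qed.
Lemma Mop_Mop i j (F : polymod) : Mop i (Mop j F) = Mop j (Mop i F).
Proof. by apply: submod_inj; apply: MM. Qed.
Lemma Sop_Sop i j (F : polymod) : Sop i (Sop j F) = Sop j (Sop i F).
Proof. by apply: submod_inj; apply: SS; apply: (submodP F).1. Qed.
Lemma Sop_Pop i f (F : polymod) : Sop i (Pop f F) = Pop f (Sop i F).
Proof. by apply: submod_inj. Qed.
Lemma Mop_Pop i f (F : polymod) : Mop i (Pop f F) = Pop f (Mop i F).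
Proof. by apply: submod_inj; apply: MP. Qed.

Lemma polyD (F G : polymod) w : subval (F + G) w = subval F w + subval G w.
Proof. by rewrite subvalD. Qed.
Lemma polyB (F G : polymod) w : subval (F - G) w = subval F w - subval G w.
Proof. by rewrite subvalB. Qed.
Lemma polyZ a (F : polymod) w : subval (a *: F) w = a *: subval F w.
Proof. by rewrite subvalZ. Qed.
Lemma poly0 w : subval (0 : polymod) w = 0.
Proof. by rewrite subval0. Qed.
Lemma poly_sum J (r : seq J) (P : pred J) (F : J -> polymod) w :
  subval (\sum_(i <- r | P i) F i) w = \sum_(i <- r | P i) subval (F i) w.
Proof. by rewrite subval_sum fct_sumE. Qed.

Definition cst_fun (n : L) : seq I -> L := fun w => if w is [::] then n else 0.

Lemma cst_wpoly n : wpoly (cst_fun n).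
Proof. by split=> [[|? ?] a b w //|]; exists 1%N; case. Qed.

Definition cst_mod n : polymod := tosub wpoly_subspace (cst_wpoly n).

Lemma cst_lin : linear cst_mod.
Proof.
move=> a n n'; apply: polymod_eq => w; rewrite polyD polyZ /=.
by case: w => //=; rewrite scaler0 addr0.
Qed.

Definition cstp : {linear L -> polymod} := mklin cst_lin.

Lemma Sop_cst i n : Sop i (cstp n) = 0.
Proof. by apply: polymod_eq => w; rewrite poly0. Qed.
Lemma Pop_cst (f : {linear L -> L}) n : Pop f (cstp n) = cstp (f n).
Proof. by apply: polymod_eq => -[|i w] //=; rewrite /Pfun /= linear0. Qed.

Lemma poly_cst (F : polymod) : (forall i, Sop i F = 0) -> F = cstp (subval F [::]).
Proof.
move=> F0; apply: polymod_eq => -[//|i w].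
by rewrite -SopE F0 poly0.
Qed.

(** Euler's identity: words of length k carry the part of degree k, on which the operator is
    multiplication by k. *)
Lemma euler (F : polymod) w :
  subval (\sum_i Mop i (Sop i F)) w = (size w)%:R *: subval F w.
Proof.
elim: w F => [|j w IH] F.
  by rewrite poly_sum scale0r big1.
rewrite -SopE linear_sum poly_sum.
under eq_bigr => i _ do rewrite Sop_Mop polyD polyZ Sop_Sop.
rewrite big_split -poly_sum IH (bigD1 j) //= eqxx scale1r big1 => [|i ij].
  rewrite addr0 -!SopE -[X in X + _]scale1r -scalerDl; congr (_ *: _).
  by rewrite nat1r.
by rewrite (negPf ij) scale0r.
Qed.

Hypothesis K_char : forall n, (n.+1%:R : K) != 0.

Lemma hom_wpoly k (F : polymod) :
  wpoly (fun w => if size w == k then subval F w else 0).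
Proof.
have [Fs [B hB]] := submodP F; split=> [p a b w|].
  by rewrite !size_cat /= Fs.
by exists B => w /hB ->; case: ifP.
Qed.

Definition hom_part k (F : polymod) : polymod := tosub wpoly_subspace (hom_wpoly k F).

(** Euler's identity recovers a homogeneous part of positive degree from its derivatives, by
    multiplication with the variables and division by the degree; F is the finite sum of its
    homogeneous parts. *)
Lemma poly_gen (P : polymod -> Prop) : subspace P ->
  (forall i (F : polymod), P F -> P (Mop i F)) -> (forall n, P (cstp n)) ->
  forall F : polymod, P F.
Proof.
move=> hP PM Pc F.
have Phom k (G : polymod) : (forall w, size w != k -> subval G w = 0) -> P G.
  elim: k G => [|k IH] G hG.
    by rewrite (@poly_cst G) // => i; apply: polymod_eq => w; rewrite SopE hG // poly0.
  have -> : G = k.+1%:R^-1 *: \sum_i Mop i (Sop i G).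
    apply: polymod_eq => w; rewrite polyZ euler.
    have [->|wk] := eqVneq (size w) k.+1; last by rewrite hG // !scaler0.
    by rewrite scalerA mulVf // scale1r.
  apply: (subspaceZ hP); apply: (subspace_sum hP) => i _; apply: PM.
  by apply: IH => w wk; rewrite SopE hG.
have [Fs [B hB]] := submodP F.
have -> : F = \sum_(k < B) hom_part k F.
  apply: polymod_eq => w; rewrite poly_sum.
  have [wB|wB] := ltnP (size w) B.
    rewrite (bigD1 (Ordinal wB)) //= eqxx big1 ?addr0 // => k /negPf kw.
    by rewrite -(inj_eq val_inj) /= eq_sym in kw; rewrite kw.
  by rewrite hB // big1 // => k _ /=; rewrite hB // if_same.
apply: (subspace_sum hP) => k _; apply: (Phom k) => w /negPf wk.
by rewrite /= wk.
Qed.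

End Words.

Arguments Sop {K I L} i.
Arguments Mop {K I L} i.
Arguments Pop {K} I {L} f.
Arguments cstp {K} I {L}.

Lemma dual_lin (K : fieldType) (V : vectType K) (u u' : dual V) a v :
  ((a *: u + u') v : K) = a * (u v : K) + (u' v : K).
Proof. by rewrite add_lfunE scale_lfunE. Qed.

Lemma add3_eq (M : zmodType) (a b c a' b' c' : M) :
  a = a' -> b = b' -> c = c' -> a + b + c = a' + b' + c'.
Proof. by move=> -> -> ->. Qed.

(** * Polynomials with coefficients in a module of the quotient *)

Section StepTwo.
Variables (K : fieldType) (gT : finGroupType) (V : vectType K).
Variables (rho : linrep gT V) (k : gT -> K) (lambda : dual V).
Hypothesis gT_char : (#|gT|%:R : K) != 0.
Hypothesis K_char : forall n, (n.+1%:R : K) != 0.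
Hypothesis lam_fix : forall g, dual_repr rho g lambda = lambda.

Notation U := (fixU rho).
Notation Q := (quotv U).
Notation rhoQ := (quot_repr rho).
Notation d := (\dim U).

Let lam (v : V) : K := lambda v.

Section Poly.
Variable L : prech rhoQ k.

Notation PL := (polymod 'I_d L).

(** The action of y_v - lambda(v): the derivative along the fixed component of v plus the
    coefficientwise action of its class in the quotient. *)
Definition pol_T_fun (v : V) (F : PL) : PL :=
  \sum_i (xc i v : K) *: Sop i F + Pop 'I_d (ry (qproj U v)) F.

Fact pol_T_lin v : linear (pol_T_fun v).
Proof.
move=> a F G; rewrite /pol_T_fun linearP scalerDr addrACA; congr (_ + _).
rewrite scaler_sumr -big_split; apply: eq_bigr => i _.
by rewrite linearP scalerDr !scalerA mulrC.
Qed.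

Definition pol_T v : {linear PL -> PL} := locked (mklin (pol_T_lin v)).

Lemma pol_TE v F : pol_T v F = \sum_i (xc i v : K) *: Sop i F + Pop 'I_d (ry (qproj U v)) F.
Proof. by rewrite /pol_T -lock. Qed.

Fact pol_x_lin (u : dual V) : linear (fun F : PL =>
  \sum_i (u (ub i) : K) *: Mop i F + Pop 'I_d (rx (qxC rho u)) F).
Proof.
move=> a F G; rewrite linearP scalerDr addrACA; congr (_ + _).
rewrite scaler_sumr -big_split; apply: eq_bigr => i _.
by rewrite linearP scalerDr !scalerA mulrC.
Qed.

Definition pol_x (u : dual V) : {linear PL -> PL} := locked (mklin (pol_x_lin u)).
Definition pol_y v : {linear PL -> PL} := shift (pol_T v) (- lam v).
Definition pol_w g : {linear PL -> PL} := Pop 'I_d (rw g).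

Lemma pol_xE u F : pol_x u F =
  \sum_i (u (ub i) : K) *: Mop i F + Pop 'I_d (rx (qxC rho u)) F.
Proof. by rewrite /pol_x -lock. Qed.
Lemma pol_yE v F : pol_y v F = pol_T v F + lam v *: F.
Proof. by rewrite [LHS]shiftE scaleNr opprK. Qed.

Fact pol_w1 F : pol_w 1%g F = F.
Proof. by apply: polymod_eq => w; rewrite PopE rw1. Qed.
Fact pol_wM g h F : pol_w (g * h)%g F = pol_w g (pol_w h F).
Proof. by apply: polymod_eq => w; rewrite !PopE rwM. Qed.

Fact pol_xL a u u' F : pol_x (a *: u + u') F = a *: pol_x u F + pol_x u' F.
Proof.
rewrite !pol_xE scalerDr addrACA; congr (_ + _).
  rewrite scaler_sumr -big_split; apply: eq_bigr => i _.
  by rewrite dual_lin scalerDl scalerA.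
by apply: polymod_eq => w; rewrite polyD polyZ !PopE qxC_lin rxL.
Qed.

Lemma pol_TL a v v' F : pol_T (a *: v + v') F = a *: pol_T v F + pol_T v' F.
Proof.
rewrite !pol_TE scalerDr addrACA; congr (_ + _).
  rewrite scaler_sumr -big_split; apply: eq_bigr => i _.
  by rewrite dualD dualZ scalerDl scalerA.
by apply: polymod_eq => w; rewrite polyD polyZ !PopE linearP ryL.
Qed.

Fact pol_yL a v v' F : pol_y (a *: v + v') F = a *: pol_y v F + pol_y v' F.
Proof.
rewrite !pol_yE pol_TL scalerDr addrACA; congr (_ + _).
have -> : lam (a *: v + v') = a * lam v + lam v' by apply: (linearP lambda).
by rewrite scalerDl scalerA.
Qed.

Fact pol_wx g u F : pol_w g (pol_x u F) = pol_x (dual_repr rho g u) (pol_w g F).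
Proof.
rewrite !pol_xE linearD linear_sum; congr (_ + _).
  by apply: eq_bigr => i _; rewrite linearZZ dual_ub Mop_Pop.
by apply: polymod_eq => w; rewrite !PopE rwx qxC_repr.
Qed.

Lemma pol_wT g v F : pol_w g (pol_T v F) = pol_T (rho g v) (pol_w g F).
Proof.
rewrite !pol_TE linearD linear_sum; congr (_ + _).
  by apply: eq_bigr => i _; rewrite linearZZ xc_repr Sop_Pop.
by apply: polymod_eq => w; rewrite !PopE rwy quot_proj.
Qed.

Lemma lam_repr g v : lam (rho g v) = lam v.
Proof. by rewrite /lam -{1}(lam_fix g) dactE reprK. Qed.

Fact pol_wy g v F : pol_w g (pol_y v F) = pol_y (rho g v) (pol_w g F).
Proof. by rewrite !pol_yE linearD linearZZ pol_wT lam_repr. Qed.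

Lemma pol_TT v v' F : pol_T v (pol_T v' F) = pol_T v' (pol_T v F).
Proof.
have E v1 v2 : pol_T v1 (pol_T v2 F) =
   \sum_i \sum_j ((xc i v1 : K) * (xc j v2 : K)) *: Sop i (Sop j F)
   + (\sum_i (xc i v1 : K) *: Pop 'I_d (ry (qproj U v2)) (Sop i F)
      + \sum_i (xc i v2 : K) *: Pop 'I_d (ry (qproj U v1)) (Sop i F))
   + Pop 'I_d (ry (qproj U v1)) (Pop 'I_d (ry (qproj U v2)) F).
  rewrite pol_TE pol_TE [Pop _ _ (_ + _)]linearD [Pop _ _ (\sum_(_ | _) _)]linear_sum.
  rewrite !addrA; congr (_ + _ + _); last first.
    by apply: eq_bigr => i _; rewrite linearZZ.
  rewrite -big_split; apply: eq_bigr => i _.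
  rewrite linearD linear_sum scalerDr scaler_sumr Sop_Pop; congr (_ + _).
  by apply: eq_bigr => j _; rewrite linearZZ scalerA.
rewrite !E; congr (_ + _ + _).
- rewrite exchange_big; apply: eq_bigr => i _; apply: eq_bigr => j _.
  by rewrite Sop_Sop mulrC.
- exact: addrC.
- by apply: polymod_eq => w; rewrite !PopE ryy.
Qed.

Fact pol_yy v v' F : pol_y v (pol_y v' F) = pol_y v' (pol_y v F).
Proof. by apply: shift_comm; apply: pol_TT. Qed.

(** Splitting u and v along the fixed space, the fixed components contribute the Weyl relation
    ([E1]), the others the relation of the quotient ([E2]), and mixed terms commute; [E5] adds the
    two scalars up to u(v). *)
Lemma pol_Tx v u F : pol_T v (pol_x u F) = pol_x u (pol_T v F) + (u v : K) *: F
  - \sum_s (k s * (u (rho s v - v) : K)) *: pol_w s F.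
Proof.
have E1 : \sum_i (xc i v : K) *: Sop i (\sum_j (u (ub j) : K) *: Mop j F) =
    \sum_(j < d) (u (ub j) : K) *: Mop j (\sum_i (xc i v : K) *: Sop i F)
    + (\sum_(i < d) (xc i v : K) * (u (ub i) : K)) *: F.
  transitivity (\sum_i (\sum_j ((xc i v : K) * (u (ub j) : K)) *: Mop j (Sop i F)
      + \sum_j ((xc i v : K) * (u (ub j) : K) * (j == i)%:R) *: F)).
    apply: eq_bigr => i _; rewrite [Sop i _]linear_sum scaler_sumr -big_split.
    apply: eq_bigr => j _; rewrite linearZZ scalerA Sop_Mop scalerDr scalerA.
    exact: addrC.
  rewrite big_split scaler_suml; congr (_ + _).
    rewrite exchange_big; apply: eq_bigr => j _.
    rewrite linear_sum scaler_sumr; apply: eq_bigr => i _.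
    by rewrite linearZZ scalerA mulrC.
  apply: eq_bigr => i _; rewrite (bigD1 i) //= eqxx mulr1.
  by rewrite big1 ?addr0 // => j /negPf->; rewrite mulr0 scale0r.
have E2 : Pop 'I_d (ry (qproj U v)) (Pop 'I_d (rx (qxC rho u)) F) =
    Pop 'I_d (rx (qxC rho u)) (Pop 'I_d (ry (qproj U v)) F) + (xC rho u v : K) *: F
    - \sum_s (k s * (u (rho s v - v) : K)) *: pol_w s F.
  apply: polymod_eq => w; rewrite polyB polyD polyZ poly_sum !PopE ryx qxC_proj //.
  congr (_ - _); apply: eq_bigr => s _.
  by rewrite polyZ PopE quot_proj -linearB qxC_proj // xC_diff.
have E3 : \sum_i (xc i v : K) *: Sop i (Pop 'I_d (rx (qxC rho u)) F) =
    Pop 'I_d (rx (qxC rho u)) (\sum_i (xc i v : K) *: Sop i F).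
  rewrite [Pop _ _ (\sum_(_ | _) _)]linear_sum; apply: eq_bigr => i _.
  by rewrite [Pop _ _ (_ *: _)]linearZZ Sop_Pop.
have E4 : Pop 'I_d (ry (qproj U v)) (\sum_j (u (ub j) : K) *: Mop j F) =
    \sum_j (u (ub j) : K) *: Mop j (Pop 'I_d (ry (qproj U v)) F).
  rewrite [Pop _ _ (\sum_(_ | _) _)]linear_sum; apply: eq_bigr => i _.
  by rewrite [Pop _ _ (_ *: _)]linearZZ Mop_Pop.
have E5 : (u v : K) = \sum_(i < d) (xc i v : K) * (u (ub i) : K) + (xC rho u v : K).
  rewrite {1}(dual_decomp rho u) add_lfunE sum_lfunE; congr (_ + _).
  by apply: eq_bigr => i _; rewrite scale_lfunE; apply: mulrC.
have sumM (A B : PL) : \sum_(j < d) (u (ub j) : K) *: Mop j (A + B) =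
    \sum_(j < d) (u (ub j) : K) *: Mop j A + \sum_(j < d) (u (ub j) : K) *: Mop j B.
  by rewrite -big_split; apply: eq_bigr => j _; rewrite [Mop j _]linearD scalerDr.
have sumS (A B : PL) : \sum_(i < d) (xc i v : K) *: Sop i (A + B) =
    \sum_(i < d) (xc i v : K) *: Sop i A + \sum_(i < d) (xc i v : K) *: Sop i B.
  by rewrite -big_split; apply: eq_bigr => i _; rewrite [Sop i _]linearD scalerDr.
rewrite [LHS]pol_TE [pol_x u F]pol_xE [pol_x u _]pol_xE [pol_T v F]pol_TE.
rewrite sumS sumM E1 E3.
rewrite ![Pop _ _ (_ + _)]linearD E2 E4 E5 scalerDl.
move: (\sum_(j < d) _ *: Mop j (\sum_(i < d) _)) (_ *: F) (xC rho u v *: F).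
move: (\sum_(j < d) _ *: Mop j _) (Pop _ _ (\sum_(i < d) _)) (Pop _ _ (Pop _ _ _)).
move: (\sum_s _ *: pol_w s F) => S B C D A c c'.
rewrite !addrA; congr (_ - _).
by rewrite [LHS](ACl (1 * 4 * 3 * 5 * 2 * 6)%AC).
Qed.

Fact pol_yx v u F : pol_y v (pol_x u F) = pol_x u (pol_y v F) + (u v : K) *: F
  - \sum_s (k s * (u (rho s v - v) : K)) *: pol_w s F.
Proof.
rewrite !pol_yE pol_Tx [pol_x u (_ + _)]linearD [pol_x u (_ *: _)]linearZZ.
by rewrite [LHS]addrAC; congr (_ - _); rewrite addrAC.
Qed.

Definition pol_prech : prech rho k :=
  Prech pol_w1 pol_wM pol_xL pol_yL pol_wx pol_wy pol_yy pol_yx.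

Lemma pol_xcomm : xcomm L -> xcomm pol_prech.
Proof.
move=> Lxx u u' F.
have E (a a' : dual V) : pol_x a (pol_x a' F) =
   \sum_(i < d) \sum_(j < d) ((a (ub i) : K) * (a' (ub j) : K)) *: Mop i (Mop j F)
   + (\sum_(i < d) (a (ub i) : K) *: Pop 'I_d (rx (qxC rho a')) (Mop i F)
      + \sum_(i < d) (a' (ub i) : K) *: Pop 'I_d (rx (qxC rho a)) (Mop i F))
   + Pop 'I_d (rx (qxC rho a)) (Pop 'I_d (rx (qxC rho a')) F).
  rewrite pol_xE pol_xE [Pop _ _ (_ + _)]linearD [Pop _ _ (\sum_(_ | _) _)]linear_sum.
  rewrite !addrA; congr (_ + _ + _); last first.
    by apply: eq_bigr => i _; rewrite linearZZ.
  rewrite -big_split; apply: eq_bigr => i _.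
  rewrite [Mop i (_ + _)]linearD [Mop i (\sum_(_ | _) _)]linear_sum scalerDr scaler_sumr.
  rewrite Mop_Pop; congr (_ + _).
  by apply: eq_bigr => j _; rewrite [Mop i (_ *: _)]linearZZ scalerA.
apply: (etrans (E u u')); apply: (etrans _ (esym (E u' u))); apply: add3_eq.
- rewrite exchange_big; apply: eq_bigr => i _; apply: eq_bigr => j _.
  by rewrite Mop_Mop mulrC.
- exact: addrC.
- by apply: polymod_eq => w; rewrite !PopE Lxx.
Qed.

Lemma pol_x_xc i F : pol_x (xc i) F = Mop i F.
Proof.
rewrite pol_xE (bigD1 i) //= xc_ub // eqxx scale1r big1 => [|j /negPf ij].
  rewrite addr0 qxC_xc //; apply/eqP; rewrite -subr_eq0 addrC addKr.
  by apply/eqP/polymod_eq => w; rewrite PopE rx0 poly0.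
by rewrite xc_ub // eq_sym ij scale0r.
Qed.

Lemma pol_x_pull q F : pol_x (qpull q) F = Pop 'I_d (rx q) F.
Proof.
rewrite pol_xE big1 ?add0r ?qxC_pull // => i _.
by rewrite qpull_U ?ub_mem // scale0r.
Qed.

Lemma pol_ysh v F : ysh lambda v (F : pol_prech) = pol_T v F.
Proof. by rewrite yshE [ry v _]pol_yE addrK. Qed.

Hypothesis L_wt : forall n : L, gwt (0 : dual Q) n.

(** By [poly_gen] it suffices to treat constants, where the operator acts through L, and
    multiplication by a variable, whose commutator with the operator is a scalar. *)
Lemma pol_wt (F : pol_prech) : gwt lambda F.
Proof.
move=> v; apply: (poly_gen K_char (P := fun F : PL => lnil (ysh lambda v) (F : pol_prech))).
- exact: lnil_subspace.
- move=> i {}F Fn.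
  apply: (@lnil_commutator _ _ _ (ysh lambda v : {linear pol_prech -> pol_prech})
    (ysh lambda v) (Mop i : {linear pol_prech -> pol_prech})
    (fun F => (xc i v : K) *: F) (lnil (ysh lambda v))) => //.
  + move=> G _; rewrite !pol_ysh -!pol_x_xc pol_Tx big1 ?subr0 // => s _.
    by rewrite linearB /= xc_repr subrr mulr0 scale0r.
  + by move=> G; apply: lnil_stepW.
  + by move=> G; apply: (subspaceZ (lnil_subspace _)).
- move=> n; have [e ne] := L_wt n (qproj U v); exists e.
  have -> : iter e (ysh lambda v) (cstp 'I_d n : pol_prech) =
      cstp 'I_d (iter e (ysh 0 (qproj U v)) n).
    elim: (e) => // e' IH; rewrite [LHS]iterS IH pol_ysh pol_TE iterS yshE.
    rewrite big1 => [|i _]; last by rewrite Sop_cst scaler0.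
    have z0 z : ((0 : dual Q) z : K) = 0 by rewrite lfunE.
    by rewrite add0r Pop_cst z0 scale0r subr0.
  by rewrite ne linear0.
Qed.

Lemma pol_fg : ch_fg L -> ch_fg pol_prech.
Proof.
case=> s hs; exists [seq cstp 'I_d n | n <- s] => P hP Px Ps.
apply: (poly_gen K_char (P := P)) => // [i F PF|]; first by rewrite -pol_x_xc; apply: Px.
apply: (hs (fun n => P (cstp 'I_d n))) => [|q n Pn|n ns].
- exact: (subspace_comp (cstp 'I_d : {linear L -> pol_prech}) hP).
- by rewrite -Pop_cst -pol_x_pull; apply: Px.
- by apply: Ps; apply: map_f.
Qed.

End Poly.
End StepTwo.

Arguments pol_T {K gT V rho k L} v.

(** * The joint kernel along the fixed space *)

Section Par.
Variables (K : fieldType) (gT : finGroupType) (V : vectType K).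
Variables (rho : linrep gT V) (k : gT -> K) (lambda : dual V).
Hypothesis gT_char : (#|gT|%:R : K) != 0.
Hypothesis K_char : forall n, (n.+1%:R : K) != 0.
Hypothesis lam_fix : forall g, dual_repr rho g lambda = lambda.

Notation U := (fixU rho).
Notation Q := (quotv U).
Notation rhoQ := (quot_repr rho).
Notation d := (\dim U).

Let lam (v : V) : K := lambda v.

Section ParMod.
Variable N : prech rho k.

Lemma ysh_lin a v v' (n : N) :
  ysh lambda (a *: v + v') n = a *: ysh lambda v n + ysh lambda v' n.
Proof.
rewrite !yshE ryL dualD dualZ scalerDl -scalerA scalerBr opprD addrACA.
by [].
Qed.

Lemma yshB v v' (n : N) : ysh lambda (v - v') n = ysh lambda v n - ysh lambda v' n.
Proof.
have -> : v - v' = -1 *: v' + v by rewrite scaleN1r addrC.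
by rewrite ysh_lin scaleN1r addrC.
Qed.

Lemma ysh_rx v (u : dual V) (n : N) : (forall s, (u (rho s v - v) : K) = 0) ->
  ysh lambda v (rx u n) = rx u (ysh lambda v n) + (u v : K) *: n.
Proof.
move=> u0; rewrite !yshE ryx linBZ big1 ?subr0 1?addrAC // => s _.
by rewrite u0 mulr0 scale0r.
Qed.

Lemma ysh_rx_U v (u : dual V) (n : N) : v \in U ->
  ysh lambda v (rx u n) = rx u (ysh lambda v n) + (u v : K) *: n.
Proof. by move=> vU; apply: ysh_rx => s; rewrite fixU_repr // subrr linear0. Qed.

Lemma ysh_rx_xc v (i : 'I_d) (n : N) :
  ysh lambda v (rx (xc i) n) = rx (xc i) (ysh lambda v n) + (xc i v : K) *: n.
Proof. by apply: ysh_rx => s; rewrite linearB /= xc_repr subrr. Qed.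

Lemma ysh_rw v g (n : N) : ysh lambda (rho g v) (rw g n) = rw g (ysh lambda v n).
Proof. by rewrite !yshE linBZ rwy; congr (_ - _ *: _); apply: (lam_repr lam_fix). Qed.

Definition parP (n : N) : Prop := forall v, v \in U -> ysh lambda v n = 0.

Lemma parP_subspace : subspace parP.
Proof.
split=> [v _|a n n' Pn Pn' v vU]; first by rewrite linear0.
by rewrite linearP Pn // Pn' // scaler0 addr0.
Qed.

Definition parmod : lmodType K := submod parP_subspace.

Lemma par_w_sub g n : parP n -> parP (rw g n).
Proof.
move=> Pn v vU; rewrite -[v](reprVK rho g) ysh_rw Pn ?linear0 //.
by rewrite fixU_repr.
Qed.

Lemma par_x_sub (q : dual Q) n : parP n -> parP (rx (qpull q) n).
Proof.
move=> Pn v vU; rewrite ysh_rx_U // Pn // linear0 qpull_U // add0r.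
exact: scale0r.
Qed.

Lemma par_y_sub v n : parP n -> parP (ysh lambda v n).
Proof. by move=> Pn v' vU; rewrite ysh_comm Pn // linear0. Qed.

Definition par_w g : {linear parmod -> parmod} :=
  restr parP_subspace parP_subspace (linearP (rw g : {linear N -> N})) (@par_w_sub g).
Definition par_x (q : dual Q) : {linear parmod -> parmod} :=
  restr parP_subspace parP_subspace (linearP (rx (qpull q) : {linear N -> N})) (@par_x_sub q).
Definition par_ysh v : {linear parmod -> parmod} :=
  restr parP_subspace parP_subspace (linearP (ysh lambda v : {linear N -> N})) (@par_y_sub v).
Definition par_y (z : Q) : {linear parmod -> parmod} := par_ysh (qlift U z).

Lemma par_wE g n : subval (par_w g n) = rw g (subval n). Proof. by []. Qed.
Lemma par_xE q n : subval (par_x q n) = rx (qpull q) (subval n). Proof. by []. Qed.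
Lemma par_yE z n : subval (par_y z n) = ysh lambda (qlift U z) (subval n).
Proof. by []. Qed.

(** This makes the action [par_y] of the quotient independent of the chosen lifts. *)
Lemma par_mod (n : parmod) v v' : v - v' \in U ->
  ysh lambda v (subval n) = ysh lambda v' (subval n).
Proof.
by move=> vU; apply/eqP; rewrite -subr_eq0 -yshB; apply/eqP/(submodP n).
Qed.

Lemma par_y_proj v n : subval (par_y (qproj U v) n) = ysh lambda v (subval n).
Proof. by rewrite par_yE; apply: par_mod; apply: qlift_proj. Qed.

Fact par_w1 n : par_w 1%g n = n.
Proof. by apply: submod_inj; rewrite par_wE rw1. Qed.
Fact par_wM g h n : par_w (g * h)%g n = par_w g (par_w h n).
Proof. by apply: submod_inj; rewrite !par_wE rwM. Qed.
Fact par_xL a q q' n : par_x (a *: q + q') n = a *: par_x q n + par_x q' n.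
Proof. by apply: submod_inj; rewrite subvalD subvalZ !par_xE qpull_lin rxL. Qed.
Fact par_yL a z z' n : par_y (a *: z + z') n = a *: par_y z n + par_y z' n.
Proof. by apply: submod_inj; rewrite subvalD subvalZ !par_yE linearP ysh_lin. Qed.
Fact par_wx g q n : par_w g (par_x q n) = par_x (dual_repr rhoQ g q) (par_w g n).
Proof. by apply: submod_inj; rewrite par_xE !par_wE par_xE rwx qpull_repr. Qed.
Fact par_wy g z n : par_w g (par_y z n) = par_y (rhoQ g z) (par_w g n).
Proof.
apply: submod_inj; rewrite -{2}(qliftK z) quot_proj par_y_proj !par_wE par_yE.
by rewrite ysh_rw.
Qed.
Fact par_yy z z' n : par_y z (par_y z' n) = par_y z' (par_y z n).
Proof. by apply: submod_inj; rewrite !par_yE ysh_comm. Qed.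
Fact par_yx z q n : par_y z (par_x q n) = par_x q (par_y z n) + (q z : K) *: n
  - \sum_s (k s * (q (rhoQ s z - z) : K)) *: par_w s n.
Proof.
apply: submod_inj; rewrite subvalB subvalD subvalZ subval_sum !par_yE !par_xE par_yE.
rewrite !yshE ryx linBZ qpullE qliftK addrAC [X in X - _ = _]addrAC.
congr (_ - _); apply: eq_bigr => s _.
have E : qproj U (rho s (qlift U z) - qlift U z) = rhoQ s z - z.
  by rewrite linearB /= -quot_proj !qliftK.
by rewrite subvalZ par_wE qpullE E.
Qed.

Definition par_prech : prech rhoQ k :=
  Prech par_w1 par_wM par_xL par_yL par_wx par_wy par_yy par_yx.

Lemma par_xcomm : xcomm N -> xcomm par_prech.
Proof. by move=> Nxx u u' n; apply: submod_inj; apply: Nxx. Qed.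

Hypothesis N_wt : forall n : N, gwt lambda n.

Lemma par_wt (n : par_prech) : gwt (0 : dual Q) n.
Proof.
move=> z; apply/(lnil_sub _ (f := ysh lambda (qlift U z))); last first.
  exact: N_wt.
move=> m; rewrite yshE -par_yE.
have -> : ((0 : dual Q) z : K) = 0 by rewrite zero_lfunE.
by rewrite scale0r subr0.
Qed.

Section Proj.
Hypothesis Nxx : xcomm N.

Let X (i : 'I_d) : {linear N -> N} := rx (xc i).
Let Y (i : 'I_d) : {linear N -> N} := ysh lambda (ub i).

Lemma par_YX i j n : Y i (X j n) = X j (Y i n) + (i == j)%:R *: n.
Proof. by rewrite /Y /X ysh_rx_xc xc_ub // eq_sym. Qed.

(* N is the direct sum of [parP] and of the images of the [rx (xc i)]; this is *)
(* the projection onto the first summand.                                      *)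
Lemma par_proj_ex : exists p : {linear N -> N},
  [/\ forall (i : 'I_d) n, ysh lambda (ub i) (p n) = 0, forall (i : 'I_d) n, p (rx (xc i) n) = 0,
      forall n, parP n -> p n = n
    & forall T : {linear N -> N},
        (forall (i : 'I_d) n, T (rx (xc i) n) = rx (xc i) (T n)) ->
        (forall (i : 'I_d) n, T (ysh lambda (ub i) n) = ysh lambda (ub i) (T n)) ->
        forall n, p (T n) = T (p n)].
Proof.
have XX i j n : X i (X j n) = X j (X i n) by apply: Nxx.
have YY i j n : Y i (Y j n) = Y j (Y i n) by apply: ysh_comm.
have Yn i n : lnil (Y i) n by apply: N_wt.
have [p [pY pX pid pT]] := slice_ex K_char par_YX XX YY Yn (enum_uniq 'I_d).
exists p; split=> [i n|i n|n Pn|T TX TY n].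
- by apply: pY; rewrite mem_enum.
- by apply: pX; rewrite mem_enum.
- by apply: pid => i _; apply: Pn; apply: ub_mem.
- by apply: pT => i m _; [apply: TX|apply: TY].
Qed.

Definition par_pi : {linear N -> N} := projT1 (cid par_proj_ex).

Lemma par_piP : [/\ forall (i : 'I_d) n, ysh lambda (ub i) (par_pi n) = 0,
      forall (i : 'I_d) n, par_pi (rx (xc i) n) = 0,
      forall n, parP n -> par_pi n = n
    & forall T : {linear N -> N},
        (forall (i : 'I_d) n, T (rx (xc i) n) = rx (xc i) (T n)) ->
        (forall (i : 'I_d) n, T (ysh lambda (ub i) n) = ysh lambda (ub i) (T n)) ->
        forall n, par_pi (T n) = T (par_pi n)].
Proof. exact: projT2 (cid par_proj_ex). Qed.

Lemma ysh_sum (I : Type) (r : seq I) (P : pred I) (F : I -> V) (n : N) :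
  ysh lambda (\sum_(i <- r | P i) F i) n = \sum_(i <- r | P i) ysh lambda (F i) n.
Proof.
elim/big_rec2: _ => [|i y v _ <-]; first by rewrite yshE ry0 linear0 scale0r subrr.
by rewrite -{1}[F i]scale1r ysh_lin scale1r.
Qed.

Lemma parP_ub n : (forall i : 'I_d, ysh lambda (ub i) n = 0) <-> parP n.
Proof.
split=> [Y0 v vU|Pn i]; last by apply: Pn; apply: ub_mem.
rewrite -(pU_id gT_char vU) pU_sum // ysh_sum big1 // => i _.
rewrite -[_ *: _]addr0 ysh_lin Y0 scaler0 add0r yshE ry0.
by rewrite linear0 scale0r subrr.
Qed.

Lemma par_pi_sub n : parP (par_pi n).
Proof. by apply/parP_ub => i; case: par_piP. Qed.

Definition ppi : {linear N -> par_prech} :=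
  corestr parP_subspace (linearP par_pi) par_pi_sub.

Lemma ppiE n : subval (ppi n) = par_pi n. Proof. by []. Qed.

Lemma ppi_X (i : 'I_d) n : ppi (rx (xc i) n) = 0.
Proof. by apply: submod_inj; rewrite ppiE subval0; case: par_piP. Qed.
Lemma ppi_id (n : parmod) : ppi (subval n) = n.
Proof.
by apply: submod_inj; rewrite ppiE; case: par_piP => _ _ -> //; apply: (submodP n).
Qed.
Lemma ppi_w g n : ppi (rw g n) = rw g (ppi n).
Proof.
apply: submod_inj; rewrite ppiE [RHS]par_wE ppiE; case: par_piP => _ _ _ -> //.
  by move=> i m; rewrite rwx dual_xc.
by move=> i m; rewrite -ysh_rw fixU_repr ?ub_mem.
Qed.
Lemma ppi_xC u n : ppi (rx (xC rho u) n) = rx (qxC rho u) (ppi n).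
Proof.
apply: submod_inj; rewrite ppiE [RHS]par_xE ppiE qpull_xC //.
case: par_piP => _ _ _ -> // i m.
have u0 : (xC rho u (ub i) : K) = 0 by apply: xC_U => //; apply: ub_mem.
by rewrite ysh_rx_U ?ub_mem // u0 scale0r addr0.
Qed.
(** The component v - [pU] v is killed by every [xc], so its operator commutes with all x and y of
    the slice and passes through the projection; on the joint kernel it acts as the class of v. *)
Lemma ppi_y v n : ppi (ysh lambda v n) =
  \sum_(i < d) (xc i v : K) *: ppi (ysh lambda (ub i) n) + ry (qproj U v) (ppi n).
Proof.
apply: submod_inj; rewrite ppiE subvalD [X in _ + X]par_y_proj ppiE subval_sum.
have vE : v = \sum_(i < d) (xc i v : K) *: ub i + (v - pU rho v).
  by rewrite -pU_sum // addrC subrK.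
have -> : ysh lambda v (par_pi n) = par_pi (ysh lambda (v - pU rho v) n).
  case: par_piP => _ _ _ -> //; first last.
  - by move=> i m; apply: ysh_comm.
  - move=> i m; have i0 : (xc i (v - pU rho v) : K) = 0 by apply: xc_pU.
    by rewrite ysh_rx_xc i0 scale0r addr0.
  rewrite yshB [X in _ - X](_ : _ = 0) ?subr0 //.
  by apply: (par_pi_sub n); apply: pU_mem.
rewrite {1}vE -[X in X + _]scale1r ysh_lin scale1r linearD; congr (_ + _).
rewrite ysh_sum linear_sum; apply: eq_bigr => i _.
rewrite subvalZ ppiE -[_ *: ub i]addr0 ysh_lin linearD linearZZ.
by rewrite [X in _ + par_pi X](_ : _ = 0) ?linear0 ?addr0 // yshE ry0 linear0 scale0r subrr.
Qed.

End Proj.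
End ParMod.
End Par.

(** * Taylor expansion and the equivalence for the fixed space *)

Section StepTwoEquivalence.
Variables (K : fieldType) (gT : finGroupType) (V : vectType K).
Variables (rho : linrep gT V) (k : gT -> K) (lambda : dual V).
Hypothesis gT_char : (#|gT|%:R : K) != 0.
Hypothesis K_char : forall n, (n.+1%:R : K) != 0.
Hypothesis lam_fix : forall g, dual_repr rho g lambda = lambda.

Notation U := (fixU rho).
Notation Q := (quotv U).
Notation rhoQ := (quot_repr rho).
Notation d := (\dim U).
Notation par := (par_prech lam_fix).
Notation pol := (pol_prech gT_char lam_fix).

Section Eta.
Variables (N : prech rho k) (N_wt : forall n : N, gwt lambda n) (Nxx : xcomm N).
Notation ppi := (ppi gT_char K_char lam_fix N_wt Nxx).

Definition Yw (n : N) (w : seq 'I_d) : N :=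
  foldl (fun n i => ysh lambda (ub i) n) n w.

Lemma Yw_lin w : linear (Yw ^~ w).
Proof. by move=> a n n'; elim: w n n' => [//|i w IH] n n' /=; rewrite linearP IH. Qed.

Lemma Yw_comm (T : N -> N) n w :
  (forall (i : 'I_d) n, ysh lambda (ub i) (T n) = T (ysh lambda (ub i) n)) ->
  Yw (T n) w = T (Yw n w).
Proof. by move=> YT; elim: w n => [//|i w IH] n /=; rewrite YT IH. Qed.

(** Taylor coefficients of n: differentiate along the word, then take the value at the origin, which
    is the projection onto the joint kernel. *)
Definition eta_fun (n : N) : seq 'I_d -> par N := fun w => ppi (Yw n w).

Lemma eta_wpoly n : wpoly (eta_fun n).
Proof.
split=> [p a b w|].
  by rewrite /eta_fun /Yw !foldl_cat /= ysh_comm.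
have YY (i j : 'I_d) m : ysh lambda (ub i) (ysh lambda (ub j) m) =
    ysh lambda (ub j) (ysh lambda (ub i) m) :> N by apply: ysh_comm.
have Yn (i : 'I_d) (m : N) : lnil (ysh lambda (ub i)) m by apply: N_wt.
have [B hB] := @word_bound _ N _ (fun i : 'I_d => ysh lambda (ub i)) YY Yn (enum 'I_d) n.
exists B => w Bw; rewrite /eta_fun /Yw hB ?linear0 // => i _.
by rewrite mem_enum.
Qed.

Lemma eta_fun_lin : linear eta_fun.
Proof.
by move=> a n n'; apply/funext => w; rewrite /eta_fun !fctE Yw_lin linearP.
Qed.

Definition eta_linear : {linear N -> pol (par N)} :=
  corestr (wpoly_subspace 'I_d (par N)) eta_fun_lin eta_wpoly.

Lemma etaE n w : subval (eta_linear n) w = ppi (Yw n w). Proof. by []. Qed.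

Lemma eta_S (i : 'I_d) n : Sop i (eta_linear n) = eta_linear (ysh lambda (ub i) n).
Proof. by apply: polymod_eq. Qed.

Lemma eta_w g n : eta_linear (rw g n) = rw g (eta_linear n).
Proof.
apply: polymod_eq => w; rewrite [RHS]PopE !etaE -ppi_w (Yw_comm (T := rw g)) // => i m.
by rewrite -(ysh_rw lam_fix) fixU_repr ?ub_mem.
Qed.

Lemma eta_ysh v n : eta_linear (ysh lambda v n) = pol_T v (eta_linear n).
Proof.
apply: polymod_eq => w; rewrite pol_TE polyD poly_sum PopE etaE.
rewrite (Yw_comm (T := ysh lambda v)) => [|i m]; last exact: ysh_comm.
rewrite ppi_y; congr (_ + _); apply: eq_bigr => i _.
rewrite polyZ SopE etaE /=; congr (_ *: ppi _); apply/esym.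
by apply: (Yw_comm (T := ysh lambda (ub i))) => j m; apply: ysh_comm.
Qed.

Lemma eta_y v n : eta_linear (ry v n) = ry v (eta_linear n).
Proof.
rewrite [RHS]pol_yE -eta_ysh -[X in _ + X](linearZZ eta_linear) -linearD.
by rewrite yshE subrK.
Qed.

Lemma eta_X (i : 'I_d) n : eta_linear (rx (xc i) n) = Mop i (eta_linear n).
Proof.
apply: polymod_eq => w; elim: w n => [|j w IH] n; first by rewrite etaE ppi_X.
rewrite -!SopE eta_S Sop_Mop ysh_rx_xc linearD linearZZ polyD addrC eta_S polyD IH.
by rewrite xc_ub.
Qed.

Lemma eta_xC u n : eta_linear (rx (xC rho u) n) = Pop 'I_d (rx (qxC rho u)) (eta_linear n).
Proof.
apply: polymod_eq => w; rewrite PopE !etaE -ppi_xC; congr (ppi _).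
apply: (Yw_comm (T := rx (xC rho u))) => i m.
have u0 : (xC rho u (ub i) : K) = 0 by apply: xC_U => //; apply: ub_mem.
by rewrite ysh_rx_U ?ub_mem // u0 scale0r addr0.
Qed.

Lemma eta_x u n : eta_linear (rx u n) = rx u (eta_linear n).
Proof.
rewrite {1}(dual_decomp rho u) rxD rx_sum linearD linear_sum eta_xC [RHS]pol_xE.
by congr (_ + _); apply: eq_bigr => i _; rewrite rxZ linearZZ eta_X.
Qed.

Definition eta : chom N (pol (par N)) := Chom eta_w eta_x eta_y.

(** Induction on a bound for the words acting nontrivially on n. First derivatives of n have a
    smaller bound and zero expansion, so they vanish; then n lies in the joint kernel and equals its
    constant coefficient. *)
Lemma eta_inj : injective eta.
Proof.
suff ker n : eta n = 0 -> n = 0.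
  move=> n n' /eqP; rewrite -subr_eq0 -linearB => /eqP/ker/eqP.
  by rewrite subr_eq0 => /eqP.
have YY (i j : 'I_d) m : ysh lambda (ub i) (ysh lambda (ub j) m) =
    ysh lambda (ub j) (ysh lambda (ub i) m) :> N by apply: ysh_comm.
have Yn (i : 'I_d) (m : N) : lnil (ysh lambda (ub i)) m by apply: N_wt.
have [B hB] := @word_bound _ N _ (fun i : 'I_d => ysh lambda (ub i)) YY Yn (enum 'I_d) n.
have {}hB w : (B <= size w)%N -> Yw n w = 0 by apply: hB => i _; rewrite mem_enum.
elim: B n hB => [|B IH] n hB n0; first by rewrite -[n]/(Yw n [::]) hB.
have Yn0 (i : 'I_d) : ysh lambda (ub i) n = 0.
  apply: IH => [w Bw|]; first exact: (hB (i :: w)).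
  have E : eta_linear (ysh lambda (ub i) n) = 0.
    by rewrite -eta_S (_ : eta_linear n = 0) ?linear0.
  exact: E.
have Pn : parP lambda n by apply/(@parP_ub _ _ _ _ _ lambda gT_char).
have E : subval (ppi n) = n.
  by rewrite ppiE; case: (par_piP gT_char K_char N_wt Nxx) => _ _ ->.
have p0 : ppi n = 0 by have := etaE n [::]; rewrite (_ : eta_linear n = 0) // poly0.
by rewrite -E p0 subval0.
Qed.

Lemma eta_surj F : exists n, eta n = F.
Proof.
apply: (poly_gen K_char (P := fun F : pol (par N) => exists n, eta n = F)) F.
- split=> [|a F G [n <-] [m <-]]; first by exists 0; rewrite linear0.
  by exists (a *: n + m); rewrite linearP.
- by move=> i F [n <-]; exists (rx (xc i) n); apply: eta_X.
- move=> n; exists (subval n).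
  rewrite [LHS](poly_cst (F := eta (subval n))) => [|i].
    by congr (cstp _ _); apply: ppi_id.
  rewrite [Sop i _]eta_S (_ : ysh _ _ _ = 0) ?linear0 //.
  by apply: (submodP n); apply: ub_mem.
Qed.

(** [poly_gen] pulled back through the bijection [eta]: the joint kernel generates N under the
    invariant coordinates. *)
Lemma par_gen (P : N -> Prop) : subspace P ->
  (forall (i : 'I_d) n, P n -> P (rx (xc i) n)) ->
  (forall n, parP lambda n -> P n) -> forall n, P n.
Proof.
move=> hP PX Pp n.
suff [m [/eta_inj-> //]] : exists m, eta m = eta n /\ P m.
move: (eta n : pol (par N)).
apply: (poly_gen K_char (P := fun F : pol (par N) => exists m, eta m = F /\ P m)).
- split=> [|a F G [m [<- Pm]] [m' [<- Pm']]].
    by exists 0; rewrite linear0; split=> //; apply: hP.1.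
  by exists (a *: m + m'); rewrite linearP; split=> //; apply: hP.2.
- move=> i F [m [<- Pm]]; exists (rx (xc i) m); split; last exact: PX.
  exact: eta_X.
- move=> m; exists (subval m); split; last by apply: Pp; apply: (submodP m).
  rewrite [LHS](poly_cst (F := eta (subval m))) => [|i].
    by congr (cstp _ _); apply: ppi_id.
  rewrite [Sop i _]eta_S (_ : ysh _ _ _ = 0) ?linear0 //.
  by apply: (submodP m); apply: ub_mem.
Qed.

Lemma par_fg : ch_fg N -> ch_fg (par N).
Proof.
case=> s hs; exists [seq ppi n | n <- s] => P hP Px Ps n.
rewrite -(ppi_id gT_char K_char lam_fix N_wt Nxx n).
apply: (hs (fun n => P (ppi n))) => [|u m Pm|m ms].
- exact: subspace_comp.
- rewrite (dual_decomp rho u) rxD rx_sum linearD linear_sum ppi_xC big1 => [|i _].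
    by rewrite add0r; apply: Px.
  by rewrite rxZ linearZZ ppi_X scaler0.
- by apply: Ps; apply: map_f.
Qed.

End Eta.

Section Eps.
Variable L : prech rhoQ k.
Notation PL := (pol L).

(** The constant term; a polynomial in the joint kernel has zero derivatives and is determined by
    it. *)
Definition eps2_fun (x : parmod lambda PL) : L :=
  subval (subval x : polymod 'I_d L) [::].

Lemma eps2_lin : linear eps2_fun.
Proof.
move=> a x y; rewrite /eps2_fun.
have -> : subval (a *: x + y) = a *: subval x + subval y :> PL.
  by rewrite [LHS]subvalD subvalZ.
rewrite -[LHS]/(subval (a *: (subval x : polymod 'I_d L) + subval y) [::]).
by rewrite polyD polyZ.
Qed.

Definition eps2_linear : {linear par PL -> L} := mklin eps2_lin.

Lemma eps2E (x : parmod lambda PL) :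
  eps2_linear x = subval (subval x : polymod 'I_d L) [::].
Proof. by []. Qed.

Lemma par_pol_S (x : parmod lambda PL) (i : 'I_d) :
  Sop i (subval x : polymod 'I_d L) = 0.
Proof.
have := submodP x _ (ub_mem i); rewrite pol_ysh pol_TE (bigD1 i) //= xc_ub //.
rewrite eqxx scale1r big1 => [|j /negPf ij]; last by rewrite xc_ub // ij scale0r.
rewrite addr0 [X in _ + X](_ : _ = 0) ?addr0 //; apply: polymod_eq => w.
by rewrite PopE qproj_U ?ub_mem // ry0 poly0.
Qed.

Lemma eps2_w g x : eps2_linear (rw g x) = rw g (eps2_linear x).
Proof. by []. Qed.
Lemma eps2_x q x : eps2_linear (rx q x) = rx q (eps2_linear x).
Proof. by rewrite !eps2E par_xE [rx _ _]pol_x_pull PopE. Qed.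
Lemma eps2_y z x : eps2_linear (ry z x) = ry z (eps2_linear x).
Proof.
rewrite !eps2E par_yE pol_ysh pol_TE big1 => [|i _].
  by rewrite add0r PopE qliftK.
by rewrite par_pol_S scaler0.
Qed.

Definition eps2 : chom (par PL) L := Chom eps2_w eps2_x eps2_y.

Lemma eps2_inj : injective eps2.
Proof.
move=> x y xy; apply: submod_inj.
rewrite [LHS](poly_cst (par_pol_S x)) [RHS](poly_cst (par_pol_S y)).
by congr (cstp _ _); apply: xy.
Qed.

Lemma eps2_surj n : exists x, eps2 x = n.
Proof.
have cP : parP lambda (cstp 'I_d n : PL).
  apply/(@parP_ub _ _ _ _ _ lambda gT_char) => i; rewrite pol_ysh pol_TE big1 => [|j _].
    by rewrite add0r Pop_cst qproj_U ?ub_mem // ry0 linear0.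
  by rewrite Sop_cst scaler0.
by exists (tosub (parP_subspace lambda PL) cP).
Qed.

End Eps.

Section ParMorphism.
Variables (N N' : prech rho k) (f : chom N N').

Lemma chom_parP n : parP lambda n -> parP lambda (f n).
Proof. by move=> Pn v vU; rewrite yshE -chy -linBZ -yshE Pn // linear0. Qed.

Definition par_lin : {linear par N -> par N'} :=
  restr (parP_subspace lambda N) (parP_subspace lambda N') (linearP (chfun f)) chom_parP.

Lemma par_linE (n : parmod lambda N) : subval (par_lin n) = f (subval n).
Proof. by []. Qed.

Fact par_lin_w g n : par_lin (rw g n) = rw g (par_lin n).
Proof. by apply: submod_inj; rewrite par_linE par_wE chw. Qed.
Fact par_lin_x q n : par_lin (rx q n) = rx q (par_lin n).
Proof. by apply: submod_inj; rewrite par_linE !par_xE chx. Qed.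
Fact par_lin_y z n : par_lin (ry z n) = ry z (par_lin n).
Proof. by apply: submod_inj; rewrite par_linE !par_yE !yshE linBZ chy. Qed.

Definition par_chom : chom (par N) (par N') := Chom par_lin_w par_lin_x par_lin_y.
End ParMorphism.

(** The projections of N and N' come from unrelated choices, so their compatibility with f is proved
    on generators: both sides vanish on images of the coordinates and agree on the joint kernel. *)
Lemma eta_natural (N N' : prech rho k) (f : chom N N')
    (N_wt : forall n : N, gwt lambda n) (N'_wt : forall n : N', gwt lambda n)
    (Nxx : xcomm N) (N'xx : xcomm N') n w :
  subval (eta N'_wt N'xx (f n)) w = par_lin f (subval (eta N_wt Nxx n) w).
Proof.
have YwE : Yw (f n) w = f (Yw n w).
  by elim: w n => [//|i w IH] n /=; rewrite yshE -chy -linBZ -yshE IH.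
rewrite [LHS]etaE [in RHS]etaE YwE; move: (Yw n w) => {w YwE}n.
apply: (par_gen N_wt Nxx (P := fun n => ppi gT_char K_char lam_fix N'_wt N'xx (f n)
   = par_lin f (ppi gT_char K_char lam_fix N_wt Nxx n))).
- split=> [|a m m' Em Em']; first by rewrite !linear0.
  by rewrite !linearP Em Em'.
- by move=> i m _; rewrite chx !ppi_X linear0.
- move=> m Pm; rewrite -[m]/(subval (tosub (parP_subspace lambda N) Pm)) ppi_id.
  by rewrite -par_linE ppi_id.
Qed.

Section PolMorphism.
Variables (L L' : prech rhoQ k) (f : chom L L').

Lemma chom_wpoly (F : seq 'I_d -> L) : wpoly F -> wpoly (Pfun f F).
Proof.
case=> Fs [B hB]; split=> [p a b w|]; first by rewrite /Pfun Fs.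
by exists B => w Bw; rewrite /Pfun hB // linear0.
Qed.

Lemma chom_Pfun_lin : linear (Pfun f : (seq 'I_d -> L) -> seq 'I_d -> L').
Proof. by move=> a F G; apply/funext => w; rewrite /Pfun !fctE linearP. Qed.

Definition pol_lin : {linear pol L -> pol L'} :=
  restr (wpoly_subspace 'I_d L) (wpoly_subspace 'I_d L') chom_Pfun_lin chom_wpoly.

Lemma pol_linE (F : pol L) w : subval (pol_lin F) w = f (subval F w).
Proof. by []. Qed.

Lemma pol_lin_S i (F : pol L) : Sop i (pol_lin F) = pol_lin (Sop i F).
Proof. by apply: polymod_eq. Qed.

Lemma pol_lin_M i (F : pol L) : Mop i (pol_lin F) = pol_lin (Mop i F).
Proof.
apply: polymod_eq => w; elim: w F => [|j w IH] F; first by rewrite pol_linE !Mop_nil linear0.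
rewrite -!SopE Sop_Mop !pol_lin_S Sop_Mop polyD polyZ IH.
by rewrite [pol_lin (_ + _)]linearD [pol_lin (_ *: _)]linearZZ polyD polyZ.
Qed.

Fact pol_lin_w g F : pol_lin (rw g F) = rw g (pol_lin F).
Proof. by apply: polymod_eq => w; rewrite pol_linE !PopE chw. Qed.
Fact pol_lin_x u F : pol_lin (rx u F) = rx u (pol_lin F).
Proof.
rewrite [rx u F]pol_xE [RHS]pol_xE linearD linear_sum; congr (_ + _).
  by apply: eq_bigr => i _; rewrite linearZZ pol_lin_M.
by apply: polymod_eq => w; rewrite pol_linE !PopE chx.
Qed.
Fact pol_lin_y v F : pol_lin (ry v F) = ry v (pol_lin F).
Proof.
rewrite [ry v F]pol_yE [RHS]pol_yE linearD linearZZ; congr (_ + _).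
rewrite !pol_TE linearD linear_sum; congr (_ + _).
  by apply: eq_bigr => i _; rewrite linearZZ pol_lin_S.
by apply: polymod_eq => w; rewrite pol_linE !PopE chy.
Qed.

Definition pol_chom : chom (pol L) (pol L') := Chom pol_lin_w pol_lin_x pol_lin_y.
End PolMorphism.

Section Functors.

Lemma obj_gwt (N : chO_obj rho k lambda) (n : N) : gwt lambda n.
Proof. exact: (iffRL (gwt_eig N lam_fix) (@cO_eig _ _ _ _ _ _ N)). Qed.

Lemma zero_fix g : dual_repr rhoQ g (0 : dual Q) = 0.
Proof. exact: linear0. Qed.

Lemma obj0_gwt (L : chO_obj rhoQ k 0) (n : L) : gwt 0 n.
Proof. exact: (iffRL (gwt_eig L zero_fix) (@cO_eig _ _ _ _ _ _ L)). Qed.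

Section Objects.
Variable N : chO_obj rho k lambda.
Lemma par_obj_fg : ch_fg (par N).
Proof. by apply: par_fg; [apply: obj_gwt|apply: ch_xx|apply: cO_fg]. Qed.
Lemma par_obj_eig : ch_eig (par N) 0.
Proof. exact: (iffLR (gwt_eig _ zero_fix) (par_wt (@obj_gwt N))). Qed.
Lemma par_obj_xcomm : xcomm (par N).
Proof. by apply: par_xcomm; apply: ch_xx. Qed.
Definition par_obj : chO_obj rhoQ k 0 :=
  @ChO_obj _ _ _ _ _ _ (Chmod par_obj_xcomm) par_obj_fg par_obj_eig.

Variable L : chO_obj rhoQ k 0.
Lemma pol_obj_fg : ch_fg (pol L).
Proof. by apply: pol_fg => //; apply: cO_fg. Qed.
Lemma pol_obj_eig : ch_eig (pol L) lambda.
Proof. exact: (iffLR (gwt_eig _ lam_fix) (pol_wt K_char (@obj0_gwt L))). Qed.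
Lemma pol_obj_xcomm : xcomm (pol L).
Proof. by apply: pol_xcomm; apply: ch_xx. Qed.
Definition pol_obj : chO_obj rho k lambda :=
  @ChO_obj _ _ _ _ _ _ (Chmod pol_obj_xcomm) pol_obj_fg pol_obj_eig.
End Objects.

Program Definition par_functor : functor (chO rho k lambda) (chO rhoQ k 0) :=
  @Functor (chO rho k lambda) (chO rhoQ k 0) par_obj
    (fun N N' f => par_chom (f : chom (N : chO_obj _ _ _) (N' : chO_obj _ _ _))) _ _.
Next Obligation. by apply: chom_eq => n; apply: submod_inj. Qed.
Next Obligation. by apply: chom_eq => n; apply: submod_inj. Qed.

Program Definition pol_functor : functor (chO rhoQ k 0) (chO rho k lambda) :=
  @Functor (chO rhoQ k 0) (chO rho k lambda) pol_obj
    (fun L L' f => pol_chom (f : chom (L : chO_obj _ _ _) (L' : chO_obj _ _ _))) _ _.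
Next Obligation. by apply: chom_eq => n; apply: polymod_eq. Qed.
Next Obligation. by apply: chom_eq => n; apply: polymod_eq. Qed.

Lemma par_equivalence : is_equivalence par_functor.
Proof.
exists pol_functor; split.
- apply: nat_iso_sym.
  apply: (@chO_nat_iso _ _ _ _ _ (chO rho k lambda) lambda
    (idF _) (compF pol_functor par_functor) (fun N : chO_obj rho k lambda =>
       eta (@obj_gwt N) (@ch_xx _ _ _ _ _ N) : chom N (pol_obj (par_obj N)))).
  + move=> N N' f; apply: chom_eq => n; apply: polymod_eq => w.
    exact: eta_natural.
  + by move=> N; apply: eta_inj.
  + by move=> N; apply: eta_surj.
- apply: (@chO_nat_iso _ _ _ _ _ (chO rhoQ k 0) 0
    (compF par_functor pol_functor) (idF _)
    (fun L : chO_obj rhoQ k 0 => eps2 L : chom (par_obj (pol_obj L)) L)).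
  + by move=> L L' f; apply: chom_eq.
  + by move=> L; apply: eps2_inj.
  + by move=> L; apply: eps2_surj.
Qed.

End Functors.
End StepTwoEquivalence.

(** * Reflections and roots *)
Section ReprLinear.
Variables (K : fieldType) (gT : finGroupType) (V : vectType K) (W : linrep gT V).

Lemma reprD g v w : W g (v + w) = W g v + W g w.
Proof. exact: linearD. Qed.

Lemma reprZ g a v : W g (a *: v) = a *: W g v.
Proof. exact: linearZZ. Qed.
End ReprLinear.

Section ReflectionScalar.
Variables (K : fieldType) (gT : finGroupType) (V : vectType K).
Variables (W : linrep gT V).
Hypothesis K_char : forall n, (n.+1%:R : K) != 0.

(* [1 + z] is the eigenvalue of [s] on the line Im (s - 1). *)
Definition is_eig (s : gT) (z : K) : Prop :=
  forall v, W s (W s v - v) - (W s v - v) = z *: (W s v - v).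

Definition eig_coef (s : gT) : K :=
  if pselect (exists z, is_eig s z) is left ex then projT1 (cid ex) else 0.

Lemma eig_coefP s z v : is_eig s z -> W s v != v -> eig_coef s = z.
Proof.
move=> sz vN; rewrite /eig_coef; case: pselect => [ex|[]]; last by exists z.
case: (cid ex) => z' /= sz'; apply/eqP; rewrite -subr_eq0.
have := sz' v; rewrite sz => /eqP; rewrite eq_sym -subr_eq0 -scalerBl scaler_eq0.
by rewrite [W s v - v == 0]subr_eq0 (negPf vN) orbF.
Qed.

Lemma rank1_eig s : rank1 W s -> exists z, is_eig s z.
Proof.
move=> s1; have [z zE] := rank1P (rvec W s) s1; exists z => v.
have [a ->] := rank1P v s1.
by rewrite reprZ -scalerBr zE !scalerA mulrC.
Qed.

Lemma rank1_moves s : rank1 W s -> exists v, W s v != v.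
Proof.
move=> s1; have [v vE] := rank1_ex s1; exists v.
by rewrite -subr_eq0 vE rvec_neq0.
Qed.

(** For z = 0 the element s would be a transvection with s^n v = v + n (s v - v), which has infinite
    order in characteristic zero. *)
Lemma is_eig_neq0 s z : rank1 W s -> is_eig s z -> z != 0.
Proof.
move=> s1 sz; apply/eqP => z0; have [v /eqP[]] := rank1_moves s1.
have pow n : W (s ^+ n)%g v = v + n%:R *: (W s v - v).
  elim: n => [|n IH]; first by rewrite expg0 repr1v scale0r addr0.
  rewrite expgS reprMv IH reprD reprZ.
  have -> : W s (W s v - v) = W s v - v.
    by apply/eqP; rewrite -subr_eq0 sz z0 scale0r.
  by rewrite -natr1 scalerDl scale1r [RHS]addrCA [v + (_ - v)]addrC subrK addrC.
have := pow #[s]%g; rewrite expg_order repr1v -[X in X = _]addr0 => /addrI/esym/eqP.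
rewrite scaler_eq0 -[#[s]%g]prednK ?order_gt0 // (negPf (K_char _)) /=.
by rewrite subr_eq0 => /eqP.
Qed.

Variable c : gT -> K.

(** alpha_s(v) alpha_s^vee and s v - v are proportional functions of v; at v = b_s they are 2 b_s
    and z b_s, where z is [eig_coef s], whence the factor 2 / z. *)
Definition rca_coef (s : gT) : K :=
  if is_reflection W s then c s * (2 / eig_coef s) else 0.

Lemma reflection_rank1 s : is_reflection W s -> rank1 W s.
Proof. by case/andP. Qed.

Lemma reflection_eig s : is_reflection W s -> is_eig s (eig_coef s) /\ eig_coef s != 0.
Proof.
move=> /reflection_rank1 s1; have [z sz] := rank1_eig s1.
have [v vN] := rank1_moves s1; rewrite (eig_coefP sz vN); split=> //.
exact: is_eig_neq0 sz.
Qed.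

Lemma root_form s : is_reflection W s ->
  exists2 t : dual V, (forall v, root W s v = t (W s^-1%g v - v)) & root W s != 0.
Proof.
move=> sR; have s1 := reflection_rank1 sR.
have /memv_imgP[t _ tE] : root W s \in limg (dual_repr W s - \1%VF) by apply: memv_pick.
exists t => [v|].
  by rewrite tE add_lfunE opp_lfunE id_lfunE add_lfunE opp_lfunE dactE linearB.
(* A zero image on the dual would make s fix every linear form, hence all coordinates and all
   vectors. *)
rewrite vpick0; apply/eqP => d0.
have sfix (u : dual V) : dual_repr W s u = u.
  apply/eqP; rewrite -subr_eq0 -(memv0 (dual_repr W s u - u)) -d0.
  have -> : dual_repr W s u - u = (dual_repr W s - \1%VF) u.
    by rewrite add_lfunE opp_lfunE id_lfunE.
  exact: memv_img (memvf _).
have [v /eqP[]] := rank1_moves s1.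
have coordE w i : dcoord i (W s w) = dcoord i w.
  by rewrite -{1}(sfix (dcoord i)) dactE reprK.
rewrite (coord_vbasis (memvf (W s v))) [RHS](coord_vbasis (memvf v)).
by apply: eq_bigr => i _; have := coordE v i; rewrite !dcoordE => ->.
Qed.

Lemma rca_coefP s v (u : dual V) :
  (if is_reflection W s then c s * root W s v * u (coroot W s) else 0) =
  rca_coef s * (u (W s v - v) : K).
Proof.
rewrite /rca_coef; case: ifP => sR; last by rewrite mul0r.
have s1 := reflection_rank1 sR; have [sz z0] := reflection_eig sR.
move: (eig_coef s) sz z0 => z sz z0.
have [t tE r0] := root_form sR; set b := rvec W s.
have [v0 v0E] := rank1_ex s1; rewrite -/b in v0E.
have fb : W s b = (1 + z) *: b.
  have := sz v0; rewrite v0E => /(canRL (subrK _)) ->.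
  by rewrite scalerDl scale1r addrC.
have invE w : exists a, W s^-1%g w - w = a *: b /\ W s w - w = - (a * (1 + z)) *: b.
  have [a aE] := rank1_inv w s1; exists a; split=> //.
  have := congr1 (W s) aE; rewrite reprB reprVK reprZ -/b fb scalerA.
  by move=> E; rewrite scaleNr -E opprB.
have [a [aE aE']] := invE v; have [ab [abE abE']] := invE b.
have b0 : b != 0 by apply: rvec_neq0.
(* Two expressions for s b - b. Equivalently 1 + [ab], the eigenvalue of s^-1 on b, is inverse to 1
   + z; [ab] enters because the root is written through s^-1. *)
have zE : z = - (ab * (1 + z)).
  apply/eqP; rewrite -subr_eq0.
  have : (z - - (ab * (1 + z))) *: b == 0.
    by rewrite scalerBl -abE' fb scalerDl scale1r [b + _]addrC addrK subrr.
  by rewrite scaler_eq0 (negPf b0) orbF.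
have ab0 : ab != 0 by apply: contraNneq z0 => E; rewrite zE E mul0r oppr0.
have dualZ' (f : dual V) d w : f (d *: w) = d * (f w : K) by exact: dualZ.
have rE w d : W s^-1%g w - w = d *: b -> root W s w = d * (t b : K).
  by move=> E; rewrite tE E dualZ'.
have tb0 : (t b : K) != 0.
  apply: contraNneq r0 => tb; apply/eqP/lfunP => w; have [d [dE _]] := invE w.
  by rewrite (rE _ _ dE) tb mulr0 zero_lfunE.
have -> : coroot W s = (2 / root W s b) *: b by [].
rewrite (rE _ _ aE) (rE _ _ abE) aE' !dualZ'.
have -> : 1 + z = - z / ab by rewrite {2}zE opprK mulrC mulKf.
by field; rewrite z0 ab0 tb0.
Qed.


Lemma rank1_reflection s : is_reflection W s = rank1 W s.
Proof.
apply/idP/idP => [/reflection_rank1//|s1]; apply/andP; split=> //.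
by apply/eqP => E; have [v] := rank1_moves s1; rewrite E repr1v eqxx.
Qed.

Lemma rca_coef_rank1 s : rca_coef s != 0 -> rank1 W s.
Proof. by rewrite -rank1_reflection /rca_coef; case: ifP; rewrite // eqxx. Qed.

Lemma rank1I s b v : b != 0 -> W s v - v = b ->
  (forall w, exists a, W s w - w = a *: b) -> rank1 W s.
Proof.
move=> b0 vE bE; have imE w : (W s - \1%VF)%VF w = W s w - w.
  by rewrite add_lfunE opp_lfunE id_lfunE.
suff E : limg (W s - \1%VF) = <[b]>%VS by rewrite /rank1 E dim_vline b0.
apply/vspaceP => w; apply/memv_imgP/vlineP => [[u _ ->]|[a ->]].
  by rewrite imE; apply: bE.
by exists (a *: v); rewrite ?memvf // imE reprZ -scalerBr vE.
Qed.

Lemma conj_moves s g v : W (g * s * g^-1)%g v - v =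
  W g (W s (W g^-1%g v) - W g^-1%g v).
Proof. by rewrite !reprMv reprB reprVK. Qed.

Lemma rank1_conj s g : rank1 W s -> rank1 W (g * s * g^-1)%g.
Proof.
move=> s1; have [v vE] := rank1_ex s1.
apply: (@rank1I _ (W g (rvec W s)) (W g v)).
- apply: contra_neq (rvec_neq0 s1) => /(congr1 (W g^-1%g)).
  by rewrite reprK linear0.
- by rewrite conj_moves reprK vE.
- move=> w; have [a aE] := rank1P (W g^-1%g w) s1; exists a.
  by rewrite conj_moves aE reprZ.
Qed.

Lemma is_eig_conj s g z : is_eig s z -> is_eig (g * s * g^-1)%g z.
Proof. by move=> sz v; rewrite conj_moves conj_moves reprK sz reprZ. Qed.

Hypothesis c_inv : forall s g, is_reflection W s -> c (s ^ g)%g = c s.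

Lemma rca_coef_inv s g : rca_coef (g * s * g^-1)%g = rca_coef s.
Proof.
have cE : (g * s * g^-1 = s ^ g^-1)%g by rewrite conjgE invgK mulgA.
have rE : is_reflection W (g * s * g^-1)%g = is_reflection W s.
  rewrite !rank1_reflection; apply/idP/idP => [/(rank1_conj g^-1%g)|]; last exact: rank1_conj.
  by rewrite !mulgA mulVg mul1g mulgK.
rewrite /rca_coef rE; case: ifP => sR //; rewrite {1}cE c_inv //.
have [sz _] := reflection_eig sR.
have [v vN] := rank1_moves (rank1_conj g (reflection_rank1 sR)).
by rewrite (eig_coefP (is_eig_conj g sz) vN).
Qed.

End ReflectionScalar.

Section QuotientScalar.
Variables (K : fieldType) (gT : finGroupType) (V : vectType K) (rho : linrep gT V).
Hypothesis gT_char : (#|gT|%:R : K) != 0.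
Hypothesis K_char : forall n, (n.+1%:R : K) != 0.
Let U := fixed rho.

(** The difference of the two sides lies in the fixed space, so it equals its own average, and
    averaging kills every s v - v. *)
Lemma qproj_moves s v w a :
  qproj U (rho s v - v) = qproj U (a *: (rho s w - w)) ->
  rho s v - v = a *: (rho s w - w).
Proof.
move=> E; apply/eqP; rewrite -subr_eq0; set u := _ - _.
have uU : u \in U by rewrite -qproj_eq0 /u [qproj U (_ - _)]raddfB /= [X in X - _]E subrr.
rewrite -(pU_id gT_char uU) /u scalerBr -reprZ.
have pB x y : pU rho (x - y) = pU rho x - pU rho y.
  by rewrite -[- y]scaleN1r addrC pU_lin scaleN1r addrC.
by rewrite !pB !pU_repr !subrr.
Qed.

Lemma quot_moves s v : quot_repr rho s (qproj U v) - qproj U v = qproj U (rho s v - v).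
Proof. by rewrite linearB; congr (_ - _); apply: quot_funE. Qed.

Lemma rank1_quot s : rank1 (quot_repr rho) s = rank1 rho s.
Proof.
apply/idP/idP => s1.
  have [q qE] := rank1_ex s1; rewrite -(qliftK q) quot_moves in qE.
  apply: (@rank1I _ _ _ _ _ (rho s (qlift U q) - qlift U q) (qlift U q)) => //.
    apply: contra_neq (rvec_neq0 s1) => E; by rewrite -qE E linear0.
  move=> w; have [a aE] := rank1P (qproj U w) s1; exists a.
  by apply: qproj_moves; rewrite -quot_moves aE -qE linearZ.
have [v vE] := rank1_ex s1.
apply: (@rank1I _ _ _ _ _ (qproj U (rvec rho s)) (qproj U v)).
- apply/negP => b0; have := rvec_neq0 s1; rewrite -vE -[X in X != _]scale1r.
  have -> : 1 *: (rho s v - v) = 0 *: (rho s v - v).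
    by rewrite scale1r; apply: qproj_moves; rewrite vE (eqP b0) scale0r linear0.
  by rewrite scale0r eqxx.
- by rewrite quot_moves vE.
- move=> q; rewrite -(qliftK q); have [a aE] := rank1P (qlift U q) s1; exists a.
  by rewrite quot_moves aE linearZ.
Qed.

Lemma eig_coef_quot s : rank1 rho s -> eig_coef (quot_repr rho) s = eig_coef rho s.
Proof.
move=> s1; have [z sz] := rank1_eig s1; have [v vN] := rank1_moves s1.
have [q qN] : exists q, quot_repr rho s q != q by apply: rank1_moves; rewrite rank1_quot.
rewrite (eig_coefP sz vN); apply: eig_coefP qN => q'.
rewrite -(qliftK q') quot_moves quot_moves sz.
exact: linearZZ.
Qed.

Lemma rca_coef_quot (c : gT -> K) s : rca_coef (quot_repr rho) c s = rca_coef rho c s.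
Proof.
rewrite /rca_coef !rank1_reflection // rank1_quot.
by case: ifP => // s1; rewrite eig_coef_quot.
Qed.
End QuotientScalar.

Lemma rca_coef_res (K : fieldType) (gT : finGroupType) (V : vectType K)
    (W : linrep gT V) (c : gT -> K) (G : {group gT}) (s : [subg G]) :
  rca_coef (res_repr W G) (fun s => c (sgval s)) s = rca_coef W c (sgval s).
Proof.
rewrite /rca_coef; have -> : is_reflection (res_repr W G) s = is_reflection W (sgval s).
  by rewrite /is_reflection; congr (~~ _ && _).
by [].
Qed.

(** * Modules over the presented algebra *)
Section ScalarExtension.
Local Open Scope quotient_scope.
Variables (K : fieldType) (gT : finGroupType) (V : vectType K).
Variables (W : linrep gT V) (c : gT -> K) (k : gT -> K).

(** The translation is carried out for any k with this property, so that it serves both for W and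
    for the stabilizer acting on the quotient, where k is simply restricted. *)
Definition scalar_match := forall s v (u : dual V),
  (if is_reflection W s then c s * root W s v * u (coroot W s) else 0) =
  k s * (u (W s v - v) : K).

Fixpoint tev (M : prech W k) (t : aterm K (rca_gen gT V)) (m : M) : M :=
  match t with
  | Gen (GenW g) => rw g m
  | Gen (GenX u) => rx u m
  | Gen (GenY v) => ry v m
  | Cst a => a *: m
  | Opp t => - tev t m
  | Add t t' => tev t m + tev t' m
  | Mul t t' => tev t (tev t' m)
  end.

Lemma tev_lin (M : prech W k) t : linear (@tev M t).
Proof.
elim: t => [[g|u|v]|a|t IH|t IH t' IH'|t IH t' IH'] b m n /=.
- exact: linearP.
- exact: linearP.
- exact: linearP.
- by rewrite scalerDr !scalerA mulrC.
- by rewrite IH opprD scalerN.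
- by rewrite IH IH' scalerDr addrACA.
- by rewrite IH' IH.
Qed.

Lemma tevZ (M : prech W k) t a (m : M) : tev t (a *: m) = a *: tev t m.
Proof. exact: (linearZZ (mklin (@tev_lin M t))). Qed.

Lemma tevD (M : prech W k) t (m n : M) : tev t (m + n) = tev t m + tev t n.
Proof. exact: (linearD (mklin (@tev_lin M t))). Qed.

Lemma tev_sum (M : prech W k) (I : finType) (P : pred I) (F : I -> aterm K (rca_gen gT V)) (m : M) :
  tev (\big[@Add K _/Cst _ 0]_(i | P i) F i) m = \sum_(i | P i) tev (F i) m.
Proof. by apply: (big_morph (fun t => tev t m)) => //=; rewrite scale0r. Qed.

Hypothesis hk : scalar_match.

Lemma tev_congr (M : chmod W k) t t' : acongr (rca_rel W c) t t' ->
  forall m : M, tev t m = tev t' m.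
Proof.
elim=> {t t'} /=.
- move=> t t' [|g h|a u u'|a v v'|g u|g v|u u'|v v'|v u] /= m.
  + by rewrite rw1 scale1r.
  + exact: rwM.
  + exact: rxL.
  + exact: ryL.
  + exact: rwx.
  + exact: rwy.
  + exact: ch_xx.
  + exact: ryy.
  + rewrite ryx [in LHS](addrAC (_ + _)) [rx _ _ + _]addrC addrK tev_sum.
    congr (_ - _); rewrite [RHS]big_mkcond; apply: eq_bigr => s _ /=.
    by rewrite -hk; case: ifP; rewrite ?scale0r.
- by [].
- by move=> t t' _ E m.
- by move=> t t' t'' _ E _ E' m; rewrite E.
- by move=> t t' _ E m; rewrite E.
- by move=> s s' t t' _ E _ E' m; rewrite E E'.
- by move=> s s' t t' _ E _ E' m; rewrite E' E.
- by move=> r s t m; rewrite addrA.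
- by move=> s t m; rewrite addrC.
- by move=> s m; rewrite scale0r add0r.
- by move=> s m; rewrite addNr scale0r.
- by [].
- by move=> s m; rewrite scale1r.
- by move=> s m; rewrite scale1r.
- by [].
- by move=> r s t m; rewrite tevD.
- by move=> a b m; rewrite scalerDl.
- by move=> a b m; rewrite scalerA.
- by move=> a s m; rewrite tevZ.
Qed.

(* [hk] is recorded in the type because the module axioms depend on it. *)
Definition tcar (M : chmod W k) : Type := let _ := hk in M.

Section TMod.
Variable M : chmod W k.
HB.instance Definition _ := GRing.Zmodule.on (tcar M).

Definition tscale (a : rca W c) (m : tcar M) : tcar M := tev (repr a) (m : M).

Lemma tscaleE t (m : M) : tscale (\pi_(palg (rca_rel W c)) t) m = tev t m.
Proof. by apply: tev_congr; apply: repr_congr. Qed.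

Fact tscaleA a b m : tscale a (tscale b m) = tscale (a * b) m.
Proof.
elim/quotW: a => a; elim/quotW: b => b; rewrite -[_ * _](@piM _ _ (rca_rel W c)).
by rewrite !tscaleE.
Qed.
Fact tscale1 : left_id 1 tscale.
Proof. by move=> m; rewrite [LHS](tscaleE (Cst _ 1)) /= scale1r. Qed.
Fact tscaleDr : right_distributive tscale +%R.
Proof. by move=> a m n; apply: tevD. Qed.
Fact tscaleDl m : {morph tscale^~ m : a b / a + b}.
Proof.
move=> a b /=; elim/quotW: a => a; elim/quotW: b => b.
by rewrite -[_ + _](@piD _ _ (rca_rel W c)) !tscaleE.
Qed.
HB.instance Definition _ := GRing.Zmodule_isLmodule.Build (rca W c) (tcar M)
  tscaleA tscale1 tscaleDr tscaleDl.

Lemma tcar_tev t (m : tcar M) : (\pi_(palg (rca_rel W c)) t : rca W c) *: m = tev t (m : M) :> M.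
Proof. exact: tscaleE. Qed.
Lemma tcar_w g (m : tcar M) : (hw g : rca W c) *: m = rw g (m : M) :> M.
Proof. exact: (tcar_tev (Gen _ (GenW _ _))). Qed.
Lemma tcar_x u (m : tcar M) : (hx u : rca W c) *: m = rx u (m : M) :> M.
Proof. exact: (tcar_tev (Gen _ (GenX _ _))). Qed.
Lemma tcar_y v (m : tcar M) : (hy v : rca W c) *: m = ry v (m : M) :> M.
Proof. exact: (tcar_tev (Gen _ (GenY _ _))). Qed.
Lemma tcar_c a (m : tcar M) : (hcst a : rca W c) *: m = a *: (m : M) :> M.
Proof. exact: (tcar_tev (Cst _ a)). Qed.
End TMod.

(** An alias of M on which the K-module structure can be declared beside the one over the
    algebra. *)
Definition kcar (M : lmodType (rca W c)) : Type := M.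

Section KMod.
Variable M : lmodType (rca W c).
HB.instance Definition _ := GRing.Zmodule.on (kcar M).
Definition kscale (a : K) (m : kcar M) : kcar M := (hcst a : rca W c) *: (m : M).
Fact kscaleA a b m : kscale a (kscale b m) = kscale (a * b) m.
Proof. by rewrite /kscale scalerA -[_ * _](pcstM (rca_rel W c)). Qed.
Fact kscale1 : left_id 1 kscale.
Proof. by move=> m; rewrite /kscale [hcst 1](pcst1 (rca_rel W c)) scale1r. Qed.
Fact kscaleDr : right_distributive kscale +%R.
Proof. by move=> a m n; apply: scalerDr. Qed.
Fact kscaleDl m : {morph kscale^~ m : a b / a + b}.
Proof. by move=> a b; rewrite /kscale [hcst _](pcstD (rca_rel W c)) scalerDl. Qed.
HB.instance Definition _ := GRing.Zmodule_isLmodule.Build K (kcar M)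
  kscaleA kscale1 kscaleDr kscaleDl.

Lemma hcstC a (t : rca W c) : hcst a * t = t * hcst a.
Proof. exact: pcstC. Qed.

Fact act_lin (t : rca W c) : linear (fun m : kcar M => t *: (m : M) : kcar M).
Proof.
by move=> a m n; rewrite [LHS](scalerDr t (hcst a *: (m : M)) n) !scalerA -hcstC -scalerA.
Qed.
Definition act t : {linear kcar M -> kcar M} := mklin (act_lin t).


Lemma pi_act_add t t' (m : M) : (\pi_(palg (rca_rel W c)) (Add t t') : rca W c) *: m =
  (\pi_(palg (rca_rel W c)) t : rca W c) *: m + (\pi_(palg (rca_rel W c)) t' : rca W c) *: m.
Proof. by rewrite [\pi_(palg (rca_rel W c)) (Add _ _)]piD [LHS]scalerDl. Qed.
Lemma pi_act_opp t (m : M) : (\pi_(palg (rca_rel W c)) (Opp t) : rca W c) *: m =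
  - ((\pi_(palg (rca_rel W c)) t : rca W c) *: m).
Proof. by rewrite [\pi_(palg (rca_rel W c)) (Opp _)]piN [LHS]scaleNr. Qed.
Lemma pi_act_mul t t' (m : M) : (\pi_(palg (rca_rel W c)) (Mul t t') : rca W c) *: m =
  (\pi_(palg (rca_rel W c)) t : rca W c) *: ((\pi_(palg (rca_rel W c)) t' : rca W c) *: m).
Proof. by rewrite [\pi_(palg (rca_rel W c)) (Mul _ _)]piM scalerA. Qed.

Lemma rel_act t t' (m : M) : rca_rel W c t t' ->
  (\pi_(palg (rca_rel W c)) t : rca W c) *: m = (\pi_(palg (rca_rel W c)) t' : rca W c) *: m.
Proof. by move=> /palg_rel E; congr (_ *: m). Qed.

Program Definition kprech : prech W k :=
  @Prech K gT V W k (kcar M) (fun g => act (hw g)) (fun u => act (hx u)) (fun v => act (hy v))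
  _ _ _ _ _ _ _ _.
Next Obligation.
by have := rel_act m (rca_w1 W c) => E; rewrite [LHS]E [LHS]scale1r.
Qed.
Next Obligation. by have := rel_act m (rca_wM W c g h); rewrite pi_act_mul. Qed.
Next Obligation.
by have := rel_act m (rca_xL W c a u u'); rewrite pi_act_add pi_act_mul.
Qed.
Next Obligation.
by have := rel_act m (rca_yL W c a v v'); rewrite pi_act_add pi_act_mul.
Qed.
Next Obligation. by have := rel_act m (rca_wx W c g u); rewrite !pi_act_mul. Qed.
Next Obligation. by have := rel_act m (rca_wy W c g v); rewrite !pi_act_mul. Qed.
Next Obligation. by have := rel_act m (rca_yy W c v v'); rewrite !pi_act_mul. Qed.
Next Obligation.
have := congr1 (fun t : rca W c => t *: (m : M)) (hyx W c v u).
rewrite !scalerBl -!scalerA scaler_suml => /(canRL (subrK _)) ->.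
rewrite [LHS]addrC -addrA; congr (_ + (_ - _)).
rewrite big_mkcond; apply: eq_bigr => s _; rewrite -hk.
by case: ifP => _; [rewrite -scalerA|rewrite [RHS]scale0r].
Qed.

Lemma kprech_xx : xcomm kprech.
Proof.
move=> u u' m /=.
by have := rel_act m (rca_xx W c u u'); rewrite !pi_act_mul.
Qed.

Definition kmod : chmod W k := Chmod kprech_xx.

Lemma kmod_x u (m : kmod) : rx u m = hx u *: (m : M) :> M. Proof. by []. Qed.
Lemma kmod_c a (m : kmod) : a *: m = hcst a *: (m : M) :> M. Proof. by []. Qed.
Lemma kmod_tev t (m : kmod) : tev t m = (\pi_(palg (rca_rel W c)) t : rca W c) *: (m : M) :> M.
Proof.
elim: t m => [[g|u|v]|a|t IH|t IH t' IH'|t IH t' IH'] m //=.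
- by rewrite pi_act_opp IH.
- by rewrite pi_act_add IH IH'.
- by rewrite pi_act_mul IH IH'.
Qed.
End KMod.
End ScalarExtension.

Section Peval.
Variables (K : fieldType) (gT : finGroupType) (V : vectType K).
Variables (W : linrep gT V) (c : gT -> K).
Let n := \dim {:V}.
Implicit Types (p q : {mpoly K[n]}) (z : 'I_n -> rca W c).

Definition zmon z (m : 'X_{1..n}) : rca W c := \prod_(i < n) z i ^+ m i.

Lemma hcst0 : hcst 0 = 0 :> rca W c. Proof. exact: pcst0. Qed.
Lemma hcst1 : hcst 1 = 1 :> rca W c. Proof. exact: pcst1. Qed.
Lemma hcstD a b : hcst (a + b) = hcst a + hcst b :> rca W c. Proof. exact: pcstD. Qed.
Lemma hcstM a b : hcst (a * b) = hcst a * hcst b :> rca W c. Proof. exact: pcstM. Qed.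
Lemma hcstB a b : hcst (a - b) = hcst a - hcst b :> rca W c.
Proof. by apply: (addIr (hcst b)); rewrite -hcstD !subrK. Qed.

(** [peval] sums over the support of p, which varies with p; a common set of monomials of bounded
    degree makes linearity visible. *)
Lemma pevalE z k p : (msize p <= k)%N ->
  peval z p = \sum_(m : 'X_{1..n < k}) hcst p@_m * zmon z m.
Proof.
move=> le_pk; set I : subFinType _ := 'X_{1..n < k}.
rewrite /peval (big_mksub I) ?msupp_uniq //=; first last.
  by move=> m /msize_mdeg_lt /leq_trans; apply.
rewrite big_rmcond //= => j /memN_msupp_eq0 ->.
by rewrite hcst0 mul0r.
Qed.

Lemma pevalP z a p q : peval z (a *: p + q) = hcst a * peval z p + peval z q.
Proof.
pose k := maxn (msize (a *: p + q)) (maxn (msize p) (msize q)).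
rewrite !(@pevalE _ k) ?leq_max ?leqnn ?orbT //.
rewrite mulr_sumr -big_split; apply: eq_bigr => m _.
by rewrite mcoeffD mcoeffZ hcstD hcstM mulrDl mulrA.
Qed.

Lemma pevalX z m : peval z 'X_[m] = zmon z m.
Proof. by rewrite /peval msuppX big_seq1 mcoeffX eqxx hcst1 mul1r. Qed.

Variable z : 'I_n -> rca W c.
Hypothesis zC : forall i j, z i * z j = z j * z i.

Fact peval_additive : zmod_morphism (peval z).
Proof.
move=> p q; have -> : p - q = -1 *: q + p by rewrite scaleN1r addrC.
have hN1 : hcst (-1) = -1 :> rca W c by rewrite -(sub0r (1 : K)) hcstB hcst0 hcst1 sub0r.
by rewrite pevalP hN1 mulN1r addrC.
Qed.

Lemma zmonD m m' : zmon z (m + m')%MM = zmon z m * zmon z m'.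
Proof.
rewrite /zmon -prodrM_comm => [|i j _ _].
  by apply: eq_bigr => i _; rewrite mnmDE exprD.
by apply: commrX; apply/commr_sym; apply: commrX; apply: zC.
Qed.

Fact peval_multiplicative : monoid_morphism (peval z).
Proof.
split=> [|p q].
  rewrite -mpolyX0 pevalX /zmon big1 // => i _; by rewrite mnm0E.
elim/mpolyind: p => [|a m p _ _ IH].
  by rewrite mul0r; move: (peval_additive 0 0); rewrite !subrr => ->; rewrite mul0r.
rewrite mulrDl -scalerAl !pevalP IH mulrDl -mulrA; congr (_ * _ + _).
elim/mpolyind: q {IH} => [|b m' q _ _ IH].
  by rewrite mulr0; move: (peval_additive 0 0); rewrite !subrr => ->; rewrite mulr0.
rewrite mulrDr -scalerAr !pevalP IH mulrDr mulrA -hcstC -mulrA; congr (_ * _ + _).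
by rewrite -mpolyXD !pevalX zmonD.
Qed.
End Peval.

Section PolyMod.
Variables (K : fieldType) (gT : finGroupType) (V : vectType K).
Variables (W : linrep gT V) (c : gT -> K) (k : gT -> K).
Hypothesis hk : scalar_match W c k.
Let n := \dim {:V}.
Implicit Types (p q : {mpoly K[n]}).
Local Notation b i := (vbasis {:V})`_i.

Lemma hyC v v' : hy v * hy v' = hy v' * hy v :> rca W c.
Proof. by have := palg_rel (rca_yy W c v v'); rewrite !piM. Qed.
Lemma hxC u u' : hx u * hx u' = hx u' * hx u :> rca W c.
Proof. by have := palg_rel (rca_xx W c u u'); rewrite !piM. Qed.

HB.instance Definition _ := GRing.isZmodMorphism.Build _ _ (pevaly W c)
  (@peval_additive _ _ _ W c _).
HB.instance Definition _ := GRing.isMonoidMorphism.Build _ _ (pevaly W c)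
  (peval_multiplicative (fun i j => hyC _ _)).
HB.instance Definition _ := GRing.isZmodMorphism.Build _ _ (pevalx W c)
  (@peval_additive _ _ _ W c _).
HB.instance Definition _ := GRing.isMonoidMorphism.Build _ _ (pevalx W c)
  (peval_multiplicative (fun i j => hxC _ _)).

Lemma peval_X1 z (i : 'I_n) : peval z 'X_i = z i :> rca W c.
Proof.
rewrite pevalX /zmon (eq_bigr (fun j => if j == i then z i else 1)) => [|j _].
  by rewrite -big_mkcond big_pred1_eq.
by rewrite mnm1E eq_sym; case: eqP => [->|].
Qed.

Lemma peval_C z (a : K) : peval z a%:MP = hcst a :> rca W c.
Proof.
have := pevalP z a 1 0; rewrite addr0 -mul_mpolyC mulr1 => ->.
rewrite -mpolyX0 pevalX /zmon big1 => [|i _]; last by rewrite mnm0E.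
rewrite mulr1 -[RHS]addr0; congr (_ + _).
by rewrite /peval msupp0 big_nil.
Qed.

Lemma pevalZ z (a : K) p : peval z (a *: p) = hcst a * peval z p :> rca W c.
Proof. by rewrite -[a *: p]addr0 pevalP [X in _ + X]/peval msupp0 big_nil addr0. Qed.

Lemma hxP a u u' : hx (a *: u + u') = hcst a * hx u + hx u' :> rca W c.
Proof. by have := palg_rel (rca_xL W c a u u'); rewrite piD piM. Qed.
Lemma hyP a v v' : hy (a *: v + v') = hcst a * hy v + hy v' :> rca W c.
Proof. by have := palg_rel (rca_yL W c a v v'); rewrite piD piM. Qed.
Lemma hx0 : hx 0 = 0 :> rca W c.
Proof. by apply: (addrI (hx 0)); rewrite addr0 -{3}[0](addr0 0) -{3}[0](scale1r 0) hxP hcst1 mul1r. Qed.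
Lemma hy0 : hy 0 = 0 :> rca W c.
Proof. by apply: (addrI (hy 0)); rewrite addr0 -{3}[0](addr0 0) -{3}[0](scale1r 0) hyP hcst1 mul1r. Qed.
Lemma hx_lin (r : seq 'I_n) (a : 'I_n -> K) (u : 'I_n -> dual V) :
  hx (\sum_(i <- r) a i *: u i) = \sum_(i <- r) hcst (a i) * hx (u i) :> rca W c.
Proof.
by elim: r => [|i r IH]; rewrite ?big_nil ?hx0 // !big_cons hxP IH.
Qed.
Lemma hy_lin (r : seq 'I_n) (a : 'I_n -> K) (v : 'I_n -> V) :
  hy (\sum_(i <- r) a i *: v i) = \sum_(i <- r) hcst (a i) * hy (v i) :> rca W c.
Proof.
by elim: r => [|i r IH]; rewrite ?big_nil ?hy0 // !big_cons hyP IH.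
Qed.

Lemma dual_sum (u : dual V) : u = \sum_(i < n) (u (b i) : K) *: dcoord i.
Proof.
apply/lfunP => v; rewrite {1}(coord_vbasis (memvf v)) linear_sum sum_lfunE.
by apply: eq_bigr => i _; rewrite scale_lfunE dcoordE linearZ; apply: mulrC.
Qed.

Definition linform (v : V) : {mpoly K[n]} := \sum_(i < n) coord (vbasis {:V}) i v *: 'X_i.

Lemma linformE v : pevaly W c (linform v) = hy v.
Proof.
rewrite raddf_sum {2}(coord_vbasis (memvf v)) hy_lin.
by apply: eq_bigr => i _; rewrite /= [LHS]pevalZ peval_X1.
Qed.

Variable M : lmodType (rca W c).

Lemma peval_closed z p (P : kmod hk M -> Prop) (m : kmod hk M) : subspace P ->
  (forall i m', P m' -> P (z i *: (m' : M))) -> P m -> P (peval z p *: (m : M)).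
Proof.
move=> hP Pz Pm; rewrite /peval scaler_suml.
apply: (subspace_sum hP) => m' _; rewrite -scalerA.
apply: (subspaceZ hP); rewrite /zmon.
elim: (index_enum _) => [|i r IH]; first by rewrite big_nil scale1r.
rewrite big_cons -scalerA; elim: (m' i) => [|e IHe]; first by rewrite scale1r.
by rewrite exprS -scalerA; apply: Pz.
Qed.

Lemma fg_chP : fg_over_Ch M <-> ch_fg (kmod hk M).
Proof.
split=> [[s sM]|[s sM]]; exists s.
  move=> P hP Px Ps m; have [p ->] := sM m.
  apply: (subspace_sum hP) => i _; apply: peval_closed => //.
    by move=> j m'; apply: Px.
  by apply: Ps; apply: mem_nth.
apply: sM => [|u m [p ->]|m ms].
- split=> [|a m m' [p ->] [p' ->]].
    by exists (fun=> 0); rewrite big1 // => i _; rewrite raddf0 scale0r.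
  exists (fun i => a *: p i + p' i); rewrite [a *: _]kmod_c scaler_sumr -big_split.
  by apply: eq_bigr => i _ /=; rewrite /pevalx pevalP scalerDl -scalerA.
- pose L := \sum_(i < n) (u (b i) : K) *: 'X_i : {mpoly K[n]}.
  have LE : pevalx W c L = hx u.
    rewrite raddf_sum {2}(dual_sum u) hx_lin.
    by apply: eq_bigr => i _; rewrite /= [LHS]pevalZ peval_X1.
  exists (fun i => L * p i); rewrite [rx u _]kmod_x scaler_sumr.
  apply: eq_bigr => i _.
  have -> : pevalx W c (L * p i) = hx u * pevalx W c (p i) by rewrite -LE; apply: rmorphM.
  by rewrite scalerA.
- have im : (index m s < size s)%N by rewrite index_mem.
  exists (fun i => if i == Ordinal im then 1 else 0).
  rewrite (bigD1 (Ordinal im)) //= eqxx rmorph1 scale1r nth_index // big1 ?addr0 // => i /negPf->.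
  by rewrite raddf0 scale0r.
Qed.

End PolyMod.

(** * Generalized eigenvalues and weights *)
Section Radical.
Variables (K : fieldType) (gT : finGroupType) (V : vectType K).
Variables (W : linrep gT V) (c : gT -> K).
Variable M : lmodType (rca W c).
Let n := \dim {:V}.
Implicit Types (p q r : {mpoly K[n]}) (m : M).

Definition pact p m : M := pevaly W c p *: m.

Lemma pactM p q m : pact (p * q) m = pact p (pact q m).
Proof. by rewrite /pact rmorphM scalerA. Qed.
Lemma pactD p q m : pact (p + q) m = pact p m + pact q m.
Proof. by rewrite /pact raddfD scalerDl. Qed.
Lemma pact1 m : pact 1 m = m.
Proof. by rewrite /pact rmorph1 scale1r. Qed.
Lemma pact0 p : pact p 0 = 0.
Proof. exact: scaler0. Qed.
Lemma pact_addr p m m' : pact p (m + m') = pact p m + pact p m'.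
Proof. exact: scalerDr. Qed.

Definition psub (P : M -> Prop) := [/\ P 0, forall m m', P m -> P m' -> P (m + m')
  & forall p m, P m -> P (pact p m)].

Lemma psub0 : psub (fun m => m = 0).
Proof.
split=> [//|m m' -> ->|p m ->]; first by rewrite addr0.
exact: pact0.
Qed.

(** q lies in the radical of the ideal of all p with p m in P. It is used for P zero, giving
    nilpotency at m, and for P the sum of the weight spaces. *)
Definition rad (P : M -> Prop) q m := exists e, P (pact (q ^+ e) m).

Variable P : M -> Prop.
Hypothesis hP : psub P.

Lemma radW q m e e' : (e <= e')%N -> P (pact (q ^+ e) m) -> P (pact (q ^+ e') m).
Proof.
by case: hP => _ _ Pq /subnK <- Pm; rewrite exprD pactM; apply: Pq.
Qed.

(** Induction on the sum of the exponents: (p + q)^(E+1) m is (p + q)^E applied to p m plus the same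
    applied to q m, and each of these has one exponent lowered. *)
Lemma radD p q m : rad P p m -> rad P q m -> rad P (p + q) m.
Proof.
case: hP => _ PD PM; case=> e pe [e' qe'].
have [N] := ubnP (e + e'); elim: N e e' m pe qe' => // N IH [|e] e' m pe qe' lt_N.
  by exists 0%N; rewrite expr0.
case: e' qe' lt_N => [|e'] qe' lt_N; first by exists 0%N; rewrite expr0.
have [|||E1 PE1] := IH e e'.+1 (pact p m).
- by rewrite -pactM -exprSr.
- by rewrite -pactM mulrC pactM; apply: PM.
- by rewrite -ltnS -addSn.
have [|||E2 PE2] := IH e.+1 e' (pact q m).
- by rewrite -pactM mulrC pactM; apply: PM.
- by rewrite -pactM -exprSr.
- by rewrite -ltnS -addnS.
exists (maxn E1 E2).+1; rewrite exprSr mulrDr pactD !pactM.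
by apply: PD; [apply: radW PE1|apply: radW PE2]; rewrite ?leq_maxl ?leq_maxr.
Qed.

Lemma radM r p m : rad P p m -> rad P (r * p) m.
Proof. by case: hP => _ _ PM [e pe]; exists e; rewrite exprMn pactM; apply: PM. Qed.

Lemma rad0 m : rad P 0 m.
Proof. by case: hP => P0 _ _; exists 1%N; rewrite expr1 /pact raddf0 scale0r. Qed.

Lemma rad_sum I (s : seq I) (Q : pred I) (F : I -> {mpoly K[n]}) m :
  (forall i, Q i -> rad P (F i) m) -> rad P (\sum_(i <- s | Q i) F i) m.
Proof. by move=> FP; apply: (big_ind (fun p => rad P p m)) => //; [apply: rad0|move=> *; apply: radD]. Qed.

Lemma rad_exp p m e : rad P (p ^+ e) m -> rad P p m.
Proof. by case=> e' pe; exists (e * e')%N; rewrite exprM. Qed.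

Lemma rad1 m : rad P 1 m -> P m.
Proof. by case=> e; rewrite expr1n pact1. Qed.

Lemma rad_addr q m m' : rad P q m -> rad P q m' -> rad P q (m + m').
Proof.
case: (hP) => _ PD _ [e Pe] [e' Pe']; exists (maxn e e'); rewrite pact_addr.
by apply: PD; [apply: radW Pe|apply: radW Pe']; rewrite ?leq_maxl ?leq_maxr.
Qed.

End Radical.

Section OrbitPoly.
Variables (K : fieldType) (gT : finGroupType) (V : vectType K).
Variables (W : linrep gT V) (c : gT -> K).
Let n := \dim {:V}.
Implicit Types (f p q r : {mpoly K[n]}) (mu : dual V).
Local Notation b i := (vbasis {:V})`_i.

Lemma dual_evalX mu (i : 'I_n) : dual_eval 'X_i mu = mu (b i).
Proof. exact: mevalXU. Qed.

Lemma dual_evalC mu (a : K) : dual_eval a%:MP mu = a.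
Proof. exact: mevalC. Qed.
Lemma dual_evalM mu p q : dual_eval (p * q) mu = dual_eval p mu * dual_eval q mu.
Proof. exact: rmorphM. Qed.
Lemma dual_evalD mu p q : dual_eval (p + q) mu = dual_eval p mu + dual_eval q mu.
Proof. exact: raddfD. Qed.
Lemma dual_evalB mu p q : dual_eval (p - q) mu = dual_eval p mu - dual_eval q mu.
Proof. exact: raddfB. Qed.
Lemma dual_eval1 mu : dual_eval (1 : {mpoly K[n]}) mu = 1.
Proof. exact: rmorph1. Qed.
Lemma dual_eval_prod mu I (s : seq I) (Q : pred I) (F : I -> {mpoly K[n]}) :
  dual_eval (\prod_(i <- s | Q i) F i) mu = \prod_(i <- s | Q i) dual_eval (F i) mu.
Proof. exact: rmorph_prod. Qed.

Lemma dual_eval_linform mu v : dual_eval (linform v) mu = mu v.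
Proof.
rewrite /dual_eval raddf_sum [in RHS](coord_vbasis (memvf v)) linear_sum.
by apply: eq_bigr => i _; rewrite /= mevalZ mevalXU linearZ.
Qed.

Lemma linform_basis (i : 'I_n) : linform (b i) = 'X_i.
Proof.
rewrite /linform (bigD1 i) //= coord_free ?(basis_free (vbasisP _)) // eqxx scale1r.
rewrite big1 ?addr0 // => j /negPf ji.
by rewrite coord_free ?(basis_free (vbasisP _)) // -[_ == _]/(i == j :> 'I_n) eq_sym ji scale0r.
Qed.

(** Precomposition of f with the action of g on the dual, written as a substitution because the
    coordinates of g mu are the values mu(g^-1 b_i). *)
Definition pconj (g : gT) f : {mpoly K[n]} :=
  f \mPo [tuple linform (W g^-1%g (b i)) | i < n].

Lemma dual_eval_pconj g f mu : dual_eval (pconj g f) mu = dual_eval f (dual_repr W g mu).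
Proof.
rewrite /dual_eval comp_mpoly_meval; apply: meval_eq => i.
by rewrite tnth_mktuple [LHS]dual_eval_linform dactE.
Qed.

Lemma pconj1 f : pconj 1%g f = f.
Proof.
rewrite -[RHS]comp_mpoly_id; congr (_ \mPo _); apply: eq_from_tnth => i.
by rewrite !tnth_mktuple invg1 repr1v linform_basis.
Qed.

Definition orbit_poly f : {poly {mpoly K[n]}} := \prod_(g : gT) ('X - (pconj g f)%:P).

Lemma orbit_poly_root f : (orbit_poly f).[f] = 0.
Proof.
by rewrite /orbit_poly (bigD1 1%g) //= pconj1 hornerM hornerXsubC subrr mul0r.
Qed.

Lemma orbit_poly_eval f j mu : dual_eval (orbit_poly f)`_j mu =
  (\prod_(g : gT) ('X - (dual_eval f (dual_repr W g mu))%:P))`_j.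
Proof.
rewrite -[LHS](coef_map (meval (fun i : 'I_n => mu (b i)))) rmorph_prod.
congr ((_ : {poly K})`_j); apply: eq_bigr => g _.
by rewrite /= map_polyXsubC -dual_eval_pconj.
Qed.

Lemma orbit_poly_inv f j : dual_invariant W (orbit_poly f)`_j.
Proof.
move=> g mu; rewrite !orbit_poly_eval; congr ((_ : {poly K})`_j).
rewrite [RHS](reindex_inj (mulIg g)); apply: eq_bigr => h _.
by rewrite dactM.
Qed.

Lemma orbit_poly_size f : size (orbit_poly f) = #|gT|.+1.
Proof. by rewrite size_prod_XsubC cardE enumT.
Qed.

Lemma orbit_poly_lead f : (orbit_poly f)`_#|gT| = 1.
Proof.
have /monicP := @monic_prod_XsubC {mpoly K[n]} gT (index_enum gT) predT (fun g => pconj g f).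
by rewrite lead_coefE -/(orbit_poly f) orbit_poly_size.
Qed.

Variable lambda : dual V.

Definition vanishing f := forall g, dual_eval f (dual_repr W g lambda) = 0.

Lemma orbit_poly_vanish f (j : 'I_#|gT|) : vanishing f ->
  dual_eval (orbit_poly f)`_j lambda = 0.
Proof.
move=> f0; rewrite orbit_poly_eval (eq_bigr (fun=> 'X)) => [|g _].
  by rewrite prodr_const coefXn ltn_eqF // ltn_ord.
by rewrite f0 polyC0 subr0.
Qed.

(** A product over the whole group of affine forms separating h lambda from g lambda; the factor is
    the constant 1 when the two points coincide. *)
Lemma lagrange g : exists f, dual_eval f (dual_repr W g lambda) = 1 /\
  forall h, dual_repr W h lambda <> dual_repr W g lambda ->
    dual_eval f (dual_repr W h lambda) = 0.
Proof.
have ph h : exists p, dual_eval p (dual_repr W g lambda) = 1 /\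
    (dual_repr W h lambda <> dual_repr W g lambda ->
     dual_eval p (dual_repr W h lambda) = 0).
  set mu := dual_repr W g lambda; set nu := dual_repr W h lambda.
  have [->|/eqP munu] := eqVneq nu mu; first by exists 1; rewrite dual_eval1.
  have [v vN] : exists v, (mu v : K) <> nu v.
    apply: contrapT => /forallNP E; apply: munu; apply/lfunP => v.
    by apply: contrapT => vN; apply: (E v) => E'; apply: vN.
  exists (((mu v : K) - nu v)^-1%:MP * (linform v - (nu v : K)%:MP)).
  rewrite !dual_evalM !dual_evalB !dual_evalC !dual_eval_linform subrr mulr0.
  by split=> //; rewrite mulVf // subr_eq0; apply/eqP.
pose p h := projT1 (cid (ph h)).
have [p1 p0] : (forall h, dual_eval (p h) (dual_repr W g lambda) = 1) /\
  (forall h, dual_repr W h lambda <> dual_repr W g lambda ->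
     dual_eval (p h) (dual_repr W h lambda) = 0).
  by split=> h; have [] := projT2 (cid (ph h)).
exists (\prod_h p h); split; first by rewrite dual_eval_prod big1.
by move=> h hg; rewrite dual_eval_prod (bigD1 h) //= p0 // mul0r.
Qed.

End OrbitPoly.

Section Eigen.
Variables (K : fieldType) (gT : finGroupType) (V : vectType K).
Variables (W : linrep gT V) (c : gT -> K) (k : gT -> K).
Hypothesis hk : scalar_match W c k.
Variable M : lmodType (rca W c).
Let n := \dim {:V}.
Local Notation b i := (vbasis {:V})`_i.
Local Notation N := (kmod hk M).
Local Notation nul := (fun m : M => m = 0).
Implicit Types (p q f : {mpoly K[n]}) (m : M) (mu lambda : dual V).

Lemma pevaly_sub f (a : K) : pevaly W c (f - a%:MP) = pevaly W c f - hcst a.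
Proof. by rewrite raddfB; congr (_ - _); apply: peval_C. Qed.

Lemma loc_nilpP f (a : K) :
  acts_loc_nilp M (pevaly W c f - hcst a) <-> forall m, rad nul (f - a%:MP) m.
Proof.
by rewrite -pevaly_sub; split=> E m; have [e me] := E m; exists e; move: me; rewrite /pact rmorphXn.
Qed.

Lemma iter_yshE mu v e m :
  iter e (ysh mu v) (m : N) = (hy v - hcst (mu v : K)) ^+ e *: m :> M.
Proof.
elim: e m => [|e IH] m; first by rewrite scale1r.
by rewrite exprSr -scalerA -IH iterSr yshE scalerBl.
Qed.

Lemma pact_linform mu v e m : pact ((linform v - (mu v : K)%:MP) ^+ e) m =
  (hy v - hcst (mu v : K)) ^+ e *: m.
Proof. by rewrite /pact rmorphXn /= pevaly_sub linformE. Qed.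

Lemma gwt_rad mu m : gwt mu (m : N) <->
  forall v, rad nul (linform v - (mu v : K)%:MP) m.
Proof.
by split=> mw v; have [e me] := mw v; exists e; move: me; rewrite iter_yshE pact_linform.
Qed.

Lemma gwt_basis mu m :
  (forall i : 'I_n, rad nul ('X_i - (mu (b i) : K)%:MP) m) -> gwt mu (m : N).
Proof.
move=> mb; apply/gwt_rad => v.
have -> : linform v - (mu v : K)%:MP =
    \sum_(i < n) (coord (vbasis {:V}) i v)%:MP * ('X_i - (mu (b i) : K)%:MP).
  rewrite [in X in _ - X](coord_vbasis (memvf v)) linear_sum raddf_sum -sumrB.
  by apply: eq_bigr => i _; rewrite mulrBr -mpolyCM mul_mpolyC; congr (_ - _%:MP); apply: dualZ.
apply: rad_sum => [|i _]; first exact: psub0.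
by apply: radM; [exact: psub0|apply: mb].
Qed.

Lemma gwt_pact mu f m : gwt mu (m : N) -> gwt mu (pact f m : N).
Proof.
apply: (@peval_closed _ _ _ _ _ _ hk) => [|i m' mw]; first exact: gwt_subspace.
exact: (@gwt_ry _ _ _ _ _ N).
Qed.

(** The p for which p - p(mu) is nilpotent at m form a subring containing the constants and the
    indeterminates. *)
Lemma gwt_eval mu f m : gwt mu (m : N) -> rad nul (f - (dual_eval f mu)%:MP) m.
Proof.
move=> mw; have h0 := psub0 M.
pose S p := rad nul (p - (dual_eval p mu)%:MP) m.
have SC (a : K) : S a%:MP by rewrite /S dual_evalC subrr; apply: rad0.
have SM p q : S p -> S q -> S (p * q).
  move=> Sp Sq; rewrite /S dual_evalM.
  have -> : p * q - (dual_eval p mu * dual_eval q mu)%:MP =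
      p * (q - (dual_eval q mu)%:MP) + (dual_eval q mu)%:MP * (p - (dual_eval p mu)%:MP).
    by rewrite !mulrBr mpolyCM [_ * p]mulrC addrA subrK [X in _ - X]mulrC.
  exact: (radD h0 (radM h0 _ Sq) (radM h0 _ Sp)).
have SD p q : S p -> S q -> S (p + q).
  move=> Sp Sq; rewrite /S dual_evalD mpolyCD opprD addrACA.
  exact: radD.
have SX (i : 'I_n) : S 'X_i.
  by rewrite /S dual_evalX -linform_basis; move/gwt_rad: mw.
have S1 : S 1 by apply: SC.
have Sexp p e : S p -> S (p ^+ e) by move=> Sp; elim: e => // e; rewrite exprS; apply: SM.
apply: (mpolyind (P := S)) => [|a m' p _ _ Sp]; first by rewrite -mpolyC0.
apply: (SD _ _ _ Sp); rewrite -mul_mpolyC; apply: (SM _ _ (SC a)).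
rewrite -mmap1_id /mmap1; apply: (big_ind S S1 SM) => i _.
exact: Sexp.
Qed.

Lemma gen_eig_of_ch_eig lambda : ch_eig N lambda -> gen_eigenvalue M lambda.
Proof.
move=> Me f fW; apply/loc_nilpP => m; have [F [Fw ->]] := Me m.
apply: (big_ind (rad nul _)) => [|m1 m2|g _].
- by exists 0%N; rewrite pact0.
- by move=> r1 r2; have := rad_addr (psub0 M) r1 r2.
- by have := gwt_eval f (Fw g); rewrite fW.
Qed.

Lemma loc_fin_of_ch_eig lambda : ch_eig N lambda -> locally_finite_h M.
Proof.
move=> Me m; have [E [mE EY]] := eig_yfin (m : N) Me.
have cs : subspace (@cspan _ _ _ _ _ M E : N -> Prop).
  split=> [|a u u' [x ->] [x' ->]].
    by exists (fun=> 0); rewrite big1 // => i _; rewrite hcst0 scale0r.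
  exists (fun i => a * x i + x' i); rewrite [a *: _]kmod_c scaler_sumr -big_split.
  by apply: eq_bigr => i _ /=; rewrite hcstD hcstM scalerDl scalerA.
have cE e : e \in E -> cspan E e.
  move=> eE; have ie : (index e E < size E)%N by rewrite index_mem.
  exists (fun i => if i == Ordinal ie then 1 else 0).
  rewrite (bigD1 (Ordinal ie)) //= eqxx hcst1 scale1r nth_index // big1 ?addr0 // => i /negPf->.
  by rewrite hcst0 scale0r.
exists E; split=> [|v m' [x ->]]; first exact: cE.
rewrite scaler_sumr; apply: (subspace_sum cs) => i _.
rewrite scalerA -hcstC -scalerA; apply: (subspaceZ cs).
by have := EY _ v (mem_nth 0 (ltn_ord i)); apply.
Qed.

Section FromEigenvalue.
Variable lambda : dual V.
Hypothesis Mg : gen_eigenvalue M lambda.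
Local Notation orb g := (dual_repr W g lambda).

(* [f] is a root of its orbit polynomial, whose lower coefficients are         *)
(* invariant and vanish at [lambda], hence act locally nilpotently.            *)
Lemma vanishing_nilp f m : vanishing W lambda f -> rad nul f m.
Proof.
move=> f0; have h0 := psub0 M; apply: (@rad_exp _ _ _ _ _ _ _ _ _ #|gT|).
have := orbit_poly_root W f; rewrite horner_coef orbit_poly_size big_ord_recr /=.
rewrite orbit_poly_lead mul1r addrC => /(canRL (addrK _)) ->.
rewrite sub0r -mulN1r; apply: radM => //; apply: rad_sum => // j _.
rewrite mulrC; apply: radM => //.
have := Mg (orbit_poly_inv W f j); rewrite orbit_poly_vanish // => /loc_nilpP/(_ m).
by rewrite mpolyC0 subr0.
Qed.

Definition wtsum m : Prop := exists F : gT -> M,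
  (forall g, gwt (orb g) (F g : N)) /\ m = \sum_g F g.

Lemma wtsum_psub : psub wtsum.
Proof.
split=> [|m m' [F [Fw ->]] [F' [Fw' ->]]|p m [F [Fw ->]]].
- by exists (fun=> 0); split=> [g|]; [apply: (gwt_subspace _ _).1|rewrite big1].
- exists (fun g => F g + F' g); split; last by rewrite big_split.
  by move=> g; apply: (subspaceD (gwt_subspace _ _)).
- exists (fun g => pact p (F g)); split=> [g|]; first exact: gwt_pact.
  by rewrite /pact scaler_sumr.
Qed.

(** Every Lagrange polynomial L_g, and the product of all 1 - L_g, lies in the radical of the ideal
    sending m into the sum of the weight spaces. Together they generate 1. *)
Lemma ch_eig_of_gen_eig : ch_eig N lambda.
Proof.
move=> m; suff : wtsum m by [].
have hD := wtsum_psub; have h0 := psub0 M.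
pose L g := projT1 (cid (lagrange W lambda g)).
have L1 g : dual_eval (L g) (orb g) = 1 by have [] := projT2 (cid (lagrange W lambda g)).
have L0 g h : orb h <> orb g -> dual_eval (L g) (orb h) = 0.
  by have [_] := projT2 (cid (lagrange W lambda g)); apply.
(* (X_i - (g lambda)(b_i)) L_g vanishes on the orbit, hence is nilpotent at m; with E the largest
   exponent over i, L_g^E m has weight g lambda. *)
have LD g : rad wtsum (L g) m.
  have ex (i : 'I_n) : rad nul (('X_i - (orb g (b i) : K)%:MP) * L g) m.
    apply: vanishing_nilp => h; rewrite dual_evalM dual_evalB dual_evalX dual_evalC.
    have [->|/eqP hg] := eqVneq (orb h) (orb g); first by rewrite subrr mul0r.
    by rewrite L0 // mulr0.
  pose e i := projT1 (cid (ex i)); pose E := \max_i e i.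
  exists E; exists (fun h => if h == g then pact (L g ^+ E) m else 0); split.
    move=> h; case: eqP => [->|_]; last exact: (gwt_subspace _ _).1.
    apply: gwt_basis => i; exists E; rewrite -pactM -exprMn.
    by apply: (radW h0 (leq_bigmax i)); apply: (projT2 (cid (ex i))).
  by rewrite (bigD1 g) //= eqxx big1 ?addr0 // => h /negPf->.
have comp : rad wtsum (1 - \prod_g (1 - L g)) m.
  apply: (big_ind (fun p => rad wtsum (1 - p) m)) => [|p q Dp Dq|g _].
  - by rewrite subrr; apply: rad0.
  - have -> : 1 - p * q = (1 - q) + q * (1 - p).
      by rewrite mulrBr mulr1 addrA subrK [q * p]mulrC.
    by apply: radD => //; apply: radM.
  - by rewrite subKr.
(* The product vanishes on the orbit because L_h equals 1 at h lambda; so it is nilpotent at m. *)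
have prodD : rad wtsum (\prod_g (1 - L g)) m.
  have [e me] : rad nul (\prod_g (1 - L g)) m.
    apply: vanishing_nilp => h; rewrite dual_eval_prod (bigD1 h) //=.
    by rewrite dual_evalB dual_eval1 L1 subrr mul0r.
  by exists e; rewrite me; case: hD.
by apply: (rad1 (W := W) (c := c)); rewrite -(subrK (\prod_g (1 - L g)) 1); apply: radD.
Qed.

End FromEigenvalue.
End Eigen.

(** * Equivalence between algebra modules and operator modules *)

Section Functors.
Local Open Scope quotient_scope.
Variables (K : fieldType) (gT : finGroupType) (V : vectType K).
Variables (W : linrep gT V) (c : gT -> K) (k : gT -> K) (lambda : dual V).
Hypothesis hk : scalar_match W c k.

Definition kobj (M : catO_obj W c lambda) : chO_obj W k lambda :=
  @ChO_obj _ _ _ W k lambda (kmod hk M) ((fg_chP hk M).1 (@Omod_fg _ _ _ _ _ _ M))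
    (ch_eig_of_gen_eig (@Omod_eigen _ _ _ _ _ _ M)).

Section OnHom.
Variables (M N : lmodType (rca W c)) (f : {linear M -> N}).

Fact kfun_lin : linear (f : kmod hk M -> kmod hk N).
Proof. by move=> a u v; apply: (linearP f). Qed.

Definition khom : chom (kmod hk M) (kmod hk N) :=
  @Chom _ _ _ W k (kmod hk M) (kmod hk N) (mklin kfun_lin)
    (fun g m => linearZZ f (hw g) m) (fun u m => linearZZ f (hx u) m)
    (fun v m => linearZZ f (hy v) m).
End OnHom.

Program Definition kfunctor : functor (catO W c lambda) (chO W k lambda) :=
  @Functor (catO W c lambda) (chO W k lambda) kobj (fun M N f => khom f) _ _.
Next Obligation. by apply: chom_eq. Qed.
Next Obligation. by apply: chom_eq. Qed.

Fact tk_lin (N : chmod W k) : linear (id : N -> kmod hk (tcar hk N)).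
Proof. by move=> a u v; apply: (congr1 (fun x : N => x + v) (esym (tcar_c (hk := hk) a u))). Qed.

Definition tk (N : chmod W k) : chom N (kmod hk (tcar hk N)) :=
  @Chom _ _ _ W k N (kmod hk (tcar hk N)) (mklin (@tk_lin N))
    (fun g m => esym (tcar_w (hk := hk) g m)) (fun u m => esym (tcar_x (hk := hk) u m))
    (fun v m => esym (tcar_y (hk := hk) v m)).

Fact kt_lin (N : chmod W k) : linear (id : kmod hk (tcar hk N) -> N).
Proof. by move=> a u v; apply: (congr1 (fun x : N => x + v) (tcar_c (hk := hk) a u)). Qed.

Definition kt (N : chmod W k) : chom (kmod hk (tcar hk N)) N :=
  @Chom _ _ _ W k (kmod hk (tcar hk N)) N (mklin (@kt_lin N))
    (fun g m => tcar_w (hk := hk) g m) (fun u m => tcar_x (hk := hk) u m) (fun v m => tcar_y (hk := hk) v m).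

Lemma chom_eig (M N : chmod W k) (f : chom M N) :
  (forall n, exists m, f m = n) -> ch_eig M lambda -> ch_eig N lambda.
Proof.
move=> fs Me n; have [m <-] := fs n; have [F [Fw ->]] := Me m.
exists (fun g => f (F g)); rewrite linear_sum; split=> // g.
exact: chom_gwt.
Qed.

Lemma tcar_fg (N : chO_obj W k lambda) : fg_over_Ch (tcar hk N).
Proof.
by apply/(fg_chP hk)/(ch_fg_chom (f := tk N)) => [n|]; [exists n|exact: cO_fg].
Qed.

Lemma tcar_eig (N : chO_obj W k lambda) : ch_eig (kmod hk (tcar hk N)) lambda.
Proof.
by apply: (chom_eig (f := tk N)) => [n|]; [exists n|exact: cO_eig].
Qed.

Definition tobj (N : chO_obj W k lambda) : catO_obj W c lambda :=
  @CatO_obj _ _ _ W c lambda (tcar hk N) (tcar_fg N) (loc_fin_of_ch_eig (@tcar_eig N))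
    (gen_eig_of_ch_eig (@tcar_eig N)).

Lemma chom_tev (M N : chmod W k) (f : chom M N) t m : f (tev t m) = tev t (f m).
Proof.
elim: t m => [[g|u|v]|a|t IH|t IH t' IH'|t IH t' IH'] m /=.
- exact: chw.
- exact: chx.
- exact: chy.
- exact: linearZZ.
- by rewrite -IH; apply: raddfN.
- by rewrite -IH -IH'; apply: raddfD.
- by rewrite IH IH'.
Qed.

Fact thom_lin (M N : chmod W k) (f : chom M N) : linear (f : tcar hk M -> tcar hk N).
Proof.
move=> a u v; rewrite [LHS](raddfD f); congr (_ + _).
elim/quotW: a => a; rewrite [LHS](congr1 f (tcar_tev (hk := hk) a u)).
by rewrite chom_tev; apply/esym/tcar_tev.
Qed.

Definition thom (M N : chmod W k) (f : chom M N) : {linear tcar hk M -> tcar hk N} :=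
  HB.pack (f : tcar hk M -> tcar hk N) (GRing.isLinear.Build _ _ _ _ _ (thom_lin f)).

Program Definition tfunctor : functor (chO W k lambda) (catO W c lambda) :=
  @Functor (chO W k lambda) (catO W c lambda) tobj (fun M N f => thom f) _ _.
Next Obligation. by apply: linear_eq. Qed.
Next Obligation. by apply: linear_eq. Qed.

Section TK.
Variable M : lmodType (rca W c).

Lemma tcar_kmod (t : rca W c) (m : tcar hk (kmod hk M)) : t *: m = t *: (m : M) :> M.
Proof. by elim/quotW: t => t; rewrite [LHS]tcar_tev kmod_tev. Qed.

Fact tkm_lin : linear (id : tcar hk (kmod hk M) -> M).
Proof. by move=> a u v; congr (_ + _); apply: tcar_kmod. Qed.
Fact mtk_lin : linear (id : M -> tcar hk (kmod hk M)).
Proof. by move=> a u v; congr (_ + _); apply/esym/tcar_kmod. Qed.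

Definition tkm : {linear tcar hk (kmod hk M) -> M} :=
  HB.pack (id : tcar hk (kmod hk M) -> M) (GRing.isLinear.Build _ _ _ _ _ tkm_lin).
Definition mtk : {linear M -> tcar hk (kmod hk M)} :=
  HB.pack (id : M -> tcar hk (kmod hk M)) (GRing.isLinear.Build _ _ _ _ _ mtk_lin).
End TK.

Lemma tk_iso : nat_iso (compF tfunctor kfunctor) (idF (catO W c lambda)).
Proof.
apply: (@nat_iso_bij _ _ (compF tfunctor kfunctor) (idF (catO W c lambda))
  (fun M => tkm (M : catO_obj W c lambda)) (fun M => mtk (M : catO_obj W c lambda))).
  by move=> M N f; apply: linear_eq.
by move=> M; split; apply: linear_eq.
Qed.

Lemma kt_iso : nat_iso (compF kfunctor tfunctor) (idF (chO W k lambda)).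
Proof.
apply: (@chO_nat_iso _ _ _ _ _ _ lambda (compF kfunctor tfunctor) (idF (chO W k lambda))
  (fun N => kt (N : chO_obj W k lambda))).
- by move=> M N f; apply: chom_eq.
- by move=> N m m'.
- by move=> N n; exists n.
Qed.

Lemma kfunctor_equivalence : is_equivalence kfunctor.
Proof. by exists tfunctor; split; [apply: tk_iso|apply: kt_iso]. Qed.

Lemma tfunctor_equivalence : is_equivalence tfunctor.
Proof. by exists kfunctor; split; [apply: kt_iso|apply: tk_iso]. Qed.
End Functors.

(** * The composite functor and its naturality *)

Section Restriction.
Variables (K : fieldType) (gT : finGroupType) (V : vectType K).
Variables (W : linrep gT V) (c : gT -> K) (lambda : dual V).
Hypothesis K_char : forall n, (n.+1%:R : K) != 0.
Hypothesis c_inv : forall s g, is_reflection W s -> c (s ^ g)%g = c s.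

Let k := rca_coef W c.
Let G := Wstab W lambda.
Let kl (s : [subg G]) : K := k (sgval s).

Lemma card_char (T : finGroupType) (H : {group T}) : (#|H|%:R : K) != 0.
Proof. by rewrite -(prednK (cardG_gt0 H)). Qed.

Lemma finGroup_char (T : finGroupType) : (#|T|%:R : K) != 0.
Proof. by rewrite -cardsT; apply: card_char. Qed.

Lemma rca_match : scalar_match W c k.
Proof. by move=> s v u; apply: rca_coefP. Qed.

Lemma quot_match : scalar_match (Wstab_quot W lambda) (Wstab_param W c lambda) kl.
Proof.
move=> s v u; rewrite rca_coefP // rca_coef_quot; last exact: finGroup_char.
by rewrite rca_coef_res.
Qed.

Definition psi : functor (catO W c lambda)
    (catO (Wstab_quot W lambda) (Wstab_param W c lambda) 0) :=
  compF (tfunctor 0 quot_match)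
    (compF (par_functor kl (finGroup_char _) K_char (@WR_fix _ _ _ W lambda))
      (compF (res_functor (rca_coef_inv K_char c_inv) (@rca_coef_rank1 _ _ _ _ _) (card_char _))
        (kfunctor lambda rca_match))).

Lemma psi_equivalence : is_equivalence psi.
Proof.
apply: is_equivalence_comp; last exact: tfunctor_equivalence.
apply: is_equivalence_comp; last exact: par_equivalence.
by apply: is_equivalence_comp; [exact: kfunctor_equivalence|exact: res_equivalence].
Qed.

Local Notation rho := (Wstab_repr W lambda).
Local Notation resM M := (res_obj (rca_coef_inv K_char c_inv) (@rca_coef_rank1 _ _ _ _ _)
  (card_char (Wstab W lambda)) (kobj rca_match M)).

(** The functors composing [psi] either keep the vectors or pass to a subspace, so the comparison
    map is two inclusions: of the joint kernel in the weight space and of the latter in M. *)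
Definition iota (M : catO_obj W c lambda)
    (u : (psi M : catO_obj (Wstab_quot W lambda) (Wstab_param W c lambda) 0)) : M :=
  subval (subval (u : parmod lambda (resM M)) : wtmod lambda (kmod rca_match M)).

Lemma psi_restricts : restricts_naturally psi.
Proof.
exists iota; split=> [M|M N f u]; last by [].
pose N := kmod rca_match M.
split.
- by move=> u u' E; do 2!apply: submod_inj.
- move=> m; split=> [[mw mf]|[u <-]].
    have Nw : gwt lambda (m : N).
      by move=> v; have [e me] := mw v; exists e; rewrite iter_yshE.
    pose n : wtmod lambda N := tosub (gwt_subspace N lambda) Nw.
    have Pn : parP lambda (n : resM M).
      move=> v vU; apply: submod_inj; rewrite wt_shiftE [subval n]/= yshE.
      by apply/eqP; rewrite subr_eq0; apply/eqP/mf.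
    by exists (tosub (parP_subspace lambda (resM M)) Pn).
  split=> [v|v vU].
    have [e me] := submodP (subval (u : parmod lambda (resM M)) : wtmod lambda N) v.
    by exists e; rewrite -(iter_yshE rca_match).
  have := submodP (u : parmod lambda (resM M)) v vU.
  move=> /(congr1 (fun x : wtmod lambda N => subval x)).
  by rewrite wt_shiftE yshE => /eqP; rewrite subr_eq0 => /eqP.
- move=> a u u'; pose x := subval (subval (u : parmod lambda (resM M)) : wtmod lambda N).
  pose x' := subval (subval (u' : parmod lambda (resM M)) : wtmod lambda N).
  transitivity (a *: x + x'); last by [].
  rewrite /x -!subvalZ -!subvalD.
  by rewrite /iota (congr1 (fun z : parmod lambda (resM M) => z + u') (tcar_c (hk := quot_match) a u)).
- by move=> g u; rewrite /iota (tcar_w (hk := quot_match) g u) par_wE wt_wE.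
- move=> v u; rewrite /iota (tcar_y (hk := quot_match) (qproj _ v) u) par_y_proj.
  by rewrite wt_shiftE yshE scalerBl.
Qed.

End Restriction.

Theorem corollary3p3 (R : realType) (h : vectType R[i]) (gT : finGroupType)
  (W : linrep gT h) (W_faithful : injective W)
  (c : gT -> R[i])
  (c_inv : forall s g : gT, is_reflection W s -> c (s ^ g)%g = c s)
  (lambda : dual h) :
  exists psi : functor (catO W c lambda)
                       (catO (Wstab_quot W lambda) (Wstab_param W c lambda) 0),
    is_equivalence psi /\ restricts_naturally psi.
Proof.
have K_char n : (n.+1%:R : R[i]) != 0 by rewrite Num.Theory.pnatr_eq0.
exists (psi lambda K_char c_inv).
by split; [apply: psi_equivalence|apply: psi_restricts].
Qed.
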